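(* Let $\Omega$ be a bounded open domain of $\mathbb{R}^d$ with $d\ge 1$. Let $(u_\varepsilon)_{\varepsilon>0}$ be a bounded sequence of functions in $L^2(\Omega)$. Let $(p_n)_{n\in\mathbb{N}}$ be an increasing sequence of positive real numbers such that for every $n$, $p_{n+1}$ is an integer multiple of $p_n$. Set $M_n:=p_n/p_0$ for $n\ge 0$ and $m_n:=p_n/p_{n-1}$ for $n\ge 1$. Let $(\varepsilon_k)_{k\in\mathbb{N}}$ be a decreasing sequence of positive real numbers converging to $0$ such that, for every non-negative integer $n$, the sequence $(u_{\varepsilon_k})_{k\in\mathbb{N}}$ $p_n$-two-scale converges to $u_{0,p_n}$. Set $$\widetilde{w}_n:\Omega\times[0,p_0]^d\times[0,1]^d\to\mathbb{R},\qquad (x,y,y')\mapsto u_{0,p_n}\big(x,\;p_0\lfloor M_nH_n(y')\rfloor+y\big),$$ where $H_n$ is the shuffle function associated with $(M_n)$ and $(m_n)$ and $u_{0,p_n}$ is extended $p_n$-periodically in its last $d$ variables. Then the sequence $(\widetilde{w}_n)_{n\in\mathbb{N}}$ is a martingale, bounded in $L^2(\Omega\times[0,p_0]^d\times[0,1]^d)$, for the filtration $$\mathcal{F}_n=\mathcal{B}(\Omega)\times\mathcal{B}([0,p_0]^d)\times\sigma\Big\{\prod_{i=1}^d\Big[\tfrac{\beta_i}{M_n},\tfrac{\beta_i+1}{M_n}\Big[\;:\;\beta\in\{0,\dots,M_n-1\}^d\Big\}.$$ Moreover, $\widetilde{w}_n$ converges, both strongly in $L^2(\Omega\times[0,p_0]^d\times[0,1]^d)$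 and almost everywhere in $\Omega\times[0,p_0]^d\times[0,1]^d$, to a function $\widetilde{w}_\infty$ (called the Two-Scale Shuffle limit). Moreover, for every $n$ and all sets $A\in\mathcal{F}_n$, $$\iiint_A\widetilde{w}_n(x,y,y')\,dy'\,dy\,dx=\iiint_A\widetilde{w}_\infty(x,y,y')\,dy'\,dy\,dx,$$ i.e. $\widetilde{w}_n=\mathbb{E}(\widetilde{w}_\infty\mid\mathcal{F}_n)$.
   Context: Two-scale convergence. For $p>0$ let $Y_p=[0,p]^d$ and let $\mathcal{C}_\#(Y_p)$ be the set of continuous functions on $\mathbb{R}^d$ that are $p$-periodic in each variable. A sequence $(u_{\varepsilon_k})_k$ in $L^2(\Omega)$, with $\varepsilon_k\to0$, $p$-two-scale converges to $u_{0,p}\in L^2(\Omega\times Y_p)$ if $$\lim_{k\to\infty}\int_\Omega u_{\varepsilon_k}(x)\,\psi\Big(x,\frac{x}{\varepsilon_k}\Big)dx=\frac1{p^d}\int_\Omega\int_{Y_p}u_{0,p}(x,y)\psi(x,y)\,dy\,dx$$ for all $\psi\in L^2(\Omega;\mathcal{C}_\#(Y_p))$. The function $u_{0,p}$ is identified with its extension to $\Omega\times\mathbb{R}^d$ that is $p$-periodic in each of the last $d$ variables. Shuffle function $H_n$. For positive integers $M,m$, define $$R_{M,m}:\{0,\dots,Mm-1\}\to\{0,\dots,Mm-1\},\quad R_{M,m}(i)=M\cdot(i\bmod m)+\lfloor i/m\rfloor,$$ $$h^*_{M,m}:[0,1[\to[0,1[,\quad h^*_{M,m}(y')=\frac{R_{M,m}(\lfloor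 Mmy'\rfloor)}{Mm}+\Big(y'-\frac{\lfloor Mmy'\rfloor}{Mm}\Big).$$ Set $H^*_n:=h^*_{M_{n-1},m_n}\circ\dots\circ h^*_{M_1,m_2}\circ h^*_{M_0,m_1}$ (with $H_0^*$ the identity), and $H_n:[0,1[^d\to[0,1[^d$, $H_n(y'_1,\dots,y'_d)=(H^*_n(y'_1),\dots,H^*_n(y'_d))$. The floor $\lfloor\cdot\rfloor$ of a vector is taken componentwise. (The set where some $y'_i=1$ is Lebesgue-null and is ignored.) Martingales. All spaces carry Lebesgue measure; $\mathcal{B}$ denotes the Borel $\sigma$-field, $\sigma\{\cdot\}$ the generated $\sigma$-field, and the product of $\sigma$-fields is the product $\sigma$-field. A filtration is a nondecreasing sequence of $\sigma$-fields. For a sub-$\sigma$-field $\mathcal{G}$, $\mathbb{E}(f\mid\mathcal{G})$ is the a.e. unique $\mathcal{G}$-measurable function $g$ with $\int_B g=\int_B f$ for all $B\in\mathcal{G}$. A sequence $(f_n)$ is an $(\mathcal{F}_n)$-martingale if $f_n=\mathbb{E}(f_{n+j}\mid\mathcal{F}_n)$ for all $n,j\ge0$ (as equality of functions up to null sets). *)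

(* Defs.v *)
From HB Require Import structures.
From mathcomp Require Import all_boot all_order all_algebra.
From mathcomp Require Import all_classical all_reals all_analysis.
From mathcomp Require Import measurable_realfun.

Set Implicit Arguments.
Unset Strict Implicit.
Unset Printing Implicit Defensive.

Import Order.TTheory GRing.Theory Num.Theory.
Import numFieldNormedType.Exports.

Local Open Scope classical_set_scope.
Local Open Scope ring_scope.

(* The library puts no measurable structure on matrices: row vectors get the
   sigma-field generated by the open sets. *)
Section borel_rV.
Context (R : realType).

HB.instance Definition _ d := @isMeasurable.Build
  (sigma_display (@open 'rV[R]_d)) 'rV[R]_d <<s (@open 'rV[R]_d) >>
  (@sigma_algebra0 _ setT _) (@sigma_algebraC _ _)
  (@sigma_algebra_bigcup _ setT _).

Context (d : nat).

Lemma open_measurable_rV (U : set 'rV[R]_d) : open U -> measurable U.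
Proof. exact: sub_sigma_algebra. Qed.

Lemma measurable_coord (i : 'I_d) :
  measurable_fun setT (fun v : 'rV[R]_d => v 0 i).
Proof.
apply: (measurability _ (RGenOpens.measurableE R)).
move=> _ [_ [a [b ->] <-]]; rewrite setTI; apply: open_measurable_rV.
have /continuousP := @coord_continuous R 1 d 0 i; apply.
exact: interval_open.
Qed.

(* A ball with rational centre and radius [1 / k.+1]. *)
Let rball (qk : 'rV[rat]_d * nat) : set 'rV[R]_d :=
  ball (map_mx ratr qk.1 : 'rV[R]_d) (qk.2.+1%:R^-1).

Let open_bigcup_rball (U : set 'rV[R]_d) : open U ->
  U = \bigcup_(qk in [set qk | rball qk `<=` U]) rball qk.
Proof.
move=> oU; apply/seteqP; split=> [v Uv|v [qk /= sub /sub //]].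
have /nbhs_ballP[e /= e0 eU] : nbhs v U by exact: open_nbhs_nbhs.
have [k ke] : exists k : nat, k.+1%:R^-1 < e / 2.
  have e20 : 0 < e / 2 by rewrite divr_gt0.
  near \oo => k; exists k.
  near: k; exact: near_infty_natSinv_lt (PosNum e20).
pose r : R := k.+1%:R^-1.
have r0 : 0 < r by rewrite invr_gt0.
have qP (i : 'I_d) : exists q : rat, ball (v 0 i) r (ratr q).
  have [||vq [bq [q _ qE]]] := @dense_rat R (ball (v 0 i) r).
  - by exists (v 0 i); exact: ballxx.
  - exact: ball_open.
  - by exists q; rewrite qE.
pose w : 'rV[rat]_d := \row_i projT1 (cid (qP i)).
have vw : ball v r (map_mx ratr w : 'rV[R]_d).
  by split=> // i j; rewrite !mxE ord1; exact: projT2 (cid (qP j)).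
exists (w, k); last by rewrite /rball/=; exact: ball_sym.
move=> u; rewrite /rball/= => wu; apply: eU.
rewrite [e]splitr; apply: (@ball_triangle _ _ (map_mx ratr w : 'rV[R]_d)).
  exact: le_ball (ltW ke) _ vw.
exact: le_ball (ltW ke) _ wu.
Unshelve. all: by end_near. Qed.

Lemma measurable_fun_rV d' (T : measurableType d') (f : T -> 'rV[R]_d) :
  (forall i, measurable_fun setT (fun t => f t 0 i)) -> measurable_fun setT f.
Proof.
move=> mf; apply: (@measurability _ _ _ _ _ _ (@open 'rV[R]_d)) => //.
move=> _ [U oU <-]; rewrite setTI (open_bigcup_rball oU) preimage_bigcup.
rewrite [X in measurable X](_ : _ = \bigcup_n
    (if unpickle n is Some qk then
       if `[< rball qk `<=` U >] then f @^-1` rball qk else set0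
     else set0)); last first.
  apply/seteqP; split=> [t [qk /= sub tqk]|t [n _]].
    by exists (pickle qk) => //; rewrite pickleK asboolT.
  by case: unpickle => // qk; case: asboolP => // ? ?; exists qk.
apply: bigcupT_measurable => n; case: unpickle => // -[q k].
case: asboolP => // _.
rewrite [X in measurable X](_ : _ = \bigcap_(i in [set: 'I_d])
    (fun t => f t 0 i) @^-1` ball (ratr (q 0 i) : R) (k.+1%:R^-1)).
  apply: fin_bigcap_measurable => // i _.
  rewrite -[X in measurable X]setTI; apply: mf => //.
  by apply: open_measurable; exact: ball_open.
apply/seteqP; split=> [t [? /= h] i _|t /= h].
  by have := h 0 i; rewrite mxE.
by split=> [|i j]; rewrite ?invr_gt0// mxE ord1; exact: h.
Qed.

End borel_rV.

(* [rV_cons] identifies [R * R^d] with [R^(d + 1)]; Lebesgue measure on [R^d] is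
   the d-fold product of Lebesgue measure on [R] carried along it. *)
Section lebesgue_rV.
Context (R : realType).

Definition rV_cons d (z : measurableTypeR R * 'rV[R]_d) : 'rV[R]_d.+1 :=
  \row_i (if unlift ord0 i is Some j then z.2 0 j else z.1).

Definition rV_uncons d (v : 'rV[R]_d.+1) : measurableTypeR R * 'rV[R]_d :=
  (v 0 ord0, \row_i v 0 (lift ord0 i)).

Lemma measurable_rV_cons d : measurable_fun setT (@rV_cons d).
Proof.
apply: measurable_fun_rV => i; rewrite /rV_cons.
case: (unliftP ord0 i) => [j|] ->.
  under eq_fun do rewrite mxE liftK.
  exact: (measurableT_comp (@measurable_coord R d j) measurable_snd).
under eq_fun do rewrite mxE unlift_none.
exact: measurable_fst.
Qed.

Lemma measurable_rV_uncons d : measurable_fun setT (@rV_uncons d).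
Proof.
apply/measurable_fun_pairP; split; first exact: measurable_coord.
apply: measurable_fun_rV => i.
under eq_fun do rewrite mxE.
exact: measurable_coord.
Qed.

Lemma rV_consK d : cancel (@rV_cons d) (@rV_uncons d).
Proof.
move=> [a v]; rewrite /rV_uncons /rV_cons mxE unlift_none; congr pair.
by apply/rowP => i; rewrite !mxE liftK.
Qed.

Section step.
Context (d : nat) (mu : {sigma_finite_measure set 'rV[R]_d -> \bar R}).

Definition lebesgue_rV_step : set 'rV[R]_d.+1 -> \bar R :=
  pushforward (@lebesgue_measure R \x mu)%E (@rV_cons d).

Let step_measure : {measure set 'rV[R]_d.+1 -> \bar R} :=
  @measure_function_pushforward__canonical__measure_function_Measure
    _ _ _ _ _ (@lebesgue_measure R \x mu)%E _ (@measurable_rV_cons d).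

HB.instance Definition _ := isMeasure.Build _ _ _ lebesgue_rV_step
  (measure0 step_measure) (measure_ge0 step_measure)
  (@measure_semi_sigma_additive _ _ _ step_measure).

Let sigma_finite_step : sigma_finite setT lebesgue_rV_step.
Proof.
have /sigma_finiteP[F [FT ndF Foo]] := sigma_finiteT (@lebesgue_measure R).
have /sigma_finiteP[G [GT ndG Goo]] := sigma_finiteT mu.
exists (fun n => @rV_uncons d @^-1` (F n `*` G n)) => [|n].
  apply/seteqP; split=> // v _.
  have [a _ Fa] : (\bigcup_i F i) (rV_uncons v).1 by rewrite -FT.
  have [b _ Gb] : (\bigcup_i G i) (rV_uncons v).2 by rewrite -GT.
  exists (maxn a b) => //; split.
    by move: Fa; exact/subsetPset/ndF/leq_maxl.
  by move: Gb; exact/subsetPset/ndG/leq_maxr.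
have [mF Fn] := Foo n; have [mG Gn] := Goo n.
split.
  rewrite -[X in measurable X]setTI.
  by apply: measurable_rV_uncons => //; exact: measurableX.
rewrite /lebesgue_rV_step /pushforward.
rewrite -comp_preimage (_ : _ \o _ = id); last exact/funext/rV_consK.
by rewrite preimage_id product_measure1E// lte_mul_pinfty// ge0_fin_numE.
Qed.

HB.instance Definition _ := Measure_isSigmaFinite.Build _ _ _ lebesgue_rV_step
  sigma_finite_step.
End step.

Fixpoint lebesgue_rV d : {sigma_finite_measure set 'rV[R]_d -> \bar R} :=
  if d is d'.+1 then lebesgue_rV_step (lebesgue_rV d') else \d_(0 : 'rV[R]_0).

Lemma lebesgue_rV_box d (a b : 'rV[R]_d) : (forall i, a 0 i <= b 0 i) ->
  lebesgue_rV d [set v | forall i, a 0 i <= v 0 i <= b 0 i] =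
  (\prod_i (b 0 i - a 0 i))%:E.
Proof.
elim: d => [|d IH] in a b *; move=> ab.
  by rewrite /= diracE big_ord0 mem_set// => -[].
rewrite /= /lebesgue_rV_step /pushforward.
pose a' := (rV_uncons a).2; pose b' := (rV_uncons b).2.
have mbox : measurable [set v : 'rV[R]_d | forall i, a' 0 i <= v 0 i <= b' 0 i].
  rewrite [X in measurable X](_ : _ = \bigcap_(i in [set: 'I_d])
      (fun v : 'rV[R]_d => v 0 i) @^-1` `[a' 0 i, b' 0 i]%classic); last first.
    apply/seteqP; split=> [v h i _|v h i]; first by rewrite /= in_itv/= h.
    by have := h i I; rewrite /= in_itv.
  apply: fin_bigcap_measurable => // i _.
  by rewrite -[X in measurable X]setTI; exact: measurable_coord.
rewrite [X in product_measure1 _ _ X](_ : _ = `[a 0 ord0, b 0 ord0]%classic `*`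
    [set v : 'rV[R]_d | forall i, a' 0 i <= v 0 i <= b' 0 i]); last first.
  apply/seteqP; split=> [[x v]/= h|[x v]/= [h0 h] i].
    split=> [|i]; first by have := h ord0; rewrite mxE unlift_none in_itv.
    by have := h (lift ord0 i); rewrite !mxE liftK.
  case: (unliftP ord0 i) => [j|] ->; last by rewrite mxE unlift_none; rewrite in_itv in h0.
  by have := h j; rewrite !mxE liftK.
rewrite product_measure1E// IH => [|i]; last by rewrite !mxE.
have /= -> := @lebesgue_measure_itv R `[a 0 ord0, b 0 ord0].
rewrite lte_fin big_ord_recl EFinM.
congr (_ * _)%E; last by congr (_%:E); apply: eq_bigr => i _; rewrite !mxE.
have := ab ord0; rewrite le_eqVlt => /orP[/eqP->|->]; last by rewrite EFinB.
by rewrite ltxx subrr.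
Qed.

End lebesgue_rV.

Section L2.
Context d (T : measurableType d) (R : realType).
Variable mu : {measure set T -> \bar R}.

(* Square-integrable functions on [D] are represented by total functions whose
   values outside [D] are irrelevant: [f \_ D] is [f] extended by 0. *)
Definition L2 (D : set T) : set (T -> R) :=
  [set f | f \_ D \in Lfun mu 2%:E].

Definition L2norm (D : set T) (f : T -> R) : \bar R :=
  ('N[mu]_2%:E [EFin \o (f \_ D)])%E.

End L2.

Section martingale.
Context d (T : measurableType d) (R : realType).
Variables (mu : {measure set T -> \bar R}) (D : set T).

Definition filtration (F : nat -> set (set T)) :=
  (forall n, sigma_algebra D (F n) /\ F n `<=` measurable) /\
  (forall n, F n `<=` F n.+1).

Definition measurable_for (G : set (set T)) (g : T -> R) :=
  forall B : set R, measurable B -> G (D `&` g @^-1` B).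

Definition cond_exp_version (G : set (set T)) (f g : T -> R) :=
  [/\ mu.-integrable D (EFin \o f), mu.-integrable D (EFin \o g),
      measurable_for G g &
      forall B, G B -> \int[mu]_(z in B) g z = \int[mu]_(z in B) f z].

(* [h = E(f | G)] as classes modulo null sets. *)
Definition is_cond_exp (G : set (set T)) (f h : T -> R) :=
  exists2 g, cond_exp_version G f g & h = g %[ae mu in D].

Definition martingale (F : nat -> set (set T)) (f : nat -> T -> R) :=
  forall n j, is_cond_exp (F n) (f (n + j)%N) (f n).

End martingale.

Section two_scale.
Context (R : realType) (d : nat).
Local Notation E := 'rV[R]_d.
Local Notation leb := (lebesgue_rV R d).

Definition cube (p : R) : set E := [set y | forall i, 0 <= y 0 i <= p].

Definition periodic (p : R) (g : E -> R) :=
  forall y i, g (y + p *: delta_mx 0 i) = g y.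

Definition Cper (p : R) : set (E -> R) :=
  [set g | continuous g /\ periodic p g].

Definition sup_norm (g : E -> R) : R := sup (range (fun y => `|g y|)).

Definition Cper_simple (p : R) (s : E -> E -> R) :=
  exists (N : nat) (A : 'I_N -> set E) (g : 'I_N -> E -> R),
    [/\ forall j, measurable (A j), forall j, Cper p (g j) &
        forall x y, s x y = \sum_(j < N) \1_(A j) x * g j y].

(* The Bochner space [L^2(Omega; Cper p)], [Cper p] being normed by [sup_norm]:
   strong measurability is a.e. approximation by simple functions. *)
Definition L2_Cper (Omega : set E) (p : R) (psi : E -> E -> R) :=
  [/\ forall x, Omega x -> Cper p (psi x),
      exists2 s : nat -> E -> E -> R, forall k, Cper_simple p (s k) &
        {ae leb, forall x, Omega x ->
          (fun k => sup_norm (s k x \- psi x)) @ \oo --> (0 : R)} &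
      (\int[leb]_(x in Omega) (sup_norm (psi x) ^+ 2)%:E < +oo)%E].

Definition two_scale_cvg (Omega : set E) (p : R) (eps : nat -> R)
    (v : nat -> E -> R) (u0 : E * E -> R) :=
  L2 (leb \x leb)%E (Omega `*` cube p) u0 /\
  forall psi, L2_Cper Omega p psi ->
    (fun k => \int[leb]_(x in Omega) (v k x * psi x ((eps k)^-1 *: x))) @ \oo -->
    (p ^+ d)^-1 *
      \int[leb]_(x in Omega) (\int[leb]_(y in cube p) (u0 (x, y) * psi x y)).

Definition floor_rV (y : E) : E := \row_i (Num.floor (y 0 i))%:~R.

Definition periodic_ext (p : R) (f : E * E -> R) (x y : E) : R :=
  f (x, y - p *: floor_rV (p^-1 *: y)).

End two_scale.

Section shuffle.
Context (R : realType).

Definition R_shuffle (M m i : nat) : nat := (M * (i %% m) + i %/ m)%N.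

(* [Num.truncn] is the floor on nonnegative reals; only [0 <= y < 1] matters. *)
Definition h_shuffle (M m : nat) (y : R) : R :=
  let i := Num.truncn ((M * m)%:R * y) in
  (R_shuffle M m i)%:R / (M * m)%:R + (y - i%:R / (M * m)%:R).

Fixpoint H_star (M m : nat -> nat) (n : nat) : R -> R :=
  if n is n'.+1 then h_shuffle (M n') (m n) \o H_star M m n' else id.

Definition H_shuffle d (M m : nat -> nat) (n : nat) (y : 'rV[R]_d) : 'rV[R]_d :=
  \row_i H_star M m n (y 0 i).

End shuffle.

Section shuffle_filtration.
Context (R : realType) (d : nat).
Local Notation E := 'rV[R]_d.

Definition borel_in (D : set E) : set (set E) :=
  [set A | measurable A /\ A `<=` D].

Definition cell (M : nat) (b : {ffun 'I_d -> 'I_M}) : set E :=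
  [set y | forall i, (b i)%:R / M%:R <= y 0 i < (b i).+1%:R / M%:R].

Definition sigma_prod3 (D1 D2 D3 : set E) (G1 G2 G3 : set (set E)) :
    set (set (E * E * E)) :=
  <<s D1 `*` D2 `*` D3, [set X | exists A1 A2 A3,
    [/\ G1 A1, G2 A2, G3 A3 & X = A1 `*` A2 `*` A3]] >>.

(* The cells cover only [0, 1[^d: the null set of faces where some coordinate is
   1 is one more atom of the sigma-field they generate on the closed cube. *)
Definition shuffle_field (Omega : set E) (p0 : R) (M : nat) :=
  sigma_prod3 Omega (cube p0) (cube 1)
    (borel_in Omega) (borel_in (cube p0)) <<s cube 1, range (@cell M) >>.

Definition two_scale_shuffle (p : nat -> R) (M m : nat -> nat)
    (u0 : nat -> E * E -> R) (n : nat) (z : E * E * E) : R :=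
  let: (x, y, y') := z in
  periodic_ext (p n) (u0 n) x
    (p 0%N *: floor_rV ((M n)%:R *: H_shuffle M m n y') + y).

End shuffle_filtration.

(* Main.v *)
(* Testing two-scale convergence against the span of the products
   1_Q(x) t_1(y_1) ... t_d(y_d), with Q a box and the t_i continuous and
   p-periodic, is enough, because this span is dense in L^2(Q0 x Y_p) for any box
   Q0 containing Omega. Since the integral of psi(x, x/eps_k)^2 tends to
   p^-d ||psi||^2, this gives p^-d ||u_{0,p}||^2 <= sup ||u_eps||^2. A p_n-periodic
   test function is also p_{n+1}-periodic, so u_{0,p_n} is a.e. on Omega x Y_{p_n}
   the average of the translates of u_{0,p_{n+1}} by p_n {0, ..., m_{n+1} - 1}^d.

   The shuffle function turns these translates into the subcells of a cell of side
   1/M_n: floor (M_{n+1} H_{n+1} y') = floor (M_n H_n y') + M_n r when y' is in the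
   r-th subcell. Hence w_n is the average of w_{n+1} over the cells of side 1/M_n.
   As F_n consists of the Borel sets that cannot separate two points with the same
   (x, y) whose y' lie in the same cell, this is the martingale property. An
   L^2-bounded martingale converges in L^2 by orthogonality of the increments and
   almost everywhere by Kolmogorov's maximal inequality. *)

Require Import Defs.
From HB Require Import structures.
From mathcomp Require Import all_boot all_order all_algebra.
From mathcomp Require Import all_classical all_reals all_analysis.
From mathcomp Require Import measurable_realfun.
From mathcomp Require Import ring lra.

Set Implicit Arguments.
Unset Strict Implicit.
Unset Printing Implicit Defensive.

Import Order.TTheory GRing.Theory Num.Theory.
Import numFieldNormedType.Exports.

Local Open Scope classical_set_scope.
Local Open Scope ring_scope.

(** The martingale property is handled through inner products. Measurability for [F n] is replaced
    by invariance under the relation [same_cell M n], and the projection property by equality of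
    integrals against all square-integrable invariant functions; [shuffle_fieldP] translates this
    into sigma-fields at the end. The limits [u0 n] are determined only up to null sets, and the
    faces of the closed cubes carry arbitrary values. The work is therefore done on [shuffled], a
    version built from the limits extended by 0 and constant on cells at every point; the sequence
    of the statement is compared with it almost everywhere. The norm bound and the averaging
    identity come from one duality lemma, [tspan_norm_le]: an inequality that survives the two-scale
    limit against each test function becomes an inequality between norms. Its constant is [p ^ d]
    times the squared bound in the first case and 0 in the second. The factor [p n ^ d] in the norm
    bound is harmless: a cell has measure [M n ^ -d] and [p n = M n * p 0], which leaves [p 0 ^ d],
    independent of [n]. *)

Lemma measurable_setb d (T : measurableType d) (f : T -> bool) :
  measurable_fun setT f -> measurable [set z | f z].
Proof.
move=> mf; rewrite (_ : mkset _ = setT `&` f @^-1` [set true]); last first.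
  by rewrite setTI; apply/seteqP; split=> z /=.
exact: mf.
Qed.

(** * Square-integrable functions *)

Section square_integrable.
Context d (T : measurableType d) (R : realType).
Variable mu : {measure set T -> \bar R}.
Implicit Types f g : T -> R.

(** Measurability is asked on the whole type, so that a function given on a domain enters as its
    extension by 0. *)
Definition sqint (f : T -> R) :=
  measurable_fun setT f /\ (\int[mu]_z (f z ^+ 2)%:E < +oo)%E.

Lemma sqint_integrable f : sqint f -> mu.-integrable setT (EFin \o (fun z => f z ^+ 2)).
Proof.
move=> [mf foo]; apply/integrableP; split.
  by apply/measurable_EFinP; exact: measurable_funX.
by under eq_integral do rewrite /= ger0_norm ?sqr_ge0//.
Qed.

Lemma sqint_le f g : sqint f -> measurable_fun setT g ->
  (forall z, g z ^+ 2 <= f z ^+ 2) -> sqint g.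
Proof.
move=> [mf foo] mg gf; split=> //; apply: le_lt_trans foo.
apply: ge0_le_integral => //=.
- by move=> z _; rewrite lee_fin sqr_ge0.
- by apply/measurable_EFinP; exact: measurable_funX.
- by apply/measurable_EFinP; exact: measurable_funX.
- by move=> z _; rewrite lee_fin.
Qed.

(** The product is dominated by [f ^ 2 + g ^ 2]. *)
Lemma sqintM f g : sqint f -> sqint g ->
  mu.-integrable setT (EFin \o (fun z => f z * g z)).
Proof.
move=> sf sg; have := integrableD measurableT (sqint_integrable sf) (sqint_integrable sg).
apply: le_integrable => //.
  by apply/measurable_EFinP; apply: measurable_funM; [case: sf|case: sg].
move=> z _ /=; rewrite lee_fin [leRHS]ger0_norm ?addr_ge0 ?sqr_ge0//.
rewrite ler_norml; apply/andP; split; nra.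
Qed.

Lemma sqintZ k f : sqint f -> sqint (fun z => k * f z).
Proof.
move=> [mf foo]; split; first exact: measurable_funM.
under eq_integral do rewrite exprMn EFinM.
rewrite ge0_integralZl_EFin//.
- by rewrite lte_mul_pinfty// lee_fin sqr_ge0.
- by move=> z _; rewrite lee_fin sqr_ge0.
- by apply/measurable_EFinP; exact: measurable_funX.
- by rewrite sqr_ge0.
Qed.

Lemma sqintD f g : sqint f -> sqint g -> sqint (fun z => f z + g z).
Proof.
move=> sf sg; split; first by apply: measurable_funD; [case: sf|case: sg].
have fgi := integrableD measurableT (integrableZl measurableT 2 (sqint_integrable sf))
  (integrableZl measurableT 2 (sqint_integrable sg)).
apply: le_lt_trans (integrable_lty measurableT fgi).
apply: ge0_le_integral => //=.
- by move=> z _; rewrite lee_fin sqr_ge0.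
- apply/measurable_EFinP; apply: measurable_funX; apply: measurable_funD;
  [by case: sf|by case: sg].
- exact: measurable_int fgi.
- move=> z _; rewrite -!EFinM -EFinD lee_fin -subr_ge0.
  by rewrite (_ : _ - _ = (f z - g z) ^+ 2) ?sqr_ge0//; ring.
Qed.

Lemma sqintB f g : sqint f -> sqint g -> sqint (fun z => f z - g z).
Proof.
move=> sf /(@sqintZ (-1)) /(sqintD sf); congr sqint.
by apply/funext => z; rewrite mulN1r.
Qed.

Lemma sqint_indicM A f : measurable A -> sqint f -> sqint (fun z => \1_A z * f z).
Proof.
move=> mA sf; apply: (sqint_le sf).
  by apply: measurable_funM; [exact: measurable_indic|case: sf].
move=> z; rewrite exprMn ler_piMl ?sqr_ge0// indicE.
Qed.

Lemma sqint_indic A : measurable A -> (mu A < +oo)%E -> sqint \1_A.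
Proof.
move=> mA Aoo; split; first exact: measurable_indic.
rewrite (eq_integral (EFin \o \1_A)); first by rewrite integral_indic// setIT.
by move=> z _; rewrite /= indicE; case: (z \in A); rewrite ?expr1n ?expr0n.
Qed.

Lemma integrable_scale D k f : measurable D -> mu.-integrable D (EFin \o f) ->
  mu.-integrable D (EFin \o (fun z => k * f z)).
Proof.
move=> mD fi; rewrite (_ : _ \o _ = fun z => (k%:E * (EFin \o f) z)%E).
  exact: integrableZl.
by apply/funext => z /=; rewrite EFinM.
Qed.

Lemma integrable_add D f g : measurable D -> mu.-integrable D (EFin \o f) ->
  mu.-integrable D (EFin \o g) -> mu.-integrable D (EFin \o (fun z => f z + g z)).
Proof. by move=> mD fi gi; apply: eq_integrable (integrableD mD fi gi). Qed.

Lemma integrable_sub D f g : measurable D -> mu.-integrable D (EFin \o f) ->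
  mu.-integrable D (EFin \o g) -> mu.-integrable D (EFin \o (fun z => f z - g z)).
Proof. by move=> mD fi gi; apply: eq_integrable (integrableB mD fi gi). Qed.

Lemma lty_integrable_indic A : measurable A -> (mu A < +oo)%E ->
  mu.-integrable setT (EFin \o \1_A).
Proof.
move=> mA Aoo; apply/integrableP; split; first exact/measurable_EFinP.
rewrite (eq_integral (EFin \o \1_A)); first by rewrite integral_indic// setIT.
by move=> t _; rewrite /= ger0_norm.
Qed.

Lemma EFin_Rintegral f : mu.-integrable setT (EFin \o f) ->
  (\int[mu]_z f z)%:E = (\int[mu]_z (f z)%:E)%E.
Proof. by move=> fi; rewrite /Rintegral fineK//; exact: integrable_fin_num. Qed.

Lemma Rintegral_sum D (I : Type) (s : seq I) (F : I -> T -> R) : measurable D ->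
  (forall i, mu.-integrable D (EFin \o F i)) ->
  mu.-integrable D (EFin \o (fun z => \sum_(i <- s) F i z)) /\
  \int[mu]_(z in D) (\sum_(i <- s) F i z) = \sum_(i <- s) \int[mu]_(z in D) F i z.
Proof.
move=> mD Fi; elim: s => [|i s [ih1 ih2]].
  under [X in _.-integrable _ (EFin \o X)]eq_fun do rewrite big_nil.
  under eq_Rintegral do rewrite big_nil.
  by rewrite big_nil /Rintegral integral0; split => //; exact: integrable0.
under [X in _.-integrable _ (EFin \o X)]eq_fun do rewrite big_cons.
under eq_Rintegral do rewrite big_cons.
by rewrite big_cons -ih2 RintegralD//; split => //; exact: integrable_add.
Qed.

Lemma ge0_sqint_integral f : 0 <= \int[mu]_z (f z ^+ 2).
Proof. by apply: Rintegral_ge0 => z _; exact: sqr_ge0. Qed.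

(** Cauchy-Schwarz through the quadratic [a - 2 t b + t ^ 2 c], which is the integral of
    [(f - t g) ^ 2] and hence nonnegative for every real [t]. *)
Lemma sqint_inner_sqr f g : sqint f -> sqint g ->
  (\int[mu]_z (f z * g z)) ^+ 2 <= (\int[mu]_z (f z ^+ 2)) * (\int[mu]_z (g z ^+ 2)).
Proof.
move=> sf sg; set a := \int[mu]_z (f z ^+ 2); set b := \int[mu]_z (f z * g z).
set c := \int[mu]_z (g z ^+ 2).
have q t : 0 <= a - 2 * t * b + t ^+ 2 * c.
  have -> : a - 2 * t * b + t ^+ 2 * c = \int[mu]_z ((f z - t * g z) ^+ 2).
    apply: EFin_inj; rewrite EFin_Rintegral; last first.
      by apply: sqint_integrable; apply: sqintB => //; exact: sqintZ.
    rewrite EFinD EFinB !EFinM !EFin_Rintegral; [|exact: sqint_integrable|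
      exact: sqintM|exact: sqint_integrable].
    rewrite -!EFinM -!integralZl//; [|exact: sqint_integrable|exact: sqintM].
    rewrite -integralB//; [|exact: sqint_integrable|
      by apply: integrableZl => //; exact: sqintM].
    rewrite -integralD//; last 2 first.
    - apply: integrableB => //; first exact: sqint_integrable.
      by apply: integrableZl => //; exact: sqintM.
    - by apply: integrableZl => //; exact: sqint_integrable.
    apply: eq_integral => z _ /=; rewrite -!EFinM -EFinB -EFinD; congr EFin; ring.
  exact: ge0_sqint_integral.
have c0 : 0 <= c by exact: ge0_sqint_integral.
have [c_eq0|cn0] := eqVneq c 0.
  rewrite c_eq0 mulr0; suff -> : b = 0 by rewrite expr0n.
  apply/eqP; apply: contraT => b0.
  (* With [c = 0] the quadratic is affine in [t]; if [b] were nonzero, this [t] would give it the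
     value -1. *)
  have := q ((a + 1) / (2 * b)); rewrite c_eq0 mulr0 addr0.
  suff -> : 2 * ((a + 1) / (2 * b)) * b = a + 1 by lra.
  by field.
(* The minimiser [b / c] turns nonnegativity into [b ^ 2 <= a c]. *)
have := q (b / c); rewrite (_ : _ + _ = (a * c - b ^+ 2) / c); last by field.
by rewrite pmulr_lge0 ?invr_gt0 ?lt0r ?cn0// subr_ge0.
Qed.

End square_integrable.

Section Lfun2.
Context d (T : measurableType d) (R : realType).
Variable mu : {measure set T -> \bar R}.
Implicit Types f : T -> R.

Lemma Lnorm2E f : ('N[mu]_2%:E [EFin \o f] = (\int[mu]_z (f z ^+ 2)%:E) `^ 2^-1)%E.
Proof.
rewrite unlock; congr (_ `^ _)%E; apply: eq_integral => z _ /=.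
by rewrite powR_mulrn// real_normK// num_real.
Qed.

Lemma Lfun2P f : f \in Lfun mu 2%:E <-> sqint mu f.
Proof.
split=> [lf|[mf foo]].
  split; first by move/sub_Lfun_mfun : lf; rewrite inE.
  by have := integrable_lty measurableT (Lfun2_integrable_sqr lf).
rewrite inE; apply/andP; split; rewrite inE//=.
by rewrite /finite_norm Lnorm2E poweR_lty.
Qed.

Lemma sqint_Lnorm2 f : sqint mu f ->
  ('N[mu]_2%:E [EFin \o f])%E = (Num.sqrt (\int[mu]_z (f z ^+ 2)))%:E.
Proof.
move=> sf; rewrite Lnorm2E -EFin_Rintegral; last exact: sqint_integrable.
by rewrite poweR_EFin powR12_sqrt// ge0_sqint_integral.
Qed.

End Lfun2.

(** * Martingales bounded in L^2 *)

Section L2_martingale_convergence.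
Context d (T : measurableType d) (R : realType).
Variable mu : {measure set T -> \bar R}.

(* The information available at time [n] is encoded by a relation: [r n z z']
   means that [z] and [z'] cannot be told apart at time [n]. *)
Variable r : nat -> T -> T -> Prop.
Hypothesis r_decr : forall n z z', r n.+1 z z' -> r n z z'.

(** Invariance under [r n] stands in for measurability with respect to the [n]-th sigma-field. Such
    functions are both the values of the martingale and the test functions of [g_step], which says
    that [g n] is the projection of [g n.+1] onto them. *)
Definition adapted n (h : T -> R) :=
  sqint mu h /\ forall z z', r n z z' -> h z = h z'.

Variable g : nat -> T -> R.
Hypothesis g_adapted : forall n, adapted n (g n).
Hypothesis g_step : forall n h, adapted n h ->
  \int[mu]_z (h z * g n.+1 z) = \int[mu]_z (h z * g n z).
Variable C : R.
Hypothesis g_bounded : forall n, \int[mu]_z (g n z ^+ 2) <= C.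

Let e n := \int[mu]_z (g n z ^+ 2).

Let r_le n k z z' : (n <= k)%N -> r k z z' -> r n z z'.
Proof.
move=> /subnK <-; elim: (k - n)%N => // j ih.
by rewrite addSn => /r_decr.
Qed.

Let adapted_le n k h : (n <= k)%N -> adapted n h -> adapted k h.
Proof. by move=> nk [sh rh]; split=> // z z' /(r_le nk); exact: rh. Qed.

Let sg n : sqint mu (g n). Proof. by case: (g_adapted n). Qed.

Let mg n : measurable_fun setT (g n). Proof. by case: (sg n). Qed.

Let sgB k n : sqint mu (fun z => g k z - g n z). Proof. exact: sqintB. Qed.

Lemma adapted_inner n k h : (n <= k)%N -> adapted n h ->
  \int[mu]_z (h z * g k z) = \int[mu]_z (h z * g n z).
Proof.
move=> nk ah; rewrite -(subnK nk); elim: (k - n)%N => // j ih.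
by rewrite addSn g_step//; apply: adapted_le ah; exact: leq_addl.
Qed.

Lemma adapted_innerB n k h : (n <= k)%N -> adapted n h ->
  \int[mu]_z (h z * (g k z - g n z)) = 0.
Proof.
move=> nk ah; under eq_Rintegral do rewrite mulrBr.
rewrite RintegralB//; [|by apply: sqintM => //; case: ah..].
by rewrite (adapted_inner nk ah) subrr.
Qed.

(** Pythagoras: [g n] is itself an admissible test function at time [n], hence orthogonal to the
    later increment, and the cross term of the square vanishes. *)
Lemma martingale_incr n k : (n <= k)%N ->
  \int[mu]_z ((g k z - g n z) ^+ 2) = e k - e n.
Proof.
move=> nk.
have E1 : \int[mu]_z (g k z ^+ 2) = \int[mu]_z (g n z ^+ 2 +
     (2 * (g n z * (g k z - g n z)) + (g k z - g n z) ^+ 2)).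
  by apply: eq_Rintegral => z _; ring.
have i1 : mu.-integrable setT (EFin \o (fun z => g n z * (g k z - g n z))).
  exact: sqintM.
have i2 : mu.-integrable setT (EFin \o (fun z => (g k z - g n z) ^+ 2)).
  exact: sqint_integrable.
have i3 : mu.-integrable setT (EFin \o (fun z => 2 * (g n z * (g k z - g n z)))).
  exact: integrable_scale.
rewrite /e E1 RintegralD//; last 2 first.
- exact: sqint_integrable.
- exact: integrable_add.
rewrite RintegralD// RintegralZl// adapted_innerB// mulr0 add0r.
by rewrite addrC addKr.
Qed.

Let e_le n k : (n <= k)%N -> e n <= e k.
Proof. by move=> nk; rewrite -subr_ge0 -martingale_incr// ge0_sqint_integral. Qed.

Let e_cvg : cvgn e.
Proof.
apply: nondecreasing_is_cvgn => //; exists C => _ [n _ <-].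
exact: g_bounded.
Qed.

Let e_lim n : e n <= limn e.
Proof. by apply: nondecreasing_cvgn_le. Qed.

Section maximal_inequality.
Variables (n : nat) (l : R).
Hypothesis l0 : 0 < l.

(** Deviations are measured from time [n] rather than from time 0, so that the whole tail after [n]
    is controlled by the energy still to come, [limn e - e n]. *)
Let F j := [set z | l <= `|g (n + j)%N z - g n z|].

Let mF j : measurable (F j).
Proof.
apply: measurable_setb; apply: measurable_fun_ler => //.
apply: measurableT_comp => //; exact: measurable_funB.
Qed.

Let mA j : measurable (seqDU F j).
Proof. by apply: measurableD => //; exact: bigsetU_measurable. Qed.

(* On the set where the increment first exceeds [l] at time [n + j], the
   later increment is orthogonal to the one reached at that time. *)
Let first_passage J j : (j <= J)%N ->
  ((l ^+ 2)%:E * mu (seqDU F j) <=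
   \int[mu]_(z in seqDU F j) ((g (n + J)%N z - g n z) ^+ 2)%:E)%E.
Proof.
move=> jJ; set A := seqDU F j; have mA' : measurable A by exact: mA.
pose S z := g (n + j)%N z - g n z; pose D z := g (n + J)%N z - g (n + j)%N z.
(* Membership in [seqDU F j] depends only on [F 0], ..., [F j], that is on [g n], ..., [g (n + j)],
   all of which [r (n + j)] preserves. *)
have aS : adapted (n + j)%N (fun z => \1_A z * S z).
  split; first exact: sqint_indicM mA' (sgB (n + j)%N n).
  move=> z z' zz'.
  have gE k : (k <= j)%N -> g (n + k)%N z = g (n + k)%N z'.
    by move=> kj; apply: (g_adapted _).2; apply: r_le zz'; rewrite leq_add2l.
  have gnE : g n z = g n z' by have := gE 0%N (leq0n _); rewrite addn0.
  have FE k : (k <= j)%N -> F k z = F k z' by move=> kj; rewrite /F/= gE// gnE.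
  rewrite /S gE// gnE; congr (_ * _); rewrite !indicE; congr ((nat_of_bool _)%:R).
  apply/idP/idP; rewrite !inE => -[Fj nF]; (split; first by rewrite ?FE// -?FE//);
  rewrite -bigcup_mkord => -[k /= kj Fk]; apply: nF; rewrite -bigcup_mkord;
  by exists k => //; rewrite ?FE// -?FE// ltnW.
have iD : mu.-integrable setT (EFin \o (fun z => (\1_A z * S z) * D z)).
  by apply: sqintM; [case: aS|exact: (sgB _ _)].
have i0 : \int[mu]_z ((\1_A z * S z) * D z) = 0.
  by rewrite adapted_innerB// leq_add2l.
have iS : mu.-integrable setT (EFin \o (fun z => \1_A z * (S z ^+ 2))).
  rewrite (_ : (fun z => _) = (fun z => (\1_A z * S z) * S z)).
    by apply: sqintM; [case: aS|exact: (sgB _ _)].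
  by apply/funext => z; rewrite expr2 mulrA.
have iT : mu.-integrable setT (EFin \o (fun z => \1_A z * ((g (n + J)%N z - g n z) ^+ 2))).
  rewrite (_ : (fun z => _) = (fun z => (\1_A z * (g (n + J)%N z - g n z)) * (g (n + J)%N z - g n z))).
    by apply: sqintM; [apply: (sqint_indicM mA')|]; exact: sgB.
  by apply/funext => z; rewrite expr2 mulrA.
rewrite [leRHS]integral_mkcond.
have -> : (fun z => ((g (n + J)%N z - g n z) ^+ 2)%:E) \_ A =
    EFin \o (fun z => \1_A z * ((g (n + J)%N z - g n z) ^+ 2)).
  by apply/funext => z; rewrite patchE /= indicE; case: (z \in A); rewrite ?mul1r ?mul0r.
(* On [A] one has [l <= |S|]; it then remains to compare [S ^ 2] with [(S + D) ^ 2]. *)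
apply: (@le_trans _ _ (\int[mu]_z (\1_A z * (S z ^+ 2))%:E)%E).
  rewrite -[A in mu A]setIT -integral_indic//. rewrite -ge0_integralZl_EFin//.
  - apply: ge0_le_integral => //=.
    + by move=> z _; rewrite -EFinM lee_fin mulr_ge0// sqr_ge0.
    + apply/measurable_EFinP; apply: measurable_funM => //.
    + by case/integrableP : iS.
    + move=> z _; rewrite -EFinM lee_fin mulrC indicE.
      have [|] := boolP (z \in A); rewrite ?mul0r// inE => -[Fj _]; rewrite !mul1r.
      by rewrite -[leRHS]real_normK ?num_real// lerXn2r// nnegrE ltW.
  - by apply/measurable_EFinP; exact: measurable_indic.
  - exact: sqr_ge0.
rewrite -!EFin_Rintegral// lee_fin.
(* Twice the vanishing integral of [1_A S D] is added on the left; the inequality is then pointwise,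
   since [(S + D) ^ 2 - S ^ 2 - 2 S D = D ^ 2]. *)
rewrite -[leLHS]addr0 -[X in _ + X](mulr0 2) -i0 -RintegralZl// -RintegralD//; last exact: integrable_scale.
apply: le_Rintegral => //.
- by apply: integrable_add => //; exact: integrable_scale.
- move=> z _; rewrite /D /S indicE; case: (z \in A); rewrite ?mul0r ?mulr0 ?addr0// !mul1r.
  by rewrite -subr_ge0 (_ : _ - _ = (g (n + J)%N z - g (n + j)%N z) ^+ 2) ?sqr_ge0//; ring.
Qed.

(** The first-passage sets are disjoint with the same union as the [F j]. Their estimates all refer
    to the common final time [n + J], so they add up to at most the squared norm of one
    increment. *)
Lemma kolmogorov_maximal J :
  ((l ^+ 2)%:E * mu (\big[setU/set0]_(j < J.+1) F j) <= (limn e - e n)%:E)%E.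
Proof.
rewrite bigsetU_seqDU measure_bigsetU_ord//; last first.
  by apply/trivIsetP => i j _ _ ij; move/trivIsetP : (trivIset_seqDU F); apply.
rewrite ge0_sume_distrr//.
apply: (@le_trans _ _ (\int[mu]_z ((g (n + J)%N z - g n z) ^+ 2)%:E)%E); last first.
  rewrite -EFin_Rintegral; last exact/sqint_integrable/sgB.
  by rewrite lee_fin martingale_incr ?leq_addr// lerB.
have mf : measurable_fun setT (fun z => ((g (n + J)%N z - g n z) ^+ 2)%:E).
  by apply/measurable_EFinP/measurable_funX; exact: measurable_funB.
apply: (@le_trans _ _ (\int[mu]_(z in \big[setU/set0]_(j < J.+1) seqDU F j) ((g (n + J)%N z - g n z) ^+ 2)%:E)%E).
  rewrite -(big_mkord xpredT (seqDU F)) ge0_integral_bigsetU//.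
  - by rewrite big_mkord; apply: lee_sum => j _; apply: first_passage; rewrite -ltnS.
  - exact: iota_uniq.
  - exact: sub_trivIset (trivIset_seqDU F).
  - exact: measurable_funTS.
  - by move=> z _; rewrite lee_fin sqr_ge0.
apply: ge0_subset_integral => //.
- exact: bigsetU_measurable.
- by move=> z _; rewrite lee_fin sqr_ge0.
Qed.

(** The bound does not depend on [J], so continuity from below carries it to the infinite union. *)
Lemma kolmogorov_maximal_sup :
  measurable (\bigcup_j F j) /\
  ((l ^+ 2)%:E * mu (\bigcup_j F j) <= (limn e - e n)%:E)%E.
Proof.
have mU : measurable (\bigcup_j F j) by exact: bigcup_measurable.
split=> //; pose G J := \big[setU/set0]_(j < J.+1) F j.
have GE : \bigcup_j F j = \bigcup_J G J.
  by rewrite bigcup_bigsetU_bigcup.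
have mG J : measurable (G J) by exact: bigsetU_measurable.
have : ((l ^+ 2)%:E * (mu \o G) J)%E @[J --> \oo] --> ((l ^+ 2)%:E * mu (\bigcup_j F j))%E.
  apply: cvgeZl => //; rewrite GE; apply: nondecreasing_cvg_mu => //.
    by rewrite -GE.
  apply/nondecreasing_seqP => J; apply/subsetPset; rewrite /G.
  by rewrite [X in _ `<=` X]big_ord_recr/=; exact: subsetUl.
move=> cv; rewrite -(cvg_lim _ cv)//; apply: lime_le; first by apply/cvg_ex; eexists; exact: cv.
by apply: nearW => J; exact: kolmogorov_maximal.
Qed.

End maximal_inequality.

(** A point at which the sequence is not Cauchy belongs, for some [i], to [osc n i] for all [n]. *)
Let osc n i := \bigcup_j [set z | i.+1%:R^-1 <= `|g (n + j)%N z - g n z|].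

(** For fixed [i] the maximal inequality bounds the measure of the intersection by
    [(i + 1) ^ 2 (limn e - e n)] for every [n], and this tends to 0. *)
Let osc_null : mu.-negligible (\bigcup_i \bigcap_n osc n i).
Proof.
have i0 (i : nat) : 0 < i.+1%:R^-1 :> R by rewrite invr_gt0.
have mosc n i : measurable (osc n i) := (kolmogorov_maximal_sup n (i0 i)).1.
apply: negligible_bigcup => i; exists (\bigcap_n osc n i); split=> //.
  exact: bigcapT_measurable.
apply/eqP; rewrite eq_le measure_ge0 andbT.
have c0 : (0 < i.+1%:R^-1 ^+ 2 :> R) by rewrite exprn_gt0.
rewrite -(@lee_pmul2l _ (i.+1%:R^-1 ^+ 2)%:E)// ?lte_fin// mule0.
have : (limn e - e n)%:E @[n --> \oo] --> (0 : \bar R).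
  apply/fine_cvgP; split; first exact: nearW.
  by rewrite -(subrr (limn e)); apply: cvgB => //; exact: cvg_cst.
move=> cv; rewrite -(cvg_lim _ cv)//; apply: lime_ge; first by apply/cvg_ex; eexists; exact: cv.
apply: nearW => n; apply: le_trans (kolmogorov_maximal_sup n (i0 i)).2.
apply: lee_wpmul2l; first by rewrite lee_fin ltW.
apply: le_measure; rewrite ?inE//; first exact: bigcapT_measurable.
  exact: mosc.
by move=> z h; exact: h.
Qed.

Let ae_cvg : {ae mu, forall z, cvgn (g ^~ z)}.
Proof.
apply: negligibleS osc_null => z /= ncvg; apply: contrapT => nosc.
apply: ncvg; apply: cauchy_cvg; apply: cauchy_exP => _/posnumP[eps].
have [i ieps] : exists i : nat, i.+1%:R^-1 < eps%:num.
  near \oo => i; exists i.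
  near: i; exact: near_infty_natSinv_lt eps.
have [n nosci] : exists n, ~ osc n i z.
  apply: contrapT => /forallNP h; apply: nosc; exists i => // n _.
  exact: contrapT (h n).
have gn k : (n <= k)%N -> `|g k z - g n z| < eps%:num.
  move=> nk; rewrite ltNge; apply/negP => le; apply: nosci; exists (k - n)%N => //=.
  by rewrite subnKC// (le_trans (ltW ieps)).
by exists (g n z), n => // k /= /gn; rewrite distrC.
Unshelve. all: by end_near. Qed.

Theorem L2_martingale_cvg : exists ginf : T -> R,
  [/\ sqint mu ginf,
      \int[mu]_z ((g n z - ginf z) ^+ 2) @[n --> \oo] --> (0 : R),
      {ae mu, forall z, g ^~ z @ \oo --> ginf z} &
      forall n h, adapted n h -> \int[mu]_z (h z * ginf z) = \int[mu]_z (h z * g n z)].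
Proof.
(* The upper limit is measurable and defined at every point; [fine] gives it the value 0 where it is
   infinite, which happens only on a null set. *)
pose ginf z := fine (limn_esup (fun n => (g n z)%:E)).
have mginf : measurable_fun setT ginf.
  apply: measurableT_comp => //; apply: measurable_fun_limn_esup => n.
  exact/measurable_EFinP.
have cvg_ginf : {ae mu, forall z, g ^~ z @ \oo --> ginf z}.
  apply: filterS ae_cvg => z /cvg_ex[l gl].
  suff -> : ginf z = l by [].
  have /cvg_limn_einf_sup[_] : (g n z)%:E @[n --> \oo] --> l%:E.
    by apply/fine_cvgP; split; [exact: nearW|exact: gl].
  by rewrite /ginf => ->.
have msq n : measurable_fun setT (fun z => ((ginf z - g n z) ^+ 2)%:E).
  by apply/measurable_EFinP/measurable_funX; exact: measurable_funB.
(* Fatou applied to [(g k - g n) ^ 2] as [k] grows: for [k >= n] the integrals are [e k - e n], so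
   the bound is the energy left after [n]. *)
have err n : (\int[mu]_z ((ginf z - g n z) ^+ 2)%:E <= (limn e - e n)%:E)%E.
  pose f k z := ((g k z - g n z) ^+ 2)%:E.
  have mf k : measurable_fun setT (f k).
    by apply/measurable_EFinP/measurable_funX; exact: measurable_funB.
  have -> : (\int[mu]_z ((ginf z - g n z) ^+ 2)%:E = \int[mu]_z limn_einf (f ^~ z))%E.
    apply: ae_eq_integral => //.
      rewrite /limn_einf; apply: measurableT_comp => //.
      by apply: measurable_fun_limn_esup => k; exact: measurableT_comp.
    apply: filterS cvg_ginf => z gz _; apply/esym.
    have /cvg_limn_einf_sup[-> _]// : f ^~ z @ \oo --> ((ginf z - g n z) ^+ 2)%:E.
    apply/fine_cvgP; split; first exact: nearW.
    apply: (@cvg_comp _ _ _ (fun k => g k z - g n z) (fun x => x ^+ 2) _ (nbhs (ginf z - g n z))).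
      exact: (cvgB gz (cvg_cst _)).
    exact: exprn_continuous.
  have f0 k z : setT z -> (0 <= f k z)%E by rewrite lee_fin sqr_ge0.
  apply: le_trans (fatou mu measurableT mf f0) _.
  have cv : (\int[mu]_z f k z)%E @[k --> \oo] --> (limn e - e n)%:E.
    have : (e k - e n)%:E @[k --> \oo] --> (limn e - e n)%:E.
      apply/fine_cvgP; split; first exact: nearW.
      by apply: cvgB => //; exact: cvg_cst.
    apply: cvg_trans; apply: near_eq_cvg; exists n => // k /= nk.
    by rewrite -martingale_incr// EFin_Rintegral//; exact/sqint_integrable/sgB.
  by have [-> _] := cvg_limn_einf_sup cv.
have sB n : sqint mu (fun z => ginf z - g n z).
  by split; [exact: measurable_funB|exact: le_lt_trans (err n) (ltry _)].
have sginf : sqint mu ginf.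
  have := sqintD (sB 0%N) (sg 0%N); congr sqint; apply/funext => z; ring.
have errR n : \int[mu]_z ((ginf z - g n z) ^+ 2) <= limn e - e n.
  rewrite -lee_fin EFin_Rintegral ?err//; exact: sqint_integrable.
have err0 : limn e - e n @[n --> \oo] --> (0 : R).
  by rewrite -(subrr (limn e)); apply: cvgB => //; exact: cvg_cst.
exists ginf; split=> //.
  apply: squeeze_cvgr (cvg_cst 0) err0.
  apply: nearW => n; rewrite ge0_sqint_integral/=.
  by under eq_Rintegral do rewrite -sqrrN opprB.
move=> n h ah; have sh : sqint mu h by case: ah.
(* Since [h] is adapted at time [n], [g n] may be replaced by [g k] for any [k >= n]. By
   Cauchy-Schwarz the squared difference is then at most the integral of [h ^ 2] times
   [limn e - e k], which tends to 0. *)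
apply/eqP; rewrite -subr_eq0 -sqrf_eq0 eq_le sqr_ge0 andbT.
have : (\int[mu]_z (h z ^+ 2)) * (limn e - e k) @[k --> \oo] --> (0 : R).
  by rewrite -(mulr0 (\int[mu]_z (h z ^+ 2))); apply: cvgM => //; exact: cvg_cst.
move=> cv; rewrite -(cvg_lim _ cv)//; apply: limr_ge; first by apply/cvg_ex; eexists; exact: cv.
exists n => // k /= nk.
apply: le_trans (ler_wpM2l (ge0_sqint_integral mu h) (errR k)).
apply: le_trans (sqint_inner_sqr sh (sB k)).
rewrite le_eqVlt; apply/orP; left; apply/eqP; congr (_ ^+ 2).
rewrite -(adapted_inner nk ah) -RintegralB//; [|by apply: sqintM..].
by apply: eq_Rintegral => z _; rewrite mulrBr.
Qed.

End L2_martingale_convergence.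

(** * Lebesgue measure on R^d *)

Section lebesgue_affine.
Context (R : realType).
Local Notation mu := (@lebesgue_measure R).

(** The image of Lebesgue measure under [t -> a t + c], scaled by [a], gives each interval []x, y]]
    its length, so it is Lebesgue measure; the formula is integration against an image measure. *)
Lemma ge0_integral_affine (a c : R) (f : R -> \bar R) : 0 < a ->
  measurable_fun setT f -> (forall t, 0 <= f t)%E ->
  (\int[mu]_t f (a * t + c)%R = (a^-1)%:E * \int[mu]_t f t)%E.
Proof.
move=> a0 mf f0.
pose phi : measurableTypeR R -> measurableTypeR R := fun t => a * t + c.
have mphi : measurable_fun setT phi.
  by apply: measurable_funD => //; exact: measurable_funM.
pose m : {measure set (measurableTypeR R) -> \bar R} :=
  mscale (NngNum (ltW a0)) (measure_function_pushforward__canonical__measure_function_Measure mu mphi).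
have mE A : measurable A -> mu A = m A.
  apply: lebesgue_measure_unique => _ [[x y]] _ <-.
  rewrite /m/= /mscale/= /pushforward.
  rewrite (_ : phi @^-1` _ = `](x - c) / a, (y - c) / a]%classic); last first.
    apply/seteqP; split=> t /=; rewrite !in_itv/= /phi ltr_pdivrMr// ler_pdivlMr//
      ltrBlDr lerBrDr mulrC => //.
  rewrite !lebesgue_measure_itv/= !lte_fin ltr_pM2r ?invr_gt0// ltrD2r.
  case: ifPn => _; last by rewrite mule0.
  by rewrite -!EFinB -EFinM; congr EFin; field; rewrite gt_eqF.
rewrite [in RHS](@eq_measure_integral _ _ _ _ m); last by move=> A mA _; exact: mE.
rewrite ge0_integral_mscale//= muleA -EFinM mulVf ?gt_eqF// mul1e.
by rewrite ge0_integral_pushforward// preimage_setT.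
Qed.

End lebesgue_affine.

Section lebesgue_rV_theory.
Context (R : realType).
Local Notation mu := (@lebesgue_measure R).
Local Notation leb := (lebesgue_rV R).

Lemma ge0_integral_rVS d (f : 'rV[R]_d.+1 -> \bar R) :
  measurable_fun setT f -> (forall v, 0 <= f v)%E ->
  (\int[leb d.+1]_v f v = \int[mu]_t \int[leb d]_v f (rV_cons (t, v)))%E.
Proof.
move=> mf f0.
transitivity (\int[pushforward (mu \x leb d)%E (@rV_cons R d)]_v f v)%E.
  by apply: eq_measure_integral => //; exact: measurable_rV_cons.
rewrite ge0_integral_pushforward//; last exact: measurable_rV_cons.
rewrite preimage_setT fubini_tonelli1//.
- by apply: measurableT_comp => //; exact: measurable_rV_cons.
- by move=> x /=.
Qed.

Lemma integral_rV_prod d (f : 'I_d -> R -> R) :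
  (forall i, measurable_fun setT (f i)) -> (forall i t, 0 <= f i t) ->
  (\int[leb d]_v (\prod_i f i (v 0 i))%:E = \prod_i \int[mu]_t (f i t)%:E)%E.
Proof.
have mprod k (h : 'I_k -> R -> R) : (forall i, measurable_fun setT (h i)) ->
    measurable_fun setT (fun v : 'rV[R]_k => (\prod_i h i (v 0 i))%:E).
  move=> mh; apply/measurable_EFinP; apply: measurable_prod => i _.
  by apply: measurableT_comp => //; exact: measurable_coord.
elim: d => [|d ih] in f *; move=> mf f0.
  rewrite big_ord0 /= integral_dirac//; [by rewrite diracT mul1e big_ord0|].
  exact: mprod.
rewrite ge0_integral_rVS//; last 2 first.
- exact: mprod.
- by move=> v; rewrite lee_fin prodr_ge0.
rewrite big_ord_recl -ih => [|i|i t]; [|exact: mf|exact: f0].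
have mh := mprod d (fun i => f (lift ord0 i)) (fun i => mf _).
have h0 (v : 'rV[R]_d) : (0 <= (\prod_i f (lift ord0 i) (v 0 i))%:E)%E.
  by rewrite lee_fin prodr_ge0.
rewrite -ge0_integralZr//; last 3 first.
- by apply/measurable_EFinP; exact: mf.
- by move=> t _; rewrite lee_fin.
- exact: integral_ge0.
apply: eq_integral => t _; rewrite -ge0_integralZl_EFin//.
apply: eq_integral => v _; rewrite big_ord_recl EFinM /rV_cons.
rewrite mxE unlift_none; congr ((_)%:E * (_)%:E)%E.
by apply: eq_bigr => i _; rewrite mxE liftK.
Qed.

Lemma measurable_fun_addrV d (c : 'rV[R]_d) :
  measurable_fun setT (fun v : 'rV[R]_d => v + c).
Proof.
apply: measurable_fun_rV => i; under eq_fun do rewrite mxE.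
by apply: measurable_funD => //; exact: measurable_coord.
Qed.

(** Induction on the dimension: the first coordinate is the affine substitution with slope 1, the
    others are the induction hypothesis on each fibre. *)
Lemma ge0_integral_shift d (c : 'rV[R]_d) (f : 'rV[R]_d -> \bar R) :
  measurable_fun setT f -> (forall v, 0 <= f v)%E ->
  (\int[leb d]_v f (v + c)%R = \int[leb d]_v f v)%E.
Proof.
elim: d => [|d ih] in c f *; move=> mf f0.
  by apply: eq_integral => v _; congr f; rewrite [LHS]thinmx0 [RHS]thinmx0.
rewrite ge0_integral_rVS//; last first.
  by apply: measurableT_comp => //; exact: measurable_fun_addrV.
rewrite [RHS]ge0_integral_rVS//.
pose c' := (rV_uncons c).2.
have mcons t : measurable_fun setT (fun v : 'rV[R]_d => rV_cons (t, v)).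
  by apply: measurableT_comp (@measurable_rV_cons R d) _; exact: measurable_pair1.
pose F t := (\int[leb d]_v f (rV_cons (t, v)))%E.
have mF : measurable_fun setT F.
  apply: (@measurable_fun_fubini_tonelli_F _ _ _ _ _ (leb d) (fun z => f (rV_cons z))) => //.
  by apply: measurableT_comp => //; exact: measurable_rV_cons.
have -> : (\int[mu]_t F t = \int[mu]_t F (1 * t + c 0 ord0)%R)%E.
  by rewrite ge0_integral_affine// ?invr1 ?mul1e// => t; exact: integral_ge0.
apply: eq_integral => t _; rewrite /F -[RHS](ih c'); last 2 first.
- exact: measurableT_comp.
- by move=> v.
apply: eq_integral => v _; congr f; apply/rowP => i; rewrite /rV_cons !mxE.
by case: (unliftP ord0 i) => [j|] ->; rewrite ?liftK ?unlift_none/= ?mul1r// !mxE.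
Qed.

End lebesgue_rV_theory.

Section lebesgue_rV_boxes.
Context (R : realType).
Local Notation mu := (@lebesgue_measure R).
Local Notation leb := (lebesgue_rV R).

Definition obox d (a b : 'rV[R]_d) : set 'rV[R]_d :=
  [set v | forall i, a 0 i < v 0 i < b 0 i].

Lemma measurable_rVP d (I : 'I_d -> set R) : (forall i, measurable (I i)) ->
  measurable [set v : 'rV[R]_d | forall i, I i (v 0 i)].
Proof.
move=> mI; rewrite [X in measurable X](_ : _ = \bigcap_(i in [set: 'I_d])
    (fun v : 'rV[R]_d => v 0 i) @^-1` I i); last first.
  by apply/seteqP; split=> [v h i _|v h i]; [exact: h|exact: (h i)].
apply: fin_bigcap_measurable => // i _.
by rewrite -[X in measurable X]setTI; exact: measurable_coord.
Qed.

Lemma measurable_obox d (a b : 'rV[R]_d) : measurable (obox a b).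
Proof.
rewrite [X in measurable X](_ : _ = [set v : 'rV[R]_d | forall i, `]a 0 i, b 0 i[%classic (v 0 i)]).
  by apply: (measurable_rVP (I := fun i => `]a 0 i, b 0 i[%classic)) => i; exact: measurable_itv.
by apply/seteqP; split=> v h i; have := h i; rewrite /= in_itv.
Qed.

Lemma indic_rVP d (I : 'I_d -> set R) (v : 'rV[R]_d) :
  \1_([set v | forall i, I i (v 0 i)]) v = \prod_i \1_(I i) (v 0 i) :> R.
Proof.
have [h|h] := pselect (forall i, I i (v 0 i)).
  rewrite indicE mem_set// big1// => i _; rewrite indicE mem_set//.
rewrite indicE memNset//; move/existsNP : h => [i nI].
by rewrite (bigD1 i)//= indicE memNset// mul0r.
Qed.

Lemma lebesgue_rV_prod d (I : 'I_d -> set R) : (forall i, measurable (I i)) ->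
  (leb d [set v : 'rV[R]_d | forall i, I i (v 0%R i)] = \prod_i mu (I i))%E.
Proof.
move=> mI; rewrite -[X in leb d X]setIT -integral_indic//; last exact: measurable_rVP.
rewrite (eq_integral (fun v : 'rV[R]_d => (\prod_i \1_(I i) (v 0 i))%:E)); last first.
  by move=> v _; congr EFin; exact: indic_rVP.
rewrite (integral_rV_prod (f := fun i => \1_(I i)))//.
by apply: eq_bigr => i _; rewrite integral_indic//; [rewrite setIT|exact: mI].
Qed.

(** A class stable under intersection that generates the product sigma-field: the starting point of
    the Dynkin argument for density. *)
Definition obox2 d : set (set ('rV[R]_d * 'rV[R]_d)) :=
  [set S | exists a b a' b', S = obox a b `*` obox a' b'].

Lemma oboxI d (a b a' b' : 'rV[R]_d) : obox a b `&` obox a' b' =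
  obox (\row_i Num.max (a 0 i) (a' 0 i)) (\row_i Num.min (b 0 i) (b' 0 i)).
Proof.
apply/seteqP; split=> v /=.
  move=> [h h'] i; rewrite !mxE gt_max lt_min.
  by move: (h i) (h' i) => /andP[-> ->] /andP[-> ->].
move=> h; split=> i; have := h i; rewrite !mxE gt_max lt_min;
by move=> /andP[/andP[p q] /andP[r t]]; rewrite ?p ?q ?r ?t.
Qed.

Lemma obox2_setI d : setI_closed (@obox2 d).
Proof.
move=> _ _ [a [b [a' [b' ->]]]] [x [y [x' [y' ->]]]].
by rewrite -setXI !oboxI; do 4 eexists.
Qed.

(** A condition on a single coordinate describes an unbounded strip, which is the countable union of
    its truncations to boxes of half-side [n]. *)
Lemma measurable_obox2E d :
  @measurable _ ('rV[R]_d * 'rV[R]_d)%type = <<s @obox2 d >>.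
Proof.
apply/seteqP; split; last first.
  apply: smallest_sub; first exact: sigma_algebra_measurable.
  by move=> _ [a [b [a' [b' ->]]]]; apply: measurableX; exact: measurable_obox.
suff mid : measurable_fun setT
    (fun z : g_sigma_algebraType (@obox2 d) => z : ('rV[R]_d * 'rV[R]_d)%type).
  by move=> A mA; rewrite -[A]setTI; exact: mid.
have natgt (x : R) : exists n : nat, `|x| < n%:R.
  by exists (Num.truncn `|x|).+1; exact: truncnS_gt.
have natgt2 (x : 'rV[R]_d * 'rV[R]_d) : exists n : nat, forall i,
    (`|x.1 0 i| < n%:R) && (`|x.2 0 i| < n%:R).
  pose N i := (Num.truncn `|x.1 0%R i|).+1; pose N' i := (Num.truncn `|x.2 0%R i|).+1.
  exists (\max_i maxn (N i) (N' i))%N => i.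
  have := @leq_bigmax _ (fun i => maxn (N i) (N' i)) i; rewrite geq_max => /andP[Ni N'i].
  apply/andP; split; apply: lt_le_trans (truncnS_gt _) _; rewrite ler_nat.
    exact: Ni.
  exact: N'i.
pose bx i a b (n : nat) : set 'rV[R]_d := obox (\row_j if j == i then a else - n%:R)
  (\row_j if j == i then b else n%:R).
pose bn (n : nat) : set 'rV[R]_d := obox (\row_j - n%:R) (\row_j n%:R).
have bxE i a b (v : 'rV[R]_d) n : (forall j, `|v 0 j| < n%:R) -> a < v 0 i < b -> bx i a b n v.
  by move=> vn vab j; rewrite !mxE; case: eqP => [->//|_]; rewrite -ltr_norml.
have bnE (v : 'rV[R]_d) n : (forall j, `|v 0 j| < n%:R) -> bn n v.
  by move=> vn j; rewrite !mxE -ltr_norml.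
apply/measurable_fun_pairP; split; apply: measurable_fun_rV => i;
  apply: (measurability _ (RGenOpens.measurableE R)) => _ [_ [a [b ->] <-]];
  rewrite setTI.
- rewrite [X in measurable X](_ : _ = \bigcup_n (bx i a b n `*` bn n)).
    apply: bigcupT_measurable => n; apply: sub_sigma_algebra.
    by do 4 eexists.
  apply/seteqP; split=> [[x y] /=|[x y] [n _ [/= /(_ i) + _]]].
    rewrite in_itv/= => xab; have [n xyn] := natgt2 (x, y).
    by exists n => //; split; [apply: bxE => // j|apply: bnE => j]; have /andP[] := xyn j.
  by rewrite !mxE eqxx in_itv.
- rewrite [X in measurable X](_ : _ = \bigcup_n (bn n `*` bx i a b n)).
    apply: bigcupT_measurable => n; apply: sub_sigma_algebra.
    by do 4 eexists.
  apply/seteqP; split=> [[x y] /=|[x y] [n _ [/= _ /(_ i)]]].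
    rewrite in_itv/= => xab; have [n xyn] := natgt2 (x, y).
    by exists n => //; split; [apply: bnE => j|apply: bxE => // j]; have /andP[] := xyn j.
  by rewrite !mxE eqxx in_itv.
Qed.

End lebesgue_rV_boxes.

Section grid.
Context (R : realType) (d : nat).
Local Notation E := 'rV[R]_d.
Local Notation leb := (lebesgue_rV R d).
Local Notation leb2 := (leb \x leb)%E.

(** Half-open cubes tile exactly, closed ones only up to null sets; the closed cubes of the
    statement are exchanged for these under the integral sign. *)
Definition hcube (p : R) : set E := [set y | forall i, 0 <= y 0 i < p].

Definition gridpt N (b : {ffun 'I_d -> 'I_N}) : E := \row_i (b i)%:R.

Lemma cubeE p : cube p = [set y : E | forall i, `[0, p]%classic (y 0 i)].
Proof. by apply/seteqP; split=> y h i; have := h i; rewrite /= in_itv. Qed.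

Lemma hcubeE p : hcube p = [set y : E | forall i, `[0, p[%classic (y 0 i)].
Proof. by apply/seteqP; split=> y h i; have := h i; rewrite /= in_itv. Qed.

Lemma hcube_cube p : hcube p `<=` cube p.
Proof. by move=> y h i; have /andP[-> /ltW] := h i. Qed.

Lemma measurable_cube p : measurable (cube p : set E).
Proof.
by rewrite cubeE; apply: (measurable_rVP (I := fun=> `[0, p]%classic)) => i; exact: measurable_itv.
Qed.

Lemma measurable_hcube p : measurable (hcube p).
Proof.
by rewrite hcubeE; apply: (measurable_rVP (I := fun=> `[0, p[%classic)) => i; exact: measurable_itv.
Qed.

Lemma lebesgue_cube p : 0 <= p -> leb (cube p) = (p ^+ d)%:E.
Proof.
move=> p0; rewrite cubeE (lebesgue_rV_prod (I := fun=> `[0, p]%classic))//.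
rewrite (eq_bigr (fun=> p%:E)) => [|i _]; last first.
  have /= -> := @lebesgue_measure_itv R `[0, p].
  rewrite lte_fin sube0; have [//|] := ltP 0 p.
  by rewrite le_eqVlt ltNge p0 orbF => /eqP ->.
by rewrite prodEFin prodr_const card_ord.
Qed.

Lemma lebesgue_hcube p : 0 <= p -> leb (hcube p) = (p ^+ d)%:E.
Proof.
move=> p0; rewrite hcubeE (lebesgue_rV_prod (I := fun=> `[0, p[%classic))//.
rewrite (eq_bigr (fun=> p%:E)) => [|i _]; last first.
  have /= -> := @lebesgue_measure_itv R `[0, p[.
  rewrite lte_fin sube0; have [//|] := ltP 0 p.
  by rewrite le_eqVlt ltNge p0 orbF => /eqP ->.
by rewrite prodEFin prodr_const card_ord.
Qed.

Lemma lebesgue_faces p : 0 <= p -> leb (cube p `\` hcube p) = 0%E.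
Proof.
move=> p0; rewrite measureD//=; [|exact: measurable_cube|exact: measurable_hcube|].
  rewrite setIidr; last exact: hcube_cube.
  by rewrite [X in (X - _)%E]lebesgue_cube// [X in (_ - X)%E]lebesgue_hcube// subee.
by rewrite ltey_eq [X in X \is a fin_num]lebesgue_cube.
Qed.

(** In one variable the intervals [[j p, (j + 1) p[] tile [[0, N p[], by induction on [N]. Expanding
    the product of these sums over the coordinates gives one term for each choice function [b]. *)
Lemma indic_hcube_grid p N (v : E) : 0 < p ->
  \sum_(b : {ffun 'I_d -> 'I_N}) \1_(hcube p) (v - p *: gridpt b) =
  \1_(hcube (N%:R * p)) v :> R.
Proof.
move=> p0; pose I1 (q t : R) : R := \1_(`[0, q[%classic) t.
have hI q (y : E) : \1_(hcube q) y = \prod_i I1 q (y 0 i).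
  rewrite hcubeE; exact: (indic_rVP (fun=> `[0, q[%classic) y).
have sum1 (t : R) : \sum_(j < N) I1 p (t - p * j%:R) = I1 (N%:R * p) t.
  elim: N => [|N ih].
    rewrite big_ord0 /I1 indicE memNset// /= in_itv/= mul0r.
    by move=> /andP[/le_lt_trans h /h]; rewrite ltxx.
  rewrite big_ord_recr/= ih /I1 !indicE.
  have Np0 : 0 <= N%:R * p by rewrite mulr_ge0// ltW.
  have mI (x q : R) : (x \in `[0, q[%classic) = (0 <= x < q).
    by apply/idP/idP; rewrite inE/= in_itv.
  have e1 : (0 <= t - p * N%:R) = (N%:R * p <= t) by rewrite subr_ge0 mulrC.
  have e2 : (t - p * N%:R < p) = (t < N.+1%:R * p).
    by rewrite ltrBlDl -natr1 mulrDl mul1r mulrC.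
  rewrite !mI e1 e2 -natr1.
  have [tN|tN] := ltP t (N%:R * p); rewrite /= ?andbF ?andbT ?addr0 ?add0r.
    rewrite (_ : t < (N%:R + 1) * p)// ?andbT//; lra.
  by rewrite (le_trans Np0 tN).
rewrite hI; under [RHS]eq_bigr do rewrite -sum1.
rewrite bigA_distr_bigA/=; apply: eq_bigr => b _.
by rewrite hI; apply: eq_bigr => i _; rewrite !mxE.
Qed.

Lemma ge0_integral_shift2 (c : E) (f : E * E -> \bar R) :
  measurable_fun setT f -> (forall z, 0 <= f z)%E ->
  (\int[leb2]_z f (z.1, z.2 + c)%R = \int[leb2]_z f z)%E.
Proof.
move=> mf f0.
have ms : measurable_fun setT (fun z : E * E => (z.1, z.2 + c)).
  apply/measurable_fun_pairP; split; first exact: measurable_fst.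
  exact: (measurableT_comp (@measurable_fun_addrV R d c) measurable_snd).
rewrite fubini_tonelli1//; last exact: measurableT_comp.
rewrite [RHS]fubini_tonelli1//; apply: eq_integral => x _.
rewrite /fubini_F/= (ge0_integral_shift c (f := fun y => f (x, y)))//.
exact: measurableT_comp.
Qed.

Variable (A : set E).
Hypothesis mA : measurable A.

(** Cut along the tiling, then move each tile back to the origin by translation invariance. *)
Lemma ge0_integral_grid p N (f : E * E -> \bar R) : 0 < p ->
  measurable_fun setT f -> (forall z, 0 <= f z)%E ->
  (\int[leb2]_(z in A `*` hcube (N%:R * p)) f z =
   \sum_(b : {ffun 'I_d -> 'I_N}) \int[leb2]_(z in A `*` hcube p) f (z.1, z.2 + p *: gridpt b)%R)%E.
Proof.
move=> p0 mf f0.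
have ms c : measurable_fun setT (fun z : E * E => (z.1, z.2 + c)).
  apply/measurable_fun_pairP; split; first exact: measurable_fst.
  exact: (measurableT_comp (@measurable_fun_addrV R d c) measurable_snd).
have mS q : measurable (A `*` hcube q) by apply: measurableX => //; exact: measurable_hcube.
have indX q (z : E * E) : \1_(A `*` hcube q) z = \1_A z.1 * \1_(hcube q) z.2 :> R.
  by rewrite !indicE -natrM mulnb in_setX.
have mI q c : measurable_fun setT (fun z : E * E => (\1_(A `*` hcube q) (z.1, z.2 - c))%:E).
  apply/measurable_EFinP; apply: (measurableT_comp _ (ms _)); exact: measurable_indic.
have E1 q (g : E * E -> \bar R) : measurable_fun setT g -> (\int[leb2]_(z in A `*` hcube q) g z =
    \int[leb2]_z (g z * (\1_(A `*` hcube q) z)%:E))%E.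
  move=> mg; rewrite integral_mkcond; apply: eq_integral => z _.
  by rewrite epatch_indic.
rewrite E1//.
transitivity (\int[leb2]_z \sum_(b : {ffun 'I_d -> 'I_N})
    (f z * (\1_(A `*` hcube p) (z.1, z.2 - p *: gridpt b)%R)%:E))%E.
  apply: eq_integral => z _; rewrite -ge0_sume_distrr//.
  congr (_ * _)%E; rewrite sumEFin; congr EFin; rewrite indX -(indic_hcube_grid N _ p0).
  by rewrite mulr_sumr; apply: eq_bigr => b _; rewrite indX.
rewrite ge0_integral_sum//=; last 2 first.
- by move=> b; apply: emeasurable_funM => //; exact: mI.
- by move=> b z _; rewrite mule_ge0.
apply: eq_bigr => b _; rewrite E1; last exact: measurableT_comp.
rewrite -[LHS](ge0_integral_shift2 (p *: gridpt b)); last 2 first.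
- by apply: emeasurable_funM => //; exact: mI.
- by move=> z; rewrite mule_ge0.
by apply: eq_integral => -[x y] _ /=; rewrite addrK.
Qed.

(** Reduced to nonnegative functions by writing [f] as the difference of [f + |f|] and [|f|]. A
    translate is integrable because its integral is one term of a finite sum of nonnegative
    terms. *)
Lemma Rintegral_grid p N (f : E * E -> R) : 0 < p ->
  measurable_fun setT f ->
  leb2.-integrable (A `*` hcube (N%:R * p)) (EFin \o f) ->
  (forall b : {ffun 'I_d -> 'I_N}, leb2.-integrable (A `*` hcube p)
     (EFin \o (fun z => f (z.1, z.2 + p *: gridpt b)))) /\
  \int[leb2]_(z in A `*` hcube (N%:R * p)) f z =
  \sum_(b : {ffun 'I_d -> 'I_N}) \int[leb2]_(z in A `*` hcube p) f (z.1, z.2 + p *: gridpt b).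
Proof.
move=> p0 mf fi.
have ms c : measurable_fun setT (fun z : E * E => (z.1, z.2 + c)).
  apply/measurable_fun_pairP; split; first exact: measurable_fst.
  exact: (measurableT_comp (@measurable_fun_addrV R d c) measurable_snd).
have mS q : measurable (A `*` hcube q) by apply: measurableX => //; exact: measurable_hcube.
have key (h : E * E -> R) : measurable_fun setT h -> (forall z, 0 <= h z) ->
    leb2.-integrable (A `*` hcube (N%:R * p)) (EFin \o h) ->
    (forall b : {ffun 'I_d -> 'I_N}, leb2.-integrable (A `*` hcube p)
     (EFin \o (fun z => h (z.1, z.2 + p *: gridpt b)))) /\
    \int[leb2]_(z in A `*` hcube (N%:R * p)) h z =
    \sum_(b : {ffun 'I_d -> 'I_N}) \int[leb2]_(z in A `*` hcube p) h (z.1, z.2 + p *: gridpt b).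
  move=> mh h0 hi.
  have mh' : measurable_fun setT (EFin \o h) by exact/measurable_EFinP.
  have h0' z : (0 <= (EFin \o h) z)%E by rewrite lee_fin.
  have hE := ge0_integral_grid N p0 mh' h0'.
  have hoo := integrable_lty (mS _) hi.
  have fin (b : {ffun 'I_d -> 'I_N}) : leb2.-integrable (A `*` hcube p)
     (EFin \o (fun z => h (z.1, z.2 + p *: gridpt b))).
    apply/integrableP; split.
      apply/measurable_EFinP/measurable_funTS; exact: measurableT_comp.
    under eq_integral do rewrite /= ger0_norm//.
    apply: le_lt_trans hoo; rewrite hE (bigD1 b)//=; apply: leeDl.
    by apply: sume_ge0 => b' _; apply: integral_ge0 => z _; rewrite lee_fin.
  split=> //; rewrite /Rintegral hE sum_fine//= => b _.
  by apply: integrable_fin_num => //; exact: fin.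
have ni := integrable_norm fi.
have [//|//||k1 E1] := key (fun z => f z + `|f z|).
- by apply: measurable_funD => //; exact: measurableT_comp.
- by move=> z; rewrite -lerBlDl sub0r ler_normr lexx orbT.
- exact: integrable_add.
have [||//|k2 E2] := key (fun z => `|f z|).
- exact: measurableT_comp.
- by move=> z.
have fE (b : {ffun 'I_d -> 'I_N}) : (fun z : E * E => f (z.1, z.2 + p *: gridpt b)) =
   (fun z => (f (z.1, z.2 + p *: gridpt b) + `|f (z.1, z.2 + p *: gridpt b)|)
     - `|f (z.1, z.2 + p *: gridpt b)|).
  by apply/funext => z; rewrite addrK.
have fbi (b : {ffun 'I_d -> 'I_N}) : leb2.-integrable (A `*` hcube p)
     (EFin \o (fun z => f (z.1, z.2 + p *: gridpt b))).
  rewrite fE; exact: integrable_sub.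
split=> //.
have -> : \int[leb2]_(z in A `*` hcube (N%:R * p)) f z =
   \int[leb2]_(z in A `*` hcube (N%:R * p)) ((f z + `|f z|) - `|f z|).
  by apply: eq_Rintegral => z _; rewrite addrK.
rewrite RintegralB//; last exact: integrable_add.
rewrite E1 E2 -sumrB; apply: eq_bigr => b _; rewrite -RintegralB//.
by rewrite [in RHS]fE.
Qed.

End grid.

(** * Products of sigma-finite measures and integration over three factors *)

Section product_sigma_finite.
Context d1 d2 (T1 : measurableType d1) (T2 : measurableType d2) (R : realType).
Variables (m1 : {sigma_finite_measure set T1 -> \bar R}) (m2 : {sigma_finite_measure set T2 -> \bar R}).

Lemma sigma_finite_product : sigma_finite setT (m1 \x m2)%E.
Proof.
have /sigma_finiteP[F [FT ndF Foo]] := sigma_finiteT m1.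
have /sigma_finiteP[G [GT ndG Goo]] := sigma_finiteT m2.
exists (fun n => F n `*` G n) => [|n].
  apply/seteqP; split=> // -[x y] _.
  have [i _ Fi] : (\bigcup_n F n) x by rewrite -FT.
  have [j _ Gj] : (\bigcup_n G n) y by rewrite -GT.
  exists (i + j)%N => //; split.
    by move: Fi; apply/subsetPset/ndF/leq_addr.
  by move: Gj; apply/subsetPset/ndG/leq_addl.
have [mF Fn] := Foo n; have [mG Gn] := Goo n; split; first exact: measurableX.
by rewrite product_measure1E// lte_mul_pinfty// ge0_fin_numE.
Qed.

(* An alias of the product measure, since the sigma-finiteness of [m1 \x m2] itself
   is not found by unification when it is a factor of a further product. *)
Definition sigma_finite_prod : set (T1 * T2) -> \bar R := (m1 \x m2)%E.

HB.instance Definition _ := Measure.on sigma_finite_prod.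

HB.instance Definition _ := Measure_isSigmaFinite.Build _ _ _ sigma_finite_prod
  sigma_finite_product.

End product_sigma_finite.

Section tonelli_fubini3.
Context (R : realType) (d : nat).
Local Notation E := 'rV[R]_d.
Local Notation leb := (lebesgue_rV R d).
Local Notation leb2 := (leb \x leb)%E.
Local Notation mu := (leb \x leb \x leb)%E.

Lemma ge0_integral_rV3 (f : E * E * E -> \bar R) : measurable_fun setT f ->
  (forall z, 0 <= f z)%E -> (\int[mu]_z f z = \int[leb2]_w \int[leb]_y f (w, y))%E.
Proof.
move=> mf f0.
exact: (@fubini_tonelli1 _ _ (E * E)%type E R (sigma_finite_prod leb leb) leb f mf f0).
Qed.

(** Made for the martingale step, where the averaging identity holds almost everywhere on the first
    two factors and only the fibre integrals in the third can be compared. *)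
Lemma eq_integral_rV3 (f g : E * E * E -> \bar R) : mu.-integrable setT f ->
  mu.-integrable setT g ->
  {ae leb2, forall w, (\int[leb]_y f (w, y) = \int[leb]_y g (w, y))%E} ->
  (\int[mu]_z f z = \int[mu]_z g z)%E.
Proof.
move=> fi gi fg; pose m1 := sigma_finite_prod leb leb.
transitivity (\int[m1]_w \int[leb]_y f (w, y))%E.
  exact/esym/(@integral12_prod_meas1 _ _ (E * E)%type E R m1 leb f fi).
transitivity (\int[m1]_w \int[leb]_y g (w, y))%E; last first.
  exact: (@integral12_prod_meas1 _ _ (E * E)%type E R m1 leb g gi).
apply: ae_eq_integral => //.
- exact: measurable_int (@integrable_fubini_F _ _ (E * E)%type E R m1 leb f fi).
- exact: measurable_int (@integrable_fubini_F _ _ (E * E)%type E R m1 leb g gi).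
- by apply: filterS fg => w fgw _.
Qed.

End tonelli_fubini3.

Lemma integral_setD_null dd (T : measurableType dd) (R : realType)
    (mu : {measure set T -> \bar R}) (A B : set T) (f : T -> \bar R) :
  measurable A -> measurable B -> A `<=` B -> mu (B `\` A) = 0%E ->
  measurable_fun setT f -> (\int[mu]_(z in B) f z = \int[mu]_(z in A) f z)%E.
Proof.
move=> mA mB AB BA0 mf; rewrite integral_mkcond [RHS]integral_mkcond.
apply: ae_eq_integral => //.
- by apply/(measurable_restrictT _ _).1 => //; exact: measurable_funTS.
- by apply/(measurable_restrictT _ _).1 => //; exact: measurable_funTS.
exists (B `\` A); split=> //; first exact: measurableD.
move=> z /= h; apply: contrapT => nBA; apply: h => _; rewrite !patchE.
have [zA|zA] := pselect (A z).
  by rewrite !mem_set//; exact: AB.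
rewrite [in RHS]memNset// memNset// => zB; apply: nBA; split => //.
Qed.

Section faces.
Context (R : realType) (d : nat).
Local Notation E := 'rV[R]_d.
Local Notation leb := (lebesgue_rV R d).
Local Notation leb2 := (leb \x leb)%E.

Lemma integral_cube_hcube p (f : E -> \bar R) : 0 <= p -> measurable_fun setT f ->
  (\int[leb]_(y in cube p) f y = \int[leb]_(y in hcube p) f y)%E.
Proof.
move=> p0 mf; apply: integral_setD_null => //.
- exact: measurable_hcube.
- exact: measurable_cube.
- exact: hcube_cube.
- exact: lebesgue_faces.
Qed.

Lemma integral_cube_hcube2 A p (f : E * E -> \bar R) : 0 <= p -> measurable A ->
  measurable_fun setT f ->
  (\int[leb2]_(z in A `*` cube p) f z = \int[leb2]_(z in A `*` hcube p) f z)%E.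
Proof.
move=> p0 mA mf; apply: integral_setD_null => //.
- by apply: measurableX => //; exact: measurable_hcube.
- by apply: measurableX => //; exact: measurable_cube.
- by move=> -[x y] [Ax hy]; split=> //; exact: hcube_cube.
rewrite (_ : _ `\` _ = A `*` (cube p `\` hcube p)); last first.
  apply/seteqP; split=> -[x y] /=; first by move=> [[Ax cy] h]; split=> //; split=> // hy; exact: h.
  by move=> [Ax [cy nh]]; split=> // -[].
have mF : measurable (cube p `\` hcube p : set E).
  by apply: measurableD; [exact: measurable_cube|exact: measurable_hcube].
transitivity (leb A * leb (cube p `\` hcube p))%E; first exact: product_measure1E.
by rewrite [X in (_ * X)%E]lebesgue_faces// mule0.
Qed.

(** The lower vertex belongs to [cell b] and serves as its representative: a function constant on
    cells is read off at the corners. *)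
Definition corner N (b : {ffun 'I_d -> 'I_N}) : E := N%:R^-1 *: gridpt R b.

Lemma cellE N (b : {ffun 'I_d -> 'I_N}) : (0 < N)%N ->
  cell b = [set y : E | hcube N%:R^-1 (y - corner b)].
Proof.
move=> N0; have N0' : (0 : R) < N%:R by rewrite ltr0n.
apply/seteqP; split=> y /= h i; have := h i;
  by rewrite !mxE (mulrC _ (b i)%:R) subr_ge0 ltrBlDl -natr1 mulrDl mul1r.
Qed.

Lemma corner_cell N (b : {ffun 'I_d -> 'I_N}) : (0 < N)%N -> cell b (corner b).
Proof.
move=> N0; rewrite cellE//= => i; rewrite !mxE subrr lexx invr_gt0 ltr0n//.
Qed.

Lemma measurable_cell N (b : {ffun 'I_d -> 'I_N}) : measurable (cell b : set E).
Proof.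
rewrite (_ : (cell b : set E) = [set y : E | forall i, `[(b i)%:R / N%:R, (b i).+1%:R / N%:R[%classic (y 0 i)]).
  apply: (measurable_rVP (I := fun i => `[(b i)%:R / N%:R, (b i).+1%:R / N%:R[%classic)) => i.
  exact: measurable_itv.
by apply/seteqP; split=> y h i; have := h i; rewrite /= in_itv.
Qed.

Lemma lebesgue_cell N (b : {ffun 'I_d -> 'I_N}) : (0 < N)%N ->
  leb (cell b) = ((N%:R ^- d)%:E).
Proof.
move=> N0.
rewrite (_ : (cell b : set E) = [set y : E | forall i, `[(b i)%:R / N%:R, (b i).+1%:R / N%:R[%classic (y 0 i)]); last first.
  by apply/seteqP; split=> y h i; have := h i; rewrite /= in_itv.
rewrite (lebesgue_rV_prod (I := fun i => `[(b i)%:R / N%:R, (b i).+1%:R / N%:R[%classic))//.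
rewrite (eq_bigr (fun=> (N%:R^-1)%:E)) => [|i _]; last first.
  have /= -> := @lebesgue_measure_itv R `[(b i)%:R / N%:R, (b i).+1%:R / N%:R[.
  rewrite lte_fin ltr_pM2r ?invr_gt0 ?ltr0n// ltr_nat ltnSn -EFinB; congr EFin.
  by rewrite -mulrBl -natr1 addrC addKr mul1r.
by rewrite prodEFin prodr_const card_ord exprVn.
Qed.

(** The tiling identity with [p = 1 / N]. That the cells cover [hcube 1] and that they lie in it are
    both read off from this sum. *)
Lemma indic_hcube1_cells N (y : E) : (0 < N)%N ->
  \sum_(b : {ffun 'I_d -> 'I_N}) \1_(cell b) y = \1_(hcube 1) y :> R.
Proof.
move=> N0; have N0' : (0 : R) < N%:R by rewrite ltr0n.
rewrite -[X in hcube X](mulfV (lt0r_neq0 N0')) -indic_hcube_grid ?invr_gt0//.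
by apply: eq_bigr => b _; rewrite cellE// !indicE.
Qed.

Lemma hcube1_cell N (y : E) : (0 < N)%N -> hcube 1 y -> exists b : {ffun 'I_d -> 'I_N}, cell b y.
Proof.
move=> N0 hy; apply: contrapT => /forallNP h.
have := indic_hcube1_cells y N0; rewrite big1 => [|b _]; last by rewrite indicE memNset.
by rewrite indicE mem_set// => /eqP; rewrite eq_sym oner_eq0.
Qed.

Lemma cell_hcube1 N (b : {ffun 'I_d -> 'I_N}) (y : E) : (0 < N)%N -> cell b y -> hcube 1 y.
Proof.
move=> N0 by_; apply: contrapT => h.
have := indic_hcube1_cells y N0; rewrite (bigD1 b)//= [X in _ = X]indicE (memNset h) [X in X + _]indicE (mem_set by_) => /eqP.
rewrite gt_eqF// ltr_pwDl// sumr_ge0// => i _; by rewrite indicE.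
Qed.

Lemma integral_cells N (phi : E -> R) : (0 < N)%N ->
  measurable_fun setT phi ->
  (forall (b : {ffun 'I_d -> 'I_N}) y, cell b y -> phi y = phi (corner b)) ->
  (\int[leb]_(y in cube 1) (phi y)%:E =
   (N%:R ^- d * \sum_(b : {ffun 'I_d -> 'I_N}) phi (corner b))%:E)%E.
Proof.
move=> N0 mphi phiE; rewrite integral_cube_hcube//; last exact/measurable_EFinP.
rewrite integral_mkcond.
have cfin (b : {ffun 'I_d -> 'I_N}) : (leb (cell b) < +oo)%E.
  by rewrite [X in (X < _)%E]lebesgue_cell// ltry.
have ii (b : {ffun 'I_d -> 'I_N}) : leb.-integrable setT (EFin \o \1_(cell b)).
  by apply: lty_integrable_indic; [exact: measurable_cell|exact: cfin].
have ci (b : {ffun 'I_d -> 'I_N}) : leb.-integrable setT (EFin \o (fun y => phi (corner b) * \1_(cell b) y)).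
  by apply: integrable_scale => //; exact: ii.
transitivity (\int[leb]_y (\sum_(b : {ffun 'I_d -> 'I_N}) (EFin \o (fun y => (phi (corner b) * \1_(cell b) y)%R)) y))%E.
  apply: eq_integral => y _; rewrite sumEFin.
  have -> : ((fun y => (phi y)%:E) \_ (hcube 1)) y = (phi y * \1_(hcube 1) y)%:E.
    by rewrite patchE indicE; case: (_ \in _); rewrite ?mulr1 ?mulr0.
  congr EFin; rewrite -(indic_hcube1_cells _ N0) mulr_sumr; apply: eq_bigr => b _.
  rewrite indicE; have [|] := boolP (y \in _); rewrite ?mulr0// !mulr1 inE.
  exact: phiE.
rewrite integral_sum//.
rewrite mulr_sumr -sumEFin; apply: eq_bigr => b _.
have -> : (\int[leb]_x (EFin \o (fun y => (phi (corner b) * \1_(cell b) y)%R)) x =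
   \int[leb]_x ((phi (corner b))%:E * (\1_(cell b) x)%:E))%E.
  by apply: eq_integral => y _; rewrite /= EFinM.
rewrite integralZl//; last exact: ii.
rewrite integral_indic//; last exact: measurable_cell.
by rewrite setIT [X in (_ * X)%E]lebesgue_cell// -EFinM mulrC.
Qed.

End faces.

(** * Mean values of periodic functions *)

Section periodic_mean.
Context (R : realType).
Local Notation mu := (@lebesgue_measure R).
Variables (p : R) (tau : R -> R).
Hypotheses (p0 : 0 < p) (mtau : measurable_fun setT tau) (tau0 : forall t, 0 <= tau t).
Hypothesis tau_per : forall t, tau (t + p) = tau t.

Let J (a b : R) : \bar R := (\int[mu]_(t in `[a, b[) (tau t)%:E)%E.

Let mt : measurable_fun setT (EFin \o tau). Proof. exact/measurable_EFinP. Qed.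

Let J_ge0 a b : (0 <= J a b)%E.
Proof. by apply: integral_ge0 => t _; rewrite lee_fin. Qed.

Let tau_perz (k : int) t : tau (t + k%:~R * p) = tau t.
Proof.
have pn (n : nat) s : tau (s + n%:R * p) = tau s.
  elim: n s => [s|n ih s]; first by rewrite mul0r addr0.
  by rewrite -natr1 mulrDl mul1r addrA tau_per ih.
case: k => n; first exact: pn.
by rewrite NegzE mulrNz mulNr -[LHS](pn n.+1) subrK.
Qed.

Let J_affine (e a b : R) : 0 < e ->
  (\int[mu]_(t in `[(e * a)%R, (e * b)%R[) (tau (e^-1 * t))%:E = e%:E * J a b)%E.
Proof.
move=> e0; rewrite /J integral_mkcond [in RHS]integral_mkcond.
have := @ge0_integral_affine R e^-1 0 ((EFin \o tau) \_ `[a, b[).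
rewrite invrK => <-; rewrite ?invr_gt0//.
- apply: eq_integral => t _; rewrite addr0 !patchE.
  rewrite (_ : (e^-1 * t \in `[a, b[%classic) = (t \in `[(e * a)%R, (e * b)%R[%classic))//.
  by apply/idP/idP; rewrite !inE/= !in_itv/= ler_pdivlMl// ltr_pdivrMl.
- by apply/(measurable_restrictT _ _).1 => //; exact: measurable_funTS.
- by move=> t; rewrite patchE; case: ifPn => //=; rewrite lee_fin.
Qed.

Let J_shift (k : int) a b : J (a + k%:~R * p) (b + k%:~R * p) = J a b.
Proof.
rewrite /J integral_mkcond [in RHS]integral_mkcond.
have := @ge0_integral_affine R 1 (k%:~R * p) ((EFin \o tau) \_ `[(a + k%:~R * p)%R, (b + k%:~R * p)%R[).
rewrite invr1 mul1e => <-//.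
- apply: eq_integral => t _; rewrite mul1r !patchE /= tau_perz.
  rewrite (_ : (t + k%:~R * p \in _) = (t \in `[a, b[%classic))//.
  by apply/idP/idP; rewrite !inE/= !in_itv/= lerD2r ltrD2r.
- by apply/(measurable_restrictT _ _).1 => //; exact: measurable_funTS.
- by move=> t; rewrite patchE; case: ifPn => //=; rewrite lee_fin.
Qed.

Let J_cat a b c : a <= b -> b <= c -> J a c = (J a b + J b c)%E.
Proof.
move=> ab bc; rewrite /J (@itv_bndbnd_setU _ _ _ (BLeft b)) ?bnd_simp//.
rewrite ge0_integral_setU//=.
- by apply: measurable_funTS.
- by move=> t _; rewrite lee_fin.
- by apply/disj_setPS => t [/=]; rewrite !in_itv/= => /andP[_ tb] /andP[/(lt_le_trans tb)]; rewrite ltxx.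
Qed.

(** Up to a whole number of periods, [s] is some [r] in [[0, p]]; the part of [[r, r + p[] beyond
    [p] is [[0, r[] moved by one period. *)
Let J_period s : J s (s + p) = J 0 p.
Proof.
pose k := Num.floor (s / p); pose r := s - k%:~R * p.
have r0 : 0 <= r by rewrite subr_ge0 -ler_pdivlMr// floor_le_tmp.
have rp : r <= p.
  rewrite lerBlDr -[X in X + _]mul1r -mulrDl -ler_pdivrMr// ltW//.
  by rewrite addrC -intrD1 floorD1_gt.
have -> : s = r + k%:~R * p by rewrite subrK.
rewrite (addrAC r) J_shift (J_cat r0 rp).
rewrite (@J_cat r p (r + p))//; last by rewrite lerDr.
by rewrite addeC; congr (_ + _)%E; rewrite -(J_shift 1 0 r) add0r mul1r.
Qed.

Let J_periods s n : J s (s + n%:R * p) = (n%:R%:E * J 0 p)%E.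
Proof.
elim: n => [|n ih].
  by rewrite mul0r addr0 mul0e /J set_itv_ge ?integral_set0// bnd_simp ltxx.
have -> : s + n.+1%:R * p = (s + n%:R * p) + p by rewrite -natr1; ring.
rewrite (@J_cat _ (s + n%:R * p)); last 2 first.
- by rewrite lerDl mulr_ge0// ltW.
- by rewrite lerDl ltW.
by rewrite ih J_period -natr1 EFinD ge0_muleDl ?lee_fin// mul1e.
Qed.

Variable c : R.
Hypothesis Jc : (\int[mu]_(t in `[0%R, p[) (tau t)%:E = c%:E)%E.

(** With [n] the floor of [L / p], the interval contains [n] consecutive periods and is contained in
    [n + 1] of them; as [tau] is nonnegative, the error is at most the integral [c] over one
    period. *)
Let J_approx s L : 0 <= L ->
  exists2 x, J s (s + L) = x%:E & `|x - L / p * c| <= c.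
Proof.
move=> L0; pose n := Num.truncn (L / p).
have Lp0 : 0 <= L / p by rewrite divr_ge0// ltW.
have nL : n%:R * p <= L by rewrite -ler_pdivlMr// truncn_le.
have Ln : L <= n.+1%:R * p by rewrite -ler_pdivrMr// ltW// truncnS_gt.
have le1 : (n%:R%:E * c%:E <= J s (s + L))%E.
  rewrite -Jc -(J_periods s n) (@J_cat s (s + n%:R * p) (s + L)) ?leeDl//.
    by rewrite lerDl mulr_ge0// ltW.
  by rewrite lerD2l.
have le2 : (J s (s + L) <= n.+1%:R%:E * c%:E)%E.
  rewrite -Jc -(J_periods s n.+1) (@J_cat s (s + L) (s + n.+1%:R * p)) ?leeDl//.
    by rewrite lerDl.
  by rewrite lerD2l.
have Jfin : J s (s + L) \is a fin_num by rewrite ge0_fin_numE// (le_lt_trans le2)// ltry.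
exists (fine (J s (s + L))); first by rewrite fineK.
have c0 : 0 <= c by rewrite -lee_fin -Jc J_ge0.
move: le1 le2; rewrite -{1 2}(fineK Jfin) -!EFinM !lee_fin -natr1 mulrDl mul1r => le1 le2.
have l1 : n%:R * c <= L / p * c by rewrite ler_wpM2r// ler_pdivlMr.
have l2 : L / p * c <= n%:R * c + c.
  by rewrite -[X in _ + X]mul1r -mulrDl natr1 ler_wpM2r// ler_pdivrMr.
rewrite ler_norml; apply/andP; split; lra.
Qed.

(** In the fast variable the interval has length [(b - a) / e k]; scaling back multiplies the
    bounded error of [J_approx] by [e k]. *)
Lemma cvg_periodic_mean (a b : R) (e : nat -> R) : (forall k, 0 < e k) ->
  e @ \oo --> (0 : R) ->
  (\int[mu]_(t in `]a, b[) (tau ((e k)^-1 * t))%:E)%E @[k --> \oo] -->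
  (mu `]a, b[ * (c / p)%:E)%E.
Proof.
move=> e0 ecvg; have [ba|ab] := leP b a.
  rewrite set_itv_ge ?bnd_simp ?(le_gtF ba)// measure0 mul0e.
  by under eq_fun do rewrite integral_set0; exact: cvg_cst.
have aE k : a = e k * (a / e k) by rewrite mulrC divfK// gt_eqF.
have bE k : b = e k * (a / e k + (b - a) / e k).
  by rewrite mulrDr -aE mulrC divfK ?gt_eqF// addrC subrK.
have L0 k : 0 <= (b - a) / e k by rewrite divr_ge0// ltW// subr_gt0.
have [x xE xc] : {x : nat -> R & forall k, J (a / e k) (a / e k + (b - a) / e k) = (x k)%:E &
    forall k, `|x k - (b - a) / e k / p * c| <= c}.
  have h k : {x | J (a / e k) (a / e k + (b - a) / e k) = x%:E & `|x - (b - a) / e k / p * c| <= c}.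
    by apply: cid2; exact: J_approx.
  by exists (fun k => s2val (h k)) => k; [exact: s2valP (h k)|exact: s2valP' (h k)].
have -> : (mu `]a, b[ * (c / p)%:E)%E = ((b - a) * (c / p))%:E.
  have /= -> := @lebesgue_measure_itv R `]a, b[.
  by rewrite lte_fin ab -EFinB -EFinM.
have intE k : (\int[mu]_(t in `]a, b[) (tau ((e k)^-1 * t))%:E)%E = (e k * x k)%:E.
  have mk : measurable_fun setT (fun t => (tau ((e k)^-1 * t))%:E).
    by apply/measurable_EFinP/measurableT_comp => //; exact: measurable_funM.
  rewrite (_ : \int[mu]_(t in `]a, b[) _ = \int[mu]_(t in `[a, b[) (tau ((e k)^-1 * t))%:E)%E; last first.
    by rewrite integral_itv_obnd_cbnd//; exact: measurable_funTS.
  by rewrite {1}(aE k) {1}(bE k) J_affine// xE.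
under eq_fun do rewrite intE.
apply/fine_cvgP; split; first exact: nearW.
apply/cvgrPdist_le => /= eps eps0.
have c0 : 0 <= c by rewrite -lee_fin -Jc J_ge0.
(* [c + 1] rather than [c], which may vanish. *)
have c1 : 0 < eps / (c + 1) by rewrite divr_gt0// ltr_wpDl.
near=> k.
have ek : e k <= eps / (c + 1).
  apply: ltW; near: k; apply: (cvgr_lt _ ecvg); exact: c1.
have -> : (b - a) * (c / p) - e k * x k = - (e k * (x k - (b - a) / e k / p * c)).
  by field; rewrite !gt_eqF.
rewrite normrN normrM (ger0_norm (ltW (e0 k))).
apply: (@le_trans _ _ (eps / (c + 1) * c)); first by rewrite ler_pM// ltW.
by rewrite mulrAC ler_pdivrMr ?ltr_wpDl// ler_wpM2l// ?ltW// ltrDl.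
Unshelve. all: by end_near. Qed.

End periodic_mean.

(** * Periodic test functions *)

Section test_functions.
Context (R : realType).

(** Values in [[0, 1]] keep the class stable under products and supply constant bounds for dominated
    convergence. *)
Definition ptest (p : R) (tau : R -> R) :=
  [/\ continuous tau, forall t, tau (t + p) = tau t & forall t, 0 <= tau t <= 1].

Lemma ptestM p s t : ptest p s -> ptest p t -> ptest p (fun x => s x * t x).
Proof.
move=> [cs ps s01] [ct pt t01]; split=> [x|x|x].
- by apply: cvgM; [exact: cs|exact: ct].
- by rewrite ps pt.
- move: (s01 x) (t01 x) => /andP[s0 s1] /andP[t0 t1].
  by rewrite mulr_ge0//= mulr_ile1.
Qed.

Lemma ptest0 p : ptest p (fun=> 0).
Proof. by split=> // x; [exact: cvg_cst|rewrite lexx ler01]. Qed.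

Lemma ptest_measurable p tau : ptest p tau -> measurable_fun setT tau.
Proof. by move=> [ct _ _]; exact: continuous_measurable_fun. Qed.

Lemma ptest_muln p (n : nat) tau : ptest p tau -> ptest (n%:R * p) tau.
Proof.
move=> [ct pt t01]; split=> // t; elim: n t => [|n ih] t; first by rewrite mul0r addr0.
by rewrite -natr1 mulrDl mul1r addrA pt ih.
Qed.

(** The cosine decreases on [[0, pi]], so up to half a period from [c] it orders points by their
    distance to [c]; farther away it is evaluated at the reflected distance [p - |t - c|]. The
    bounds on [w] keep the arc inside one period. *)
Lemma cos_gt_arc (p c w t : R) : 0 < p -> w <= c -> c + w <= p -> 0 <= w ->
  0 < t < p ->
  (cos (2 * pi * w / p) < cos (2 * pi * (t - c) / p)) = (`|t - c| < w).
Proof.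
move=> p0 wc cwp w0 /andP[t0 tp].
have pi0 := pi_gt0 R.
have k0 : 0 < 2 * pi / p :> R by rewrite divr_gt0// mulr_gt0.
have -> : cos (2 * pi * (t - c) / p) = cos (2 * pi / p * `|t - c|).
  rewrite -(ger0_norm (ltW k0)) -normrM cos_norm; congr cos; ring.
have -> : 2 * pi * w / p = 2 * pi / p * w by ring.
set x := `|t - c|.
have x0 : 0 <= x by exact: normr_ge0.
have xpw : x <= p - w by rewrite /x ler_norml; apply/andP; split; lra.
have kp : 2 * pi / p * p = 2 * pi by rewrite divfK// gt_eqF.
have kI y : 0 <= y -> y <= p / 2 -> 2 * pi / p * y \in `[0, pi].
  move=> y0 yp; rewrite in_itv/= mulr_ge0 ?(ltW k0)//=.
  rewrite [leRHS](_ : _ = 2 * pi / p * (p / 2)); first by rewrite ler_pM2l.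
  by rewrite mulrA kp mulrAC mulfV ?mul1r.
have kw : 2 * pi / p * w \in `[0, pi] by apply: kI => //; lra.
have [xp|xp] := leP x (p / 2).
  by rewrite (ltr_cos (kI _ x0 xp) kw) ltr_pM2l.
have -> : cos (2 * pi / p * x) = cos (2 * pi / p * (p - x)).
  rewrite mulrBr kp -cosN -[LHS](cosD2pi (- _)); congr cos; ring.
have kpx : 2 * pi / p * (p - x) \in `[0, pi] by apply: kI; lra.
(* Beyond half a period both sides are false: [w <= p - x] because the arc stays in the period, and
   [w <= p / 2 < x]. *)
rewrite (ltr_cos kpx kw) ltr_pM2l// [RHS]ltNge (_ : w <= x); last by lra.
by apply/negbTE; rewrite -leNgt; lra.
Qed.

(** Convergence is claimed only inside the period, since clipping the interval to it may lose end
    points; in dimension [d] these become the faces of the cube, a null set. *)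
Lemma ptest_indic (p a b : R) : 0 < p -> exists tau : nat -> R -> R,
  (forall k, ptest p (tau k)) /\
  forall t, 0 < t < p -> tau ^~ t @ \oo --> (\1_(`]a, b[%classic) t : R).
Proof.
move=> p0; pose a' := Num.max a 0; pose b' := Num.min b p.
have indE t : 0 < t < p -> \1_(`]a, b[%classic) t = (a' < t < b')%R%:R :> R.
  move=> /andP[t0 tp]; rewrite indicE; congr ((nat_of_bool _)%:R).
  by apply/idP/idP; rewrite inE/= in_itv/= /a' /b' gt_max lt_min t0 tp !andbT.
have [ba|ab] := leP b' a'.
  exists (fun _ _ => 0); split=> [k|t tI]; first exact: ptest0.
  rewrite indE// (_ : (_ && _) = false); first exact: cvg_cst.
  by apply/negP => /andP[/lt_trans h /h]; rewrite ltNge ba.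
have a'0 : 0 <= a' by rewrite /a' le_max lexx orbT.
have b'p : b' <= p by rewrite /b' ge_min lexx orbT.
pose c := (a' + b') / 2; pose w := (b' - a') / 2.
(* [x > 0] exactly on [`]a', b'[] and [min 1 (k * max 0 x)] tends to its indicator. *)
pose x t := cos (2 * pi * (t - c) / p) - cos (2 * pi * w / p).
have xE t : 0 < t < p -> (0 < x t) = (a' < t < b').
  move=> tI; rewrite subr_gt0 cos_gt_arc//; rewrite /w /c; [|lra..].
  by rewrite ltr_norml; apply/andP/andP => -[h1 h2]; split; lra.
have cx : continuous x.
  move=> t; apply: cvgB; last exact: cvg_cst.
  apply: (@cvg_comp _ _ _ (fun t => 2 * pi * (t - c) / p) (@cos R)); last exact: continuous_cos.
  apply: cvgM; last exact: cvg_cst.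
  apply: cvgM; first exact: cvg_cst.
  by apply: cvgB; [exact: cvg_id|exact: cvg_cst].
exists (fun k t => Num.min 1 (k%:R * Num.max 0 (x t))); split=> [k|t tI].
  split=> [t|t|t].
  - apply: (@continuous_min _ _ (cst 1) (fun t => k%:R * Num.max 0 (x t))).
      exact: cvg_cst.
    apply: cvgM; first exact: cvg_cst.
    by apply: (@continuous_max _ _ (cst 0) x); [exact: cvg_cst|exact: cx].
  - rewrite (_ : x (t + p) = x t)// /x; congr (_ - _).
    rewrite -[RHS]cosD2pi; congr cos; field; by rewrite gt_eqF.
  - by rewrite le_min ler01 ge_min lexx/= mulr_ge0// le_max lexx.
rewrite indE// -xE//; have [x0|x0] := ltP 0 (x t); last first.
  by under eq_fun do rewrite mulr0 (min_idPr ler01); exact: cvg_cst.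
apply: cvg_near_cst; near=> k; apply/min_idPl.
rewrite -ler_pdivrMr// mul1r.
near: k; exact: nbhs_infty_ger.
Unshelve. all: by end_near. Qed.

End test_functions.

Section test_functions_rV.
Context (R : realType) (d : nat).
Local Notation mu := (@lebesgue_measure R).
Local Notation E := 'rV[R]_d.
Local Notation leb := (lebesgue_rV R d).

Lemma cvg_prodr (I : Type) (r : seq I) (T : Type) (F : set_system T) {FF : Filter F} (f : I -> T -> R) (l : I -> R) :
  (forall i, f i @ F --> l i) ->
  (\prod_(i <- r) f i t) @[t --> F] --> \prod_(i <- r) l i.
Proof.
move=> fl; elim: r => [|i r ih].
  by rewrite big_nil; under eq_fun do rewrite big_nil; exact: cvg_cst.
by rewrite big_cons; under eq_fun do rewrite big_cons; exact: cvgM.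
Qed.

Definition ptestd (p : R) (g : E -> R) := exists2 tau : 'I_d -> R -> R,
  forall i, ptest p (tau i) & g = fun y => \prod_i tau i (y 0 i).

Lemma ptestdM p g h : ptestd p g -> ptestd p h -> ptestd p (fun y => g y * h y).
Proof.
move=> [s sp ->] [t tp ->]; exists (fun i x => s i x * t i x) => [i|].
  exact: ptestM.
by apply/funext => y; rewrite big_split.
Qed.

Lemma ptestd_muln p (n : nat) g : ptestd p g -> ptestd (n%:R * p) g.
Proof. by move=> [s sp ->]; exists s => // i; exact: ptest_muln. Qed.

Lemma ptestd01 p g y : ptestd p g -> 0 <= g y <= 1.
Proof.
move=> [s sp ->]; elim/big_ind : _ => [|x z /andP[x0 x1] /andP[z0 z1]|i _].
- by rewrite ler01 lexx.
- by rewrite mulr_ge0//= mulr_ile1.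
- by have [_ _] := sp i.
Qed.

Lemma ptestd_measurable p g : ptestd p g -> measurable_fun setT g.
Proof.
move=> [s sp ->]; apply: measurable_prod => i _.
by apply: measurableT_comp (ptest_measurable (sp i)) _; exact: measurable_coord.
Qed.

Lemma ptestd_Cper p g : ptestd p g -> Cper p g.
Proof.
move=> [s sp ->]; split=> [y|y i].
  apply: (@cvg_prodr _ _ _ (nbhs y)) => i; have [cs _ _] := sp i.
  apply: (@cvg_comp _ _ _ (fun v : E => v 0 i) (s i)); last exact: cs.
  exact: coord_continuous.
apply: eq_bigr => j _; rewrite !mxE eqxx /=.
have [_ ps _] := sp j; have [_|_] := eqVneq j i; first by rewrite mulr1 ps.
by rewrite mulr0 addr0.
Qed.

Definition ocube (p : R) : set E := [set y | forall i, 0 < y 0 i < p].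

Lemma measurable_ocube p : measurable (ocube p).
Proof.
rewrite (_ : ocube p = [set y : E | forall i, `]0, p[%classic (y 0 i)]).
  apply: (measurable_rVP (I := fun=> `]0, p[%classic)) => i; exact: measurable_itv.
by apply/seteqP; split=> y h i; have := h i; rewrite /= in_itv.
Qed.

Lemma lebesgue_ofaces p : 0 <= p -> leb (cube p `\` ocube p) = 0%E.
Proof.
move=> p0; have ocE : ocube p = [set y : E | forall i, `]0, p[%classic (y 0 i)].
  by apply/seteqP; split=> y h i; have := h i; rewrite /= in_itv.
rewrite measureD//=; [|exact: measurable_cube|exact: measurable_ocube|].
  rewrite setIidr; last by move=> y h i; have /andP[/ltW -> /ltW] := h i.
  rewrite [X in (X - _)%E]lebesgue_cube// ocE.
  rewrite [X in (_ - X)%E](lebesgue_rV_prod (I := fun=> `]0, p[%classic))//.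
  rewrite (eq_bigr (fun=> p%:E)) => [|i _]; last first.
    have /= -> := @lebesgue_measure_itv R `]0, p[.
    rewrite lte_fin sube0; have [//|] := ltP 0 p.
    by rewrite le_eqVlt ltNge p0 orbF => /eqP ->.
  by rewrite prodEFin prodr_const card_ord subee.
by rewrite ltey_eq [X in X \is a fin_num]lebesgue_cube.
Qed.

Lemma ptestd_indic (p : R) (a b : E) : 0 < p -> exists g : nat -> E -> R,
  (forall k, ptestd p (g k)) /\
  forall y, ocube p y -> g ^~ y @ \oo --> (\1_(obox a b) y : R).
Proof.
move=> p0; have h i := cid (ptest_indic (a 0 i) (b 0 i) p0).
exists (fun k y => \prod_i sval (h i) k (y 0 i)); split=> [k|y yp].
  by exists (fun i => sval (h i) k) => // i; have [] := svalP (h i).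
rewrite (_ : \1_(obox a b) y = \prod_i \1_(`]a 0 i, b 0 i[%classic) (y 0 i)).
  by apply: cvg_prodr => i; have [_] := svalP (h i); apply; exact: yp.
by rewrite -(indic_rVP (fun i => `]a 0 i, b 0 i[%classic)); congr (\1_ _ _).
Qed.

(** The box and [g] are both products over the coordinates, so every integral factors and the limit
    is a finite product of one-dimensional means. *)
Lemma cvg_periodic_mean_rV (p : R) g (a b : E) (e : nat -> R) : 0 < p ->
  ptestd p g -> (forall k, 0 < e k) -> e @ \oo --> (0 : R) ->
  (\int[leb]_(x in obox a b) (g ((e k)^-1 *: x))%:E)%E @[k --> \oo] -->
  (leb (obox a b) * ((p ^+ d)^-1)%:E * \int[leb]_(y in cube p) (g y)%:E)%E.
Proof.
move=> p0 pg e0 ecvg; have mg := ptestd_measurable pg.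
have [s sp gE] := pg.
have ms i : measurable_fun setT (s i) := ptest_measurable (sp i).
have s0 i t : 0 <= s i t by have [_ _ /(_ t)/andP[]] := sp i.
have s1 i t : s i t <= 1 by have [_ _ /(_ t)/andP[]] := sp i.
pose c i := fine (\int[mu]_(t in `[0%R, p[) (s i t)%:E).
have cE i : (\int[mu]_(t in `[0%R, p[) (s i t)%:E = (c i)%:E)%E.
  rewrite fineK// ge0_fin_numE; last by apply: integral_ge0 => t _; rewrite lee_fin.
  apply: (@le_lt_trans _ _ (\int[mu]_(t in `[0%R, p[) (cst 1 t)))%E.
    apply: ge0_le_integral => //.
    - by move=> t _; rewrite lee_fin.
    - by apply/measurable_EFinP/measurable_funTS; exact: ms.
    - by move=> t _; rewrite lee_fin.
  rewrite integral_cst// mul1e.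
  have /= -> := @lebesgue_measure_itv R `[0, p[.
  by rewrite lte_fin p0 -EFinB ltry.
have sper i t : s i (t + p) = s i t by have [_ h _] := sp i.
have cvg1 i := cvg_periodic_mean (a := a 0 i) (b := b 0 i) p0 (ms i) (s0 i) (sper i) (cE i) e0 ecvg.
have oboxE : obox a b = [set v | forall i, `]a 0 i, b 0 i[%classic (v 0 i)].
  by apply/seteqP; split=> v hv i; have := hv i; rewrite /= in_itv.
have muE i : mu `]a 0 i, b 0 i[%classic = (fine (mu `]a 0 i, b 0 i[%classic))%:E.
  have /= -> := @lebesgue_measure_itv R `]a 0 i, b 0 i[.
  by case: ifPn.
have intE (I : 'I_d -> set R) (h : 'I_d -> R -> R) : (forall i, measurable (I i)) ->
    (forall i, measurable_fun setT (h i)) -> (forall i t, 0 <= h i t) ->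
    (\int[leb]_(x in [set v : E | forall i, I i (v 0%R i)]) (\prod_i h i (x 0%R i))%:E =
     \prod_i \int[mu]_(t in I i) (h i t)%:E)%E.
  move=> mI mh h0; rewrite integral_mkcond.
  transitivity (\int[leb]_x (\prod_i (\1_(I i) (x 0%R i) * h i (x 0%R i)))%:E)%E.
    by apply: eq_integral => v _; rewrite epatch_indic big_split/= -(indic_rVP I) muleC.
  rewrite (integral_rV_prod (f := fun i t => \1_(I i) t * h i t)).
  - apply: eq_bigr => i _; rewrite [RHS]integral_mkcond; apply: eq_integral => t _.
    by rewrite epatch_indic muleC.
  - by move=> i; apply: measurable_funM => //; exact: measurable_indic.
  - by move=> i t; rewrite mulr_ge0.
have -> : (leb (obox a b) * ((p ^+ d)^-1)%:E * \int[leb]_(y in cube p) (g y)%:E)%E =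
    (\prod_i (fine (mu `]a 0 i, b 0 i[%classic) * (c i / p)))%:E.
  rewrite integral_cube_hcube ?ltW//; last exact/measurable_EFinP.
  rewrite hcubeE gE (intE (fun=> `[0, p[%classic) s)//.
  rewrite oboxE (lebesgue_rV_prod (I := fun i => `]a 0 i, b 0 i[%classic)); last first.
    by move=> i; exact: measurable_itv.
  under [X in (X * _ * _)%E]eq_bigr do rewrite muE.
  under [X in (_ * _ * X)%E]eq_bigr do rewrite cE.
  rewrite !prodEFin -!EFinM; congr EFin.
  by rewrite !big_split/= prodr_const card_ord exprVn -mulrA (mulrC (p ^- d)).
have intk k : exists2 x : 'I_d -> R,
    (\int[leb]_(x in obox a b) (g ((e k)^-1 *: x))%:E)%E = (\prod_i x i)%:E &
    forall i, (\int[mu]_(t in `]a 0%R i, b 0%R i[) (s i ((e k)^-1 * t))%:E)%E = (x i)%:E.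
  have mk i : measurable_fun setT (fun t => s i ((e k)^-1 * t)).
    by apply: measurableT_comp => //; exact: measurable_funM.
  have fin i : (\int[mu]_(t in `]a 0%R i, b 0%R i[) (s i ((e k)^-1 * t))%:E)%E \is a fin_num.
    rewrite ge0_fin_numE; last by apply: integral_ge0 => t _; rewrite lee_fin.
    apply: (@le_lt_trans _ _ (\int[mu]_(t in `]a 0%R i, b 0%R i[) (cst 1 t)))%E.
      apply: ge0_le_integral => //.
      - by move=> t _; rewrite lee_fin.
      - by apply/measurable_EFinP/measurable_funTS; exact: mk.
      - by move=> t _; rewrite lee_fin.
    by rewrite integral_cst// mul1e [X in (X < _)%E]muE ltry.
  exists (fun i => fine (\int[mu]_(t in `]a 0%R i, b 0%R i[) (s i ((e k)^-1 * t))%:E)%E); last first.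
    by move=> i; rewrite fineK.
  rewrite oboxE gE -prodEFin.
  rewrite (_ : (fun x : E => _) = fun x : E => (\prod_i s i ((e k)^-1 * x 0 i))%:E); last first.
    by apply/funext => v; congr EFin; apply: eq_bigr => i _; rewrite mxE.
  rewrite (intE (fun i => `]a 0 i, b 0 i[%classic) (fun i t => s i ((e k)^-1 * t)))//.
    by apply: eq_bigr => i _; rewrite fineK.
pose x k := s2val (cid2 (intk k)).
have xE k := s2valP (cid2 (intk k)); have xE' k := s2valP' (cid2 (intk k)).
apply: (@cvg_trans _ ((\prod_i x k i)%:E @[k --> \oo])).
  by apply: near_eq_cvg; apply: nearW => k; rewrite xE.
apply/fine_cvgP; split; first exact: nearW.
apply: cvg_prodr => i.
have := cvg1 i; rewrite muE -EFinM => /fine_cvgP[_]; apply: cvg_trans.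
by apply: near_eq_cvg; apply: nearW => k /=; rewrite xE'.
Qed.

End test_functions_rV.

(** * Density of the test functions *)

Section density.
Context (R : realType) (d : nat).
Local Notation E := 'rV[R]_d.
Local Notation leb := (lebesgue_rV R d).
Local Notation leb2 := (leb \x leb)%E.

(** The linear span built one term at a time, so that linear statements about test functions are
    proved by induction. *)
Inductive tspan (p : R) : (E * E -> R) -> Prop :=
| tspan0 : tspan p (fun=> 0)
| tspan_cons c a b g f : ptestd p g -> tspan p f ->
    tspan p (fun z => c * (\1_(obox a b) z.1 * g z.2) + f z).

Lemma tspanD p f h : tspan p f -> tspan p h -> tspan p (fun z => f z + h z).
Proof.
move=> + th; elim=> [|c a b g {}f pg tf ih].
  by under eq_fun do rewrite add0r.
by under eq_fun do rewrite -addrA; exact: tspan_cons.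
Qed.

Lemma tspanZ p k f : tspan p f -> tspan p (fun z => k * f z).
Proof.
elim=> [|c a b g {}f pg tf ih].
  by under eq_fun do rewrite mulr0; exact: tspan0.
have := tspan_cons (k * c) a b pg ih; congr tspan.
by apply/funext => z; ring.
Qed.

(** Open boxes intersect in open boxes and [ptestd] is multiplicative. Squares of test functions are
    therefore test functions, which the norm bound relies on. *)
Lemma tspanM p f h : tspan p f -> tspan p h -> tspan p (fun z => f z * h z).
Proof.
move=> + th; elim=> [|c a b g {}f pg tf ih].
  by under eq_fun do rewrite mul0r; exact: tspan0.
under eq_fun do rewrite mulrDl; apply: tspanD => //.
elim: th => [|c' a' b' g' {}h pg' th {}ih].
  by under eq_fun do rewrite mulr0; exact: tspan0.
have [x [y xyE]] : exists x y : E, obox a b `&` obox a' b' = obox x y.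
  by rewrite oboxI; do 2 eexists.
have := tspan_cons (c * c') x y (ptestdM pg pg') ih; congr tspan.
by apply/funext => z; rewrite -xyE indicI /=; ring.
Qed.

Lemma tspan_measurable p f : tspan p f -> measurable_fun setT f.
Proof.
elim=> [//|c a b g {}f pg tf mf]; apply: measurable_funD => //.
apply: measurable_funM => //; apply: measurable_funM.
  apply: measurableT_comp measurable_fst; apply: measurable_indic; exact: measurable_obox.
exact: measurableT_comp (ptestd_measurable pg) measurable_snd.
Qed.

Lemma tspan_bounded p f : tspan p f -> exists B, forall z, `|f z| <= B.
Proof.
elim=> [|c a b g {}f pg tf [B fB]]; first by exists 0 => z; rewrite normr0.
exists (`|c| + B) => z; apply: le_trans (ler_normD _ _) _; apply: lerD => //.
rewrite normrM ler_piMr// normrM mulr_ile1//.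
- by rewrite indicE; case: (_ \in _); rewrite ?normr1 ?normr0.
- by have /andP[g0 g1] := ptestd01 z.2 pg; rewrite ger0_norm.
Qed.

Variables (p : R) (c : R).
Hypothesis p0 : 0 < p.
Let K : set E := obox (const_mx (- c)) (const_mx c).
Let W : set (E * E) := K `*` cube p.

Let mW : measurable W.
Proof. by apply: measurableX; [exact: measurable_obox|exact: measurable_cube]. Qed.

Let Woo : (leb2 W < +oo)%E.
Proof.
rewrite (_ : leb2 W = leb K * leb (cube p))%E; last first.
  by apply: product_measure1E; [exact: measurable_obox|exact: measurable_cube].
rewrite lte_mul_pinfty ?measure_ge0//; last by rewrite [X in (X < _)%E]lebesgue_cube ?ltry// ltW.
rewrite ge0_fin_numE//.
rewrite (_ : K = [set v : E | forall i, `]- c, c[%classic (v 0 i)]); last first.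
  by apply/seteqP; split=> v hv i; have := hv i; rewrite /= in_itv !mxE.
rewrite (lebesgue_rV_prod (I := fun=> `]- c, c[%classic)); last by move=> i; exact: measurable_itv.
rewrite (eq_bigr (fun=> (if (- c < c)%R then c - (- c) else 0)%R%:E)) => [|i _]; last first.
  have /= -> := @lebesgue_measure_itv R `]- c, c[.
  by rewrite lte_fin; case: ifP.
by rewrite prodEFin ltry.
Qed.

(** The closure of the span in L^2 of [W], with [del] bounding the squared distance; it is shown to
    be stable under the operations that build measurable functions from boxes. *)
Let clo (f : E * E -> R) := measurable_fun setT f /\ forall del : R, 0 < del ->
  exists2 psi, tspan p psi & (\int[leb2]_(z in W) ((f z - psi z) ^+ 2)%:E <= del%:E)%E.

Let msq (f h : E * E -> R) : measurable_fun setT f -> measurable_fun setT h ->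
  measurable_fun W (fun z => ((f z - h z) ^+ 2)%:E).
Proof.
move=> mf mh; apply: measurable_funTS; apply/measurable_EFinP/measurable_funX.
exact: measurable_funB.
Qed.

(** The triangle inequality for squared distances, as [(a + b) ^ 2 <= 2 a ^ 2 + 2 b ^ 2]; hence the
    quarters of [del] wherever it is used. *)
Let dist_le (f h u v w : E * E -> R) (x y : R) :
  measurable_fun setT f -> measurable_fun setT h ->
  measurable_fun setT u -> measurable_fun setT v -> measurable_fun setT w ->
  (forall z, w z = (f z - u z) + (h z - v z)) ->
  (\int[leb2]_(z in W) ((f z - u z) ^+ 2)%:E <= x%:E)%E ->
  (\int[leb2]_(z in W) ((h z - v z) ^+ 2)%:E <= y%:E)%E ->
  (\int[leb2]_(z in W) (w z ^+ 2)%:E <= (2 * x + 2 * y)%:E)%E.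
Proof.
move=> mf mh mu mv mw wE fu hv.
apply: (@le_trans _ _ (\int[leb2]_(z in W) (2%:E * ((f z - u z) ^+ 2)%:E + 2%:E * ((h z - v z) ^+ 2)%:E))%E).
  apply: ge0_le_integral => //.
  - by move=> z _; rewrite lee_fin sqr_ge0.
  - by apply: measurable_funTS; apply/measurable_EFinP/measurable_funX.
  - by apply: emeasurable_funD; apply: emeasurable_funM => //; exact: msq.
  - move=> z _; rewrite -!EFinM -EFinD lee_fin wE -subr_ge0.
    by rewrite (_ : _ - _ = ((f z - u z) - (h z - v z)) ^+ 2) ?sqr_ge0//; ring.
rewrite ge0_integralD//; last 4 first.
- by move=> z _; rewrite -EFinM lee_fin mulr_ge0// sqr_ge0.
- by apply: emeasurable_funM => //; exact: msq.
- by move=> z _; rewrite -EFinM lee_fin mulr_ge0// sqr_ge0.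
- by apply: emeasurable_funM => //; exact: msq.
rewrite !ge0_integralZl_EFin//; last 4 first.
- by move=> z _; rewrite lee_fin sqr_ge0.
- exact: msq.
- by move=> z _; rewrite lee_fin sqr_ge0.
- exact: msq.
apply: (@le_trans _ _ (2%:E * x%:E + 2%:E * y%:E)%E); last by rewrite -!EFinM -EFinD.
by apply: leeD; apply: lee_wpmul2l.
Qed.

Let clo_tspan psi : tspan p psi -> clo psi.
Proof.
move=> tp; split=> [|del del0]; first exact: tspan_measurable tp.
exists psi => //; under eq_integral do rewrite subrr expr0n.
by rewrite integral0 lee_fin ltW.
Qed.

Let cloD f h : clo f -> clo h -> clo (fun z => f z + h z).
Proof.
move=> [mf cf] [mh ch]; split=> [|del del0]; first exact: measurable_funD.
have del4 : 0 < del / 4 by rewrite divr_gt0.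
have [u tu fu] := cf _ del4; have [v tv hv] := ch _ del4.
have mu := tspan_measurable tu; have mv := tspan_measurable tv.
exists (fun z => u z + v z); first exact: tspanD.
apply: (le_trans (dist_le mf mh mu mv _ _ fu hv)).
- by apply: measurable_funB; exact: measurable_funD.
- by move=> z; ring.
- by rewrite lee_fin; lra.
Qed.

Let cloZ k f : clo f -> clo (fun z => k * f z).
Proof.
move=> [mf cf]; split=> [|del del0]; first exact: measurable_funM.
(* Adding 1 covers [k = 0]. *)
have k1 : 0 < k ^+ 2 + 1 by rewrite ltr_wpDl// sqr_ge0.
have [u tu fu] := cf _ (divr_gt0 del0 k1).
have mu := tspan_measurable tu.
exists (fun z => k * u z); first exact: tspanZ.
have -> : (\int[leb2]_(z in W) ((k * f z - k * u z) ^+ 2)%:E =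
    (k ^+ 2)%:E * \int[leb2]_(z in W) ((f z - u z) ^+ 2)%:E)%E.
  rewrite -ge0_integralZl_EFin ?sqr_ge0//.
  - by apply: eq_integral => z _; rewrite -EFinM -exprMn mulrBr.
  - by move=> z _; rewrite lee_fin sqr_ge0.
  - exact: msq.
apply: le_trans (lee_wpmul2l _ fu) _; first by rewrite lee_fin sqr_ge0.
rewrite -EFinM lee_fin mulrA ler_pdivrMr// [leRHS]mulrC ler_wpM2r ?(ltW del0)//.
by rewrite lerDl.
Qed.

Let clo_sum (I : Type) (s : seq I) (k : I -> R) (F : I -> E * E -> R) :
  (forall i, clo (F i)) -> clo (fun z => \sum_(i <- s) k i * F i z).
Proof.
move=> cF; elim: s => [|i s ih].
  by under eq_fun do rewrite big_nil; exact/clo_tspan/tspan0.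
by under eq_fun do rewrite big_cons; apply: cloD => //; exact: cloZ.
Qed.

(** Dominated convergence brings some [h N] close to [f] in squared distance, and that [h N] is in
    turn approximated by the span. *)
Let clo_cvg (f : E * E -> R) (h : nat -> E * E -> R) (G : E * E -> \bar R) :
  measurable_fun setT f -> (forall k, clo (h k)) ->
  {ae leb2, forall z, W z -> h ^~ z @ \oo --> f z} ->
  leb2.-integrable W G ->
  (forall k z, W z -> (((f z - h k z) ^+ 2)%:E <= G z)%E) ->
  clo f.
Proof.
move=> mf ch hf iG fG; split=> // del del0.
have del4 : 0 < del / 4 by rewrite divr_gt0.
pose D k z := ((f z - h k z) ^+ 2)%:E.
have mD k : measurable_fun W (D k) by apply: msq => //; exact: (ch k).1.
have D0 : {ae leb2, forall z, W z -> D ^~ z @ \oo --> cst 0%E z}.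
  apply: filterS hf => z hz Wz; apply/fine_cvgP; split; first exact: nearW.
  rewrite /D/= (_ : 0 = (f z - f z) ^+ 2); last by rewrite subrr expr0n.
  apply: (@cvg_comp _ _ _ (fun k => f z - h k z) (fun x => x ^+ 2) _ (nbhs (f z - f z))).
    by apply: cvgB; [exact: cvg_cst|exact: hz].
  exact: exprn_continuous.
have m0 : measurable_fun W (cst (0 : \bar R)) by exact: measurable_cst.
have DG : {ae leb2, forall z k, W z -> (`|D k z| <= G z)%E}.
  by apply: nearW => z k Wz; rewrite /D gee0_abs ?fG// lee_fin sqr_ge0.
have [_ _] := dominated_convergence mW mD m0 D0 iG DG.
rewrite integral0 => /fine_cvgP[fin /cvgr_le lim].
have [N _ hN] := filterI fin (lim _ del4).
have [finN leN] := hN N (leqnn N).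
have [mh chN] := ch N.
have [psi tpsi hpsi] := chN _ del4.
have mpsi := tspan_measurable tpsi.
have fh : (\int[leb2]_(z in W) ((f z - h N z) ^+ 2)%:E <= (del / 4)%:E)%E.
  by move: leN; rewrite -lee_fin /= fineK.
exists psi => //.
apply: (le_trans (dist_le mf mh mh mpsi _ _ fh hpsi)).
- exact: measurable_funB.
- by move=> z; ring.
- by rewrite lee_fin; lra.
Qed.

Let integrable1W : leb2.-integrable W (cst 1%E).
Proof. by apply/integrableP; split => //; rewrite integral_cst//= normr1 mul1e. Qed.

Lemma clo_indic (a b a' b' : E) : clo (fun z => \1_(obox a b) z.1 * \1_(obox a' b') z.2).
Proof.
have [g [pg cvg_g]] := ptestd_indic a' b' p0.
have mi (x y : E) : measurable_fun setT (\1_(obox x y) : E -> R).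
  by apply: measurable_indic; exact: measurable_obox.
apply: (@clo_cvg _ (fun k z => \1_(obox a b) z.1 * g k z.2) (cst 1%E)).
- by apply: measurable_funM; [exact: measurableT_comp (mi a b) measurable_fst
    |exact: measurableT_comp (mi a' b') measurable_snd].
- move=> k; have /clo_tspan := tspan_cons 1 a b (pg k) (tspan0 p); congr clo.
  by apply/funext => z; rewrite mul1r addr0.
(* The exceptional set consists of the faces of the cube, about which [ptestd_indic] says
   nothing. *)
- exists (K `*` (cube p `\` ocube p)); split.
  + apply: measurableX; first exact: measurable_obox.
    by apply: measurableD; [exact: measurable_cube|exact: measurable_ocube].
  + transitivity (leb K * leb (cube p `\` ocube p))%E.
      apply: product_measure1E; first exact: measurable_obox.
      by apply: measurableD; [exact: measurable_cube|exact: measurable_ocube].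
    by rewrite [X in (_ * X)%E]lebesgue_ofaces ?mule0// ltW.
  + move=> z /= h; apply: contrapT => nz; apply: h => -[Kz cz].
    have oz : ocube p z.2 by apply: contrapT => oz; exact: nz.
    by apply: cvgM; [exact: cvg_cst|exact: cvg_g].
- exact: integrable1W.
- move=> k z _; rewrite lee_fin -mulrBr exprMn mulr_ile1 ?sqr_ge0//.
  have /andP[g0 g1] := ptestd01 z.2 (pg k).
  rewrite indicE; move: (g k z.2) g0 g1 => t t0 t1.
  by case: (_ \in _) => /=; rewrite -subr_ge0 ?mulr1n ?mulr0n; [rewrite (_ : _ - _ = t * (2 - t))|rewrite (_ : _ - _ = (1 - t) * (1 + t))]; rewrite ?mulr_ge0//; lra.
Qed.

(** On [W] the constant 1 agrees with the indicator of a box, namely [K] times an open box slightly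
    larger than the period cube. *)
Let clo_T : clo \1_[set: E * E].
Proof.
have [mT cT] := clo_indic (const_mx (- c)) (const_mx c) (const_mx (- 1)) (const_mx (p + 1)).
split; first exact: measurable_indic.
move=> del /cT[psi tpsi hpsi]; exists psi => //; apply: le_trans hpsi.
rewrite le_eqVlt; apply/orP; left; apply/eqP; apply: eq_integral => z.
rewrite inE => -[Kz cz]; congr (((_ - _) ^+ 2)%:E).
rewrite !indicE !mem_set ?mulr1// => i; rewrite !mxE.
by have /andP[h1 h2] := cz i; apply/andP; split; lra.
Qed.

(** Dynkin induction: complements come from linearity, countable disjoint unions from dominated
    convergence of the partial sums of indicators. *)
Lemma clo_indicS (S : set (E * E)) : measurable S -> clo \1_S.
Proof.
move: S => S0 mS; apply: (@dynkin_induction _ (E * E)%type (@obox2 R d) (fun S => clo \1_S));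
  last by rewrite -measurable_obox2E.
- exact: measurable_obox2E.
- exact: obox2_setI.
- exact: clo_T.
- move=> _ [a [b [a' [b' ->]]]]; have := clo_indic a b a' b'; congr clo.
  by apply/funext => z; rewrite !indicE in_setX -natrM mulnb.
- move=> {mS}S mS cS; have := cloD clo_T (cloZ (-1) cS); congr clo.
  apply/funext => z; rewrite !indicE in_setT in_setC.
  by case: (_ \in _); rewrite /= ?mulr1 ?mulr0 ?subrr ?addr0.
- move=> F mF tF cF.
  apply: (@clo_cvg _ (fun n z => \sum_(i < n) 1 * \1_(F i) z) (cst 1%E)).
  + by apply: measurable_indic; exact: bigcup_measurable.
  + by move=> n; exact: clo_sum.
  + apply: nearW => z _.
    have [[i _ Fiz]|nF] := pselect ((\bigcup_i F i) z); last first.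
      rewrite indicE memNset//.
      rewrite (_ : (fun n : nat => _) = cst 0); first exact: cvg_cst.
      apply/funext => n; rewrite big1// => i _.
      by rewrite indicE memNset ?mulr0// => Fiz; apply: nF; exists i.
    rewrite indicE mem_set; last by exists i.
    apply: cvg_near_cst; exists i.+1 => // n /= ni.
    rewrite (bigD1 (Ordinal ni))//= indicE mem_set// mulr1 big1 ?addr0// => j ji.
    rewrite indicE memNset ?mulr0// => Fjz; move/eqP : ji; apply; apply/val_inj => /=.
    by apply: (tF j i) => //; exists z.
  + exact: integrable1W.
  + move=> n z _; rewrite lee_fin; set s := \sum_(i < n) _.
    (* Disjointness keeps the partial sum in [[0, 1]], so the squared error is at most 1. *)
    have s1 : 0 <= s <= 1.
      apply/andP; split; first by apply: sumr_ge0 => i _; rewrite mul1r.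
      have [[i Fiz]|nF] := pselect (exists i : 'I_n, F i z).
        rewrite /s (bigD1 i)//= big1 ?addr0 ?mul1r => [|j ji].
          by rewrite indicE; case: (_ \in _).
        rewrite indicE memNset ?mulr0// => Fjz; move/eqP : ji; apply; apply/val_inj => /=.
        by apply: (tF j i) => //; exists z.
      rewrite /s big1// => i _; rewrite indicE memNset ?mulr0// => Fiz.
      by apply: nF; exists i.
    have : 0 <= (\1_(\bigcup_i F i) z : R) <= 1 by rewrite indicE; case: (_ \in _); rewrite /= ?lexx ler01.
    move: s1; move: s (\1_(\bigcup_i F i) z) => s u /andP[s0 s1] /andP[u0 u1]; nra.
Qed.

Import HBNNSimple.

(** Simple functions increasing to [f] stay between 0 and [f], so [f ^ 2] dominates the squared
    errors. *)
Let clo_ge0 (f : E * E -> R) : measurable_fun setT f -> (forall z, 0 <= f z) ->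
  leb2.-integrable W (fun z => (f z ^+ 2)%:E) -> clo f.
Proof.
move=> mf f0 fi; have mf' : measurable_fun setT (EFin \o f) by exact/measurable_EFinP.
have f0' z : setT z -> (0 <= (EFin \o f) z)%E by rewrite lee_fin.
have [h [ndh hf]] := approximation measurableT mf' f0'.
have hz z : h ^~ z @ \oo --> f z by have /fine_cvgP[_] := hf z I.
have hle k z : h k z <= f z.
  rewrite -(cvg_lim (@Rhausdorff R) (hz z)).
  apply: (nondecreasing_cvgn_le (u_ := h ^~ z)); last by apply/cvg_ex; exists (f z).
  by move=> i j ij; exact/lefP/ndh.
apply: (clo_cvg mf (h := h) _ _ fi).
- move=> k; have mh y : measurable (h k @^-1` [set y]).
    by rewrite -[X in measurable X]setTI; exact: (measurable_funP (h k)).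
  have := clo_sum (finmap.enum_fset (fset_set (range (h k)))) id
     (F := fun y => \1_(h k @^-1` [set y])) (fun y => clo_indicS (mh y)).
  by congr clo; apply/funext => z; rewrite [RHS]fimfunE fsbig_finite.
- by apply: nearW => z _; exact: hz.
- move=> k z _; rewrite lee_fin lerXn2r ?nnegrE ?subr_ge0//.
  by rewrite lerBlDr lerDl.
Qed.

Theorem tspan_dense (f : E * E -> R) : measurable_fun setT f ->
  leb2.-integrable W (fun z => (f z ^+ 2)%:E) -> forall del : R, 0 < del ->
  exists2 psi, tspan p psi & (\int[leb2]_(z in W) ((f z - psi z) ^+ 2)%:E <= del%:E)%E.
Proof.
move=> mf fi.
suff [//] : clo f.
pose fp z := Num.max (f z) 0; pose fm z := Num.max (- f z) 0.
have fE : f = fun z => fp z + -1 * fm z.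
  apply/funext => z; rewrite /fp /fm; case: (leP (f z) 0) => h; case: leP; lra.
have mfp : measurable_fun setT fp by exact: measurable_maxr.
have mfm : measurable_fun setT fm by apply: measurable_maxr => //; exact: measurable_funN.
rewrite fE; apply: cloD; last apply: cloZ; apply: clo_ge0 => //.
- by move=> z; rewrite le_max lexx orbT.
- apply: le_integrable fi => //.
    by apply: measurable_funTS; apply/measurable_EFinP; exact: measurable_funX.
  move=> z _ /=; rewrite lee_fin !ger0_norm ?sqr_ge0//.
  have [h|h] := leP (f z) 0; rewrite /fp.
    by rewrite max_r// expr0n sqr_ge0.
  by rewrite max_l// ltW.
- by move=> z; rewrite le_max lexx orbT.
- apply: le_integrable fi => //.
    by apply: measurable_funTS; apply/measurable_EFinP; exact: measurable_funX.
  move=> z _ /=; rewrite lee_fin !ger0_norm ?sqr_ge0//.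
  have [h|h] := leP (- f z) 0; rewrite /fm.
    by rewrite max_r// expr0n sqr_ge0.
  by rewrite max_l ?sqrrN// ltW.
Qed.

End density.

(** The inner real integral is [fine] of an extended one that is known to be finite only for almost
    every [x]; hence the passage through a.e. equality. *)
Lemma Rintegral_fubini d1 d2 (T1 : measurableType d1) (T2 : measurableType d2) (R : realType)
    (m1 : {sigma_finite_measure set T1 -> \bar R}) (m2 : {sigma_finite_measure set T2 -> \bar R})
    (f : T1 * T2 -> R) : (m1 \x m2)%E.-integrable setT (EFin \o f) ->
  \int[m1]_x (\int[m2]_y f (x, y)) = \int[(m1 \x m2)%E]_z f z.
Proof.
move=> fi; rewrite /Rintegral -integral12_prod_meas1//; congr fine.
have iF := integrable_fubini_F fi.
apply: ae_eq_integral => //.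
- by apply/measurable_EFinP; apply: measurableT_comp => //; exact: measurable_int iF.
- exact: measurable_int iF.
- apply: filterS (integrable_ae measurableT iF) => x /(_ I) fx _.
  by rewrite fineK.
Qed.

(** * Two-scale limits *)

Section test_limits.
Context (R : realType) (d : nat).
Local Notation E := 'rV[R]_d.
Local Notation leb := (lebesgue_rV R d).
Local Notation leb2 := (leb \x leb)%E.
Variables (p : R) (p0 : 0 < p).

Lemma measurable_fun_scaleV (e : R) : measurable_fun setT (fun x : E => e *: x).
Proof.
apply: measurable_fun_rV => i; under eq_fun do rewrite mxE.
by apply: measurable_funM => //; exact: measurable_coord.
Qed.

Lemma measurable_tspan_diag f (e : R) : tspan p f ->
  measurable_fun setT (fun x : E => f (x, e *: x)).
Proof.
move=> tf; apply: (measurableT_comp (tspan_measurable tf)).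
by apply/measurable_fun_pairP; split; [exact: measurable_id|exact: measurable_fun_scaleV].
Qed.

Lemma lebesgue_oboxE (a b : E) :
  leb (obox a b) = (\prod_i Num.max (b 0 i - a 0 i) 0)%:E.
Proof.
rewrite (_ : obox a b = [set v : E | forall i, `]a 0 i, b 0 i[%classic (v 0 i)]); last first.
  by apply/seteqP; split=> v hv i; have := hv i; rewrite /= in_itv.
rewrite (lebesgue_rV_prod (I := fun i => `]a 0 i, b 0 i[%classic)); last by move=> i; exact: measurable_itv.
rewrite -prodEFin; apply: eq_bigr => i _.
have /= -> := @lebesgue_measure_itv R `]a 0 i, b 0 i[.
rewrite lte_fin; case: ltP => h; first by rewrite -EFinB max_l// subr_ge0 ltW.
by rewrite max_r// subr_le0.
Qed.

Lemma bounded_sqint dd (T : measurableType dd) (mu : {measure set T -> \bar R}) (A : set T) (f : T -> R) (B : R) :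
  measurable A -> (mu A < +oo)%E -> measurable_fun setT f -> (forall z, `|f z| <= B) ->
  sqint mu (fun z => \1_A z * f z).
Proof.
move=> mA Aoo mf fB.
apply: (sqint_le (sqintZ B (sqint_indic mA Aoo))).
  by apply: measurable_funM => //; exact: measurable_indic.
move=> z; rewrite !exprMn mulrC ler_wpM2r ?sqr_ge0//.
by rewrite -(real_normK (num_real (f z))) lerXn2r ?nnegrE// (le_trans _ (fB z)).
Qed.

Lemma bounded_integrable dd (T : measurableType dd) (mu : {measure set T -> \bar R}) (A : set T) (f : T -> R) (B : R) :
  measurable A -> (mu A < +oo)%E -> measurable_fun setT f -> (forall z, `|f z| <= B) ->
  mu.-integrable setT (EFin \o (fun z => \1_A z * f z)).
Proof.
move=> mA Aoo mf fB.
apply: (le_integrable measurableT _ _ (integrable_scale `|B| measurableT (lty_integrable_indic mA Aoo))).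
  by apply/measurable_EFinP/measurable_funM => //; exact: measurable_indic.
move=> z _; rewrite lee_fin !normrM mulrC normr_id ler_wpM2r// (le_trans (fB z))//.
exact: ler_norm.
Qed.

(** Linearity extends the mean value of a single product to the span. Applied to a square, it gives
    the limit of the squared norms of oscillating test functions. *)
Lemma tspan_mean f (e : nat -> R) : tspan p f -> (forall k, 0 < e k) ->
  e @ \oo --> (0 : R) ->
  [/\ forall k, leb.-integrable setT (EFin \o (fun x : E => f (x, (e k)^-1 *: x))),
      leb2.-integrable setT (EFin \o (fun z => \1_(cube p) z.2 * f z)) &
      \int[leb]_x f (x, (e k)^-1 *: x) @[k --> \oo] -->
        (p ^+ d)^-1 * \int[leb2]_z (\1_(cube p) z.2 * f z)].
Proof.
move=> tf e0 ecvg; elim: tf => [|c a b g {}f pg tf [i1 i2 cv]].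
  split=> [k||].
  - exact: integrable0.
  - by under eq_fun do rewrite mulr0; exact: integrable0.
  - have -> : \int[leb2]_z (\1_(cube p) z.2 * 0) = 0.
      by under eq_Rintegral do rewrite mulr0; rewrite /Rintegral integral0.
    by rewrite mulr0 /Rintegral integral0; exact: cvg_cst.
have gB y : `|g y| <= 1 by have /andP[g0 g1] := ptestd01 y pg; rewrite ger0_norm.
have mg := ptestd_measurable pg.
have mo := measurable_obox a b.
have mc := @measurable_cube R d p.
have Qoo : (leb (obox a b) < +oo)%E by rewrite [X in (X < _)%E]lebesgue_oboxE ltry.
have mgk k : measurable_fun setT (fun x : E => g ((e k)^-1 *: x)).
  by apply: measurableT_comp => //; exact: measurable_fun_scaleV.
have j1 k : leb.-integrable setT (EFin \o (fun x => \1_(obox a b) x * g ((e k)^-1 *: x))).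
  exact: (bounded_integrable mo Qoo (mgk k) (fun=> gB _)).
have Qc : leb2 (obox a b `*` cube p) = (leb (obox a b) * leb (cube p))%E.
  exact: product_measure1E.
have Qcoo : (leb2 (obox a b `*` cube p) < +oo)%E.
  rewrite Qc [X in (X * _)%E]lebesgue_oboxE [X in (_ * X)%E]lebesgue_cube ?ltW//.
  by rewrite -EFinM ltry.
have indX (z : E * E) : \1_(obox a b `*` cube p) z = \1_(obox a b) z.1 * \1_(cube p) z.2 :> R.
  by rewrite !indicE -natrM mulnb in_setX.
have j2 : leb2.-integrable setT (EFin \o (fun z => \1_(cube p) z.2 * (\1_(obox a b) z.1 * g z.2))).
  have := @bounded_integrable _ _ leb2 (obox a b `*` cube p) (fun z => g z.2) 1
    (measurableX mo mc) Qcoo (measurableT_comp mg measurable_snd) (fun=> gB _).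
  congr integrable; apply/funext => z /=; congr EFin; rewrite indX; ring.
split=> [k||].
- exact: (integrable_add measurableT (integrable_scale c measurableT (j1 k)) (i1 k)).
- have := integrable_add measurableT (integrable_scale c measurableT j2) i2.
  by congr integrable; apply/funext => z /=; congr EFin; ring.
have E2 : \int[leb2]_z (\1_(cube p) z.2 * (c * (\1_(obox a b) z.1 * g z.2) + f z)) =
    c * \int[leb2]_z (\1_(cube p) z.2 * (\1_(obox a b) z.1 * g z.2)) +
    \int[leb2]_z (\1_(cube p) z.2 * f z).
  rewrite -RintegralZl// -RintegralD//; last exact: integrable_scale.
  by apply: eq_Rintegral => z _; ring.
have E1 k : \int[leb]_x (c * (\1_(obox a b) x * g ((e k)^-1 *: x)) + f (x, (e k)^-1 *: x)) =
    c * \int[leb]_x (\1_(obox a b) x * g ((e k)^-1 *: x)) + \int[leb]_x f (x, (e k)^-1 *: x).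
  by rewrite -RintegralZl// -RintegralD//; exact: integrable_scale.
rewrite E2 mulrDr; under eq_fun do rewrite E1.
apply: cvgD => //; rewrite mulrCA; apply: cvgM; first exact: cvg_cst.
have := cvg_periodic_mean_rV (a := a) (b := b) p0 pg e0 ecvg.
have -> : (leb (obox a b) * ((p ^+ d)^-1)%:E * \int[leb]_(y in cube p) (g y)%:E)%E =
   ((p ^+ d)^-1 * \int[leb2]_z (\1_(cube p) z.2 * (\1_(obox a b) z.1 * g z.2)))%:E.
  rewrite EFinM EFin_Rintegral// -muleA muleCA; congr (_ * _)%E.
  rewrite fubini_tonelli1; last 2 first.
  + by have /integrableP[] := j2.
  + by move=> z; rewrite lee_fin !mulr_ge0//; have /andP[] := ptestd01 z.2 pg.
  rewrite muleC -[leb (obox a b)]/(leb (obox a b)) -[X in leb X]setIT -integral_indic//.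
  have g0 y : (0 <= (g y)%:E)%E by rewrite lee_fin; have /andP[] := ptestd01 y pg.
  rewrite -ge0_integralZl//; [|by apply/measurable_EFinP; exact: measurable_indic|exact: integral_ge0].
  apply: eq_integral => x _; rewrite /fubini_F/=.
  rewrite muleC [in LHS]integral_mkcond -ge0_integralZl//; last 2 first.
  + apply/(measurable_restrictT _ _).1 => //; apply: measurable_funTS; exact/measurable_EFinP.
  + by move=> y _; rewrite epatch_indic mule_ge0// lee_fin.
  by apply: eq_integral => y _; rewrite epatch_indic -!EFinM; congr EFin; ring.
move=> /fine_cvgP[_]; apply: cvg_trans; apply: near_eq_cvg; apply: nearW => k /=.
rewrite /Rintegral; congr fine; rewrite [in LHS]integral_mkcond.
by apply: eq_integral => x _; rewrite epatch_indic muleC.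
Qed.

End test_limits.

Section two_scale_limits.
Context (R : realType) (d : nat).
Local Notation E := 'rV[R]_d.
Local Notation leb := (lebesgue_rV R d).
Local Notation leb2 := (leb \x leb)%E.

Lemma sqint_bounded_integrable dd (T : measurableType dd) (mu : {measure set T -> \bar R})
    (A : set T) (v f : T -> R) (B : R) :
  measurable A -> (mu A < +oo)%E -> sqint mu v -> (forall z, ~ A z -> v z = 0) ->
  measurable_fun setT f -> (forall z, `|f z| <= B) ->
  mu.-integrable setT (EFin \o (fun z => v z * f z)).
Proof.
move=> mA Aoo sv vA mf fB; have := sqintM sv (bounded_sqint mA Aoo mf fB).
congr integrable; apply/funext => z /=; congr EFin.
have [Az|Az] := pselect (A z); first by rewrite indicE mem_set// mul1r.
by rewrite (vA _ Az) !mul0r.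
Qed.

Lemma sup_norm0 (g : E -> R) : (forall y, g y = 0) -> sup_norm g = 0.
Proof.
move=> g0; rewrite /sup_norm.
suff -> : range (fun y => `|g y|) = [set 0] by rewrite sup1.
apply/seteqP; split=> [_ [y _ <-]|_ ->] /=; first by rewrite g0 normr0.
by exists 0 => //=; rewrite g0 normr0.
Qed.

(** The function is already simple, with a single term, so a constant sequence approximates it. *)
Lemma Cper_test (Omega A : set E) p g : measurable Omega -> (leb Omega < +oo)%E ->
  measurable A -> Cper p g -> L2_Cper Omega p (fun x y => \1_A x * g y).
Proof.
move=> mO Ooo mA [cg pg]; split.
- move=> x _; split=> [y|y i]; last by rewrite pg.
  apply: (@cvg_comp _ _ _ g (fun t => \1_A x * t) (nbhs y) (nbhs (g y))).
    exact: cg.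
  exact: mulrl_continuous.
- exists (fun _ x y => \1_A x * g y).
    move=> _; exists 1%N, (fun=> A), (fun=> g); split=> // x y.
    by rewrite big_ord_recl big_ord0 addr0.
  apply: nearW => x _; rewrite (_ : (fun _ => _) = cst 0); first exact: cvg_cst.
  by apply/funext => k; apply: sup_norm0 => y /=; rewrite subrr.
- have supE x : sup_norm (fun y => \1_A x * g y) = \1_A x * sup_norm g.
    rewrite indicE; case: (_ \in _); first by rewrite mul1r; congr sup_norm; apply/funext => y; rewrite mul1r.
    by rewrite mul0r sup_norm0// => y; rewrite mul0r.
  apply: (@le_lt_trans _ _ (\int[leb]_(x in Omega) (cst (sup_norm g ^+ 2)%:E x))%E).
    apply: ge0_le_integral => //.
    + by move=> x _; rewrite lee_fin sqr_ge0.
    + under eq_fun do rewrite supE.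
      apply: measurable_funTS; apply/measurable_EFinP; apply: measurable_funX.
      by apply: measurable_funM => //; exact: measurable_indic.
    + move=> x _; rewrite lee_fin supE exprMn ler_piMl ?sqr_ge0// indicE.
  by rewrite integral_cst// lte_mul_pinfty// lee_fin sqr_ge0.
Qed.

Lemma measurable_cubeX (Omega : set E) p : measurable Omega -> measurable (Omega `*` cube p : set (E * E)).
Proof. by move=> mO; apply: measurableX => //; exact: measurable_cube. Qed.

Lemma lebesgue_cubeX_lty (Omega : set E) p : measurable Omega -> (leb Omega < +oo)%E -> 0 <= p ->
  (leb2 (Omega `*` cube p) < +oo)%E.
Proof.
move=> mO Ooo p0; rewrite (_ : leb2 _ = leb Omega * leb (cube p))%E; last first.
  by apply: product_measure1E => //; exact: measurable_cube.
rewrite lte_mul_pinfty ?ge0_fin_numE//.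
by rewrite [X in (X < _)%E]lebesgue_cube ?ltry.
Qed.

Section test.
Variables (Omega : set E) (p : R) (eps : nat -> R) (v : nat -> E -> R) (u0 : E * E -> R).
Hypotheses (mO : measurable Omega) (Ooo : (leb Omega < +oo)%E) (p0 : 0 < p).
Hypothesis sv : forall k, sqint leb (v k \_ Omega).
Hypothesis ts : two_scale_cvg Omega p eps v u0.
Let ut := u0 \_ (Omega `*` cube p).

Lemma two_scale_sqint : sqint leb2 ut.
Proof. by case: ts => /Lfun2P. Qed.

Let ut0 z : ~ (Omega `*` cube p) z -> ut z = 0.
Proof. by move=> nz; rewrite /ut patchE memNset. Qed.

Let v0 k x : ~ Omega x -> (v k \_ Omega) x = 0.
Proof. by move=> nz; rewrite patchE memNset. Qed.

(** The defining limit carried over to the span by linearity, with both sides extended by 0 and the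
    iterated integral written over the product. *)
Lemma two_scale_test f : tspan p f ->
  \int[leb]_x ((v k \_ Omega) x * f (x, (eps k)^-1 *: x)) @[k --> \oo] -->
  (p ^+ d)^-1 * \int[leb2]_z (ut z * f z).
Proof.
have ivf k h : tspan p h ->
    leb.-integrable setT (EFin \o (fun x => (v k \_ Omega) x * h (x, (eps k)^-1 *: x))).
  move=> th; have [B hB] := tspan_bounded th.
  apply: (sqint_bounded_integrable mO Ooo (sv k) (@v0 k) (measurable_tspan_diag _ th)) => z.
  exact: hB.
have iuf h : tspan p h -> leb2.-integrable setT (EFin \o (fun z => ut z * h z)).
  move=> th; have [B hB] := tspan_bounded th.
  exact: (sqint_bounded_integrable (measurable_cubeX p mO) (lebesgue_cubeX_lty mO Ooo (ltW p0))
    two_scale_sqint ut0 (tspan_measurable th) hB).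
elim=> [|c a b g {}f pg tf ih].
  have r0 dd (T : measurableType dd) (mu : {measure set T -> \bar R}) (h : T -> R) :
      \int[mu]_z (h z * 0) = 0.
    by under eq_Rintegral do rewrite mulr0; rewrite /Rintegral integral0.
  by rewrite r0 mulr0; under eq_fun do rewrite r0; exact: cvg_cst.
have mo := measurable_obox a b.
have tg : tspan p (fun z => \1_(obox a b) z.1 * g z.2).
  have := tspan_cons 1 a b pg (@tspan0 R d p); congr tspan.
  by apply/funext => z; rewrite mul1r addr0.
have E1 k : \int[leb]_x ((v k \_ Omega) x * (c * (\1_(obox a b) x * g ((eps k)^-1 *: x))
      + f (x, (eps k)^-1 *: x))) =
    c * \int[leb]_x ((v k \_ Omega) x * (\1_(obox a b) x * g ((eps k)^-1 *: x))) +
    \int[leb]_x ((v k \_ Omega) x * f (x, (eps k)^-1 *: x)).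
  rewrite -RintegralZl//; last exact: (ivf k _ tg).
  rewrite -RintegralD//; [|exact: integrable_scale (ivf k _ tg)|exact: ivf].
  by apply: eq_Rintegral => x _; ring.
have E2 : \int[leb2]_z (ut z * (c * (\1_(obox a b) z.1 * g z.2) + f z)) =
    c * \int[leb2]_z (ut z * (\1_(obox a b) z.1 * g z.2)) + \int[leb2]_z (ut z * f z).
  rewrite -RintegralZl//; last exact: iuf tg.
  rewrite -RintegralD//; [|exact: integrable_scale (iuf _ tg)|exact: iuf].
  by apply: eq_Rintegral => x _; ring.
rewrite E2 mulrDr; under eq_fun do rewrite E1.
apply: cvgD => //; rewrite mulrCA; apply: cvgM; first exact: cvg_cst.
have [_ /(_ _ (Cper_test mO Ooo mo (ptestd_Cper pg)))] := ts.
rewrite -(Rintegral_fubini (iuf _ tg)).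
have -> : \int[leb]_(x in Omega) (\int[leb]_(y in cube p) (u0 (x, y) * (\1_(obox a b) x * g y))) =
    \int[leb]_x (\int[leb]_y (ut (x, y) * (\1_(obox a b) x * g y))).
  rewrite Rintegral_mkcond; apply: eq_Rintegral => x _.
  rewrite patch_indic /=; have [Ox|Ox] := pselect (Omega x).
    rewrite [\1_Omega x]indicE mem_set// mulr1 Rintegral_mkcond; apply: eq_Rintegral => y _.
    rewrite /ut !patch_indic /= !indicE in_setX (mem_set Ox) /=.
    by rewrite mulrAC.
  rewrite [\1_Omega x]indicE memNset// mulr0 /Rintegral (eq_integral (cst 0%E)) ?integral0// => y _.
  by rewrite ut0 ?mul0r// => -[].
apply: cvg_trans; apply: near_eq_cvg; apply: nearW => k /=.
rewrite Rintegral_mkcond; apply: eq_Rintegral => x _.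
by rewrite !patch_indic /= mulrAC.
Qed.
End test.

(** With [f] in the span at squared distance at most [del] from [v] on [W], expanding the square
    gives [|v|^2 <= del + 2 <v, f> - |f|^2 <= del + X]. For [X = 0] this shows that a function
    orthogonal to the span vanishes almost everywhere. *)
Lemma tspan_norm_le (p c X : R) (v : E * E -> R) : 0 < p ->
  let W := obox (const_mx (- c)) (const_mx c) `*` cube p in
  sqint leb2 v -> (forall z, ~ W z -> v z = 0) ->
  (forall f, tspan p f ->
    2 * \int[leb2]_z (v z * f z) <= X + \int[leb2]_z ((\1_W z * f z) ^+ 2)) ->
  \int[leb2]_z (v z ^+ 2) <= X.
Proof.
move=> p0 W sv v0 hv; apply/ler_addgt0Pr => del del0.
have mW : measurable W by apply: measurable_cubeX; exact: measurable_obox.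
have Woo : (leb2 W < +oo)%E.
  apply: lebesgue_cubeX_lty; [exact: measurable_obox| |exact: ltW].
  by rewrite [X in (X < _)%E]lebesgue_oboxE ltry.
have [f tf hf] := tspan_dense p0 (c := c) sv.1
  (integrableS measurableT mW (@subsetT _ _) (sqint_integrable sv)) del0.
have [B fB] := tspan_bounded tf.
have sf := bounded_sqint mW Woo (tspan_measurable tf) fB.
have hf' : \int[leb2]_z ((v z - \1_W z * f z) ^+ 2) <= del.
  rewrite -lee_fin EFin_Rintegral; last exact/sqint_integrable/sqintB.
  apply: le_trans hf; rewrite [leRHS]integral_mkcond le_eqVlt; apply/orP; left; apply/eqP.
  apply: eq_integral => z _; rewrite patchE indicE.
  have [zW|zW] := boolP (z \in W); first by rewrite mul1r.
  by rewrite mul0r subr0 v0 ?expr0n// => Wz; rewrite mem_set in zW.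
have E1 : \int[leb2]_z ((v z - \1_W z * f z) ^+ 2) = \int[leb2]_z (v z ^+ 2)
    - 2 * \int[leb2]_z (v z * f z) + \int[leb2]_z ((\1_W z * f z) ^+ 2).
  have vfE z : v z * f z = v z * (\1_W z * f z).
    have [zW|zW] := pselect (W z); first by rewrite indicE mem_set// mul1r.
    by rewrite v0// !mul0r.
  have -> : \int[leb2]_z (v z * f z) = \int[leb2]_z (v z * (\1_W z * f z)).
    by apply: eq_Rintegral => z _; exact: vfE.
  have i1 := sqint_integrable sv; have i2 := sqint_integrable sf.
  have i3 := sqintM sv sf.
  rewrite -RintegralZl// -RintegralB//; last exact: integrable_scale.
  rewrite -RintegralD//; last by apply: integrable_sub => //; exact: integrable_scale.
  by apply: eq_Rintegral => z _; ring.
by have := hv f tf; move: hf'; rewrite E1; lra.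
Qed.

End two_scale_limits.

Section two_scale_consequences.
Context (R : realType) (d : nat).
Local Notation E := 'rV[R]_d.
Local Notation leb := (lebesgue_rV R d).
Local Notation leb2 := (leb \x leb)%E.

Lemma measurable_shift2 (c : E) : measurable_fun setT (fun z : E * E => (z.1, z.2 + c)).
Proof.
apply/measurable_fun_pairP; split; first exact: measurable_fst.
exact: (measurableT_comp (@measurable_fun_addrV R d c) measurable_snd).
Qed.

Lemma sqint_shift2 (c : E) f : sqint leb2 f -> sqint leb2 (fun z => f (z.1, z.2 + c)).
Proof.
move=> [mf foo]; split; first exact: measurableT_comp (measurable_shift2 c).
rewrite (ge0_integral_shift2 c (f := fun z => (f z ^+ 2)%:E))//.
- by apply/measurable_EFinP; exact: measurable_funX.
- by move=> z; rewrite lee_fin sqr_ge0.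
Qed.

Lemma ae_shift2 (c : E) (P : E * E -> Prop) : {ae leb2, forall z, P z} ->
  {ae leb2, forall z, P (z.1, z.2 + c)}.
Proof.
move=> [N [mN N0 PN]]; pose s (z : E * E) := (z.1, z.2 + c).
exists (s @^-1` N); split.
- by rewrite -[X in measurable X]setTI; exact: measurable_shift2.
- rewrite -[X in leb2 X]setIT -integral_indic//; last first.
    by rewrite -[X in measurable X]setTI; exact: measurable_shift2.
  rewrite -N0 -[in RHS](setIT N) -integral_indic//.
  rewrite -(ge0_integral_shift2 c (f := fun z => (\1_N z)%:E))//.
  by apply/measurable_EFinP; exact: measurable_indic.
- by move=> z /= nP; apply: PN.
Qed.

Lemma tspan_muln p (n : nat) (f : E * E -> R) : tspan p f -> tspan (n%:R * p) f.
Proof.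
by elim=> [|c a b g {}f pg tf ih]; [exact: tspan0|apply: tspan_cons => //; exact: ptestd_muln].
Qed.

Lemma tspan_periodic p (f : E * E -> R) : tspan p f -> forall N (b : {ffun 'I_d -> 'I_N}) z,
  f (z.1, z.2 + p *: gridpt R b) = f z.
Proof.
move=> + N b z; elim=> [//|c x y g {}f [s sp ->] tf ->/=].
congr (_ * (_ * _) + _); apply: eq_bigr => i _; rewrite !mxE.
have [_ + _] := ptest_muln (b i) (sp i); rewrite mulrC; exact.
Qed.

Section bound.
Variables (Omega : set E) (p c : R) (eps : nat -> R) (v : nat -> E -> R) (u0 : E * E -> R).
Hypotheses (mO : measurable Omega) (Ooo : (leb Omega < +oo)%E) (p0 : 0 < p).
Hypothesis OK : Omega `<=` obox (const_mx (- c)) (const_mx c).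
Hypotheses (eps0 : forall k, 0 < eps k) (eps_cvg : eps @ \oo --> (0 : R)).
Hypothesis sv : forall k, sqint leb (v k \_ Omega).
Let K : set E := obox (const_mx (- c)) (const_mx c).
Let mK : measurable K. Proof. exact: measurable_obox. Qed.
Let Koo : (leb K < +oo)%E.
Proof. by rewrite [X in (X < _)%E]lebesgue_oboxE ltry. Qed.

(** In [2 v f <= v ^ 2 + f ^ 2], taken at each [k], the product has a limit by two-scale convergence
    and [f ^ 2] by the mean value property, while [v ^ 2] is bounded by [C]. The factor [p ^ d]
    undoes the normalisation of the two limits. *)
Lemma two_scale_norm_le C : two_scale_cvg Omega p eps v u0 ->
  (forall k, \int[leb]_x ((v k \_ Omega) x ^+ 2) <= C) ->
  \int[leb2]_z ((u0 \_ (Omega `*` cube p)) z ^+ 2) <= p ^+ d * C.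
Proof.
move=> ts vC; set ut := u0 \_ _.
have sut := two_scale_sqint ts.
have pd0 : 0 < p ^+ d by rewrite exprn_gt0.
apply: (tspan_norm_le (c := c) p0) => //.
  move=> z nz; rewrite /ut patchE memNset// => -[Oz cz]; apply: nz; split=> //.
  exact: OK.
move=> f tf.
(* [f] need not be supported in [K]; multiplying it by the indicator of [K] keeps it in the span and
   makes the limit of its squared norm the one over [W]. *)
have tK : tspan p (fun z : E * E => \1_K z.1).
  have p1 : ptestd (d := d) p (fun=> 1).
    exists (fun _ _ => 1); last by apply/funext => y; rewrite big1.
    by move=> _; split=> // t; [exact: cvg_cst|rewrite ler01 lexx].
  have := tspan_cons 1 (const_mx (- c)) (const_mx c) p1 (@tspan0 R d p); congr tspan.
  by apply/funext => z; rewrite !(mul1r, mulr1, addr0).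
have tfK := tspanM tK tf; have th := tspanM tfK tfK.
have [_ _ cvb] := tspan_mean p0 th eps0 eps_cvg.
have ib k : leb.-integrable setT _ := (let: And3 ib _ _ := tspan_mean p0 th eps0 eps_cvg in ib) k.
have cva := two_scale_test mO Ooo p0 sv ts tfK.
have [B fB] := tspan_bounded tf.
have sfk k : sqint leb (fun x => \1_K x * f (x, (eps k)^-1 *: x)).
  exact: (bounded_sqint mK Koo (measurable_tspan_diag _ tf) (fun=> fB _)).
have le k : 2 * \int[leb]_x ((v k \_ Omega) x * (\1_K x * f (x, (eps k)^-1 *: x))) <=
   C + \int[leb]_x ((\1_K x * f (x, (eps k)^-1 *: x)) * (\1_K x * f (x, (eps k)^-1 *: x))).
  have i1 := sqintM (sv k) (sfk k); have i2 := sqint_integrable (sv k).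
  have i3 := sqintM (sfk k) (sfk k).
  apply: le_trans (lerD (vC k) (lexx _)).
  rewrite -RintegralZl// -RintegralD//; apply: le_Rintegral => //.
  - exact: integrable_scale.
  - exact: integrable_add.
  - move=> x _; rewrite -subr_ge0; set s := (v k \_ Omega) x; set t := \1_K x * _.
    by rewrite (_ : _ - _ = (s - t) ^+ 2) ?sqr_ge0//; ring.
have lim : 2 * ((p ^+ d)^-1 * \int[leb2]_z (ut z * (\1_K z.1 * f z))) <=
   C + (p ^+ d)^-1 * \int[leb2]_z (\1_(cube p) z.2 * ((\1_K z.1 * f z) * (\1_K z.1 * f z))).
  have c1 := cvgM (cvg_cst (2 : R)) cva; have c2 := cvgD (cvg_cst C) cvb.
  by apply: (ler_cvg_to (c1 _ _) (c2 _ _)); apply: nearW => k; exact: le.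
have -> : \int[leb2]_z (ut z * f z) = \int[leb2]_z (ut z * (\1_K z.1 * f z)).
  apply: eq_Rintegral => z _; have [Oz|Oz] := pselect (Omega z.1).
    by rewrite [\1_K _]indicE mem_set ?mul1r//; exact: OK.
  by rewrite /ut patchE memNset ?mul0r// => -[].
have -> : \int[leb2]_z ((\1_(K `*` cube p) z * f z) ^+ 2) =
   \int[leb2]_z (\1_(cube p) z.2 * ((\1_K z.1 * f z) * (\1_K z.1 * f z))).
  apply: eq_Rintegral => z _; rewrite !indicE in_setX -mulnb natrM.
  by case: (z.1 \in _); case: (z.2 \in _) => /=; ring.
have pdV0 : 0 < (p ^+ d)^-1 by rewrite invr_gt0.
rewrite -(ler_pM2l pdV0) mulrCA (mulrDr (p ^- d)) (mulrA (p ^- d) (p ^+ d)) mulVf ?mul1r//.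
by rewrite gt_eqF.
Qed.

(** The difference of the two sides is orthogonal to every [p]-periodic test function, and
    [tspan_norm_le] with [X = 0] makes it vanish. *)
Lemma two_scale_average (m : nat) w0 : (0 < m)%N ->
  two_scale_cvg Omega p eps v u0 -> two_scale_cvg Omega (m%:R * p) eps v w0 ->
  {ae leb2, forall z, (Omega `*` hcube p) z ->
    (u0 \_ (Omega `*` cube p)) z = (m%:R ^+ d)^-1 * \sum_(b : {ffun 'I_d -> 'I_m})
      (w0 \_ (Omega `*` cube (m%:R * p))) (z.1, z.2 + p *: gridpt R b)}.
Proof.
move=> m0 tsp tsq; set ut := u0 \_ (Omega `*` cube p).
pose wt := w0 \_ (Omega `*` cube (m%:R * p)).
have m0' : 0 < m%:R :> R by rewrite ltr0n.
have q0 : 0 < m%:R * p by rewrite mulr_gt0.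
have sut : sqint leb2 ut := two_scale_sqint tsp.
have swt : sqint leb2 wt := two_scale_sqint tsq.
have mH q : measurable (Omega `*` hcube q : set (E * E)).
  by apply: measurableX => //; exact: measurable_hcube.
(* Cutting off to one tile makes [vv] vanish outside [W], as [tspan_norm_le] requires. *)
pose S z := \1_(Omega `*` hcube p) z * \sum_(b : {ffun 'I_d -> 'I_m}) wt (z.1, z.2 + p *: gridpt R b).
pose vv z := (m%:R ^+ d)^-1 * S z - ut z.
have sS : sqint leb2 S.
  apply: sqint_indicM => //; elim: (index_enum _) => [|b s ih].
    under eq_fun do rewrite big_nil; split=> //.
    by under eq_integral do rewrite expr0n; rewrite integral0.
  under eq_fun do rewrite big_cons; apply: sqintD => //; exact: sqint_shift2.
have svv : sqint leb2 vv by apply: sqintB => //; exact: sqintZ.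
have utE z : ut z = \1_(Omega `*` cube p) z * ut z.
  by rewrite /ut patchE indicE; case: ifPn => _; rewrite ?mul1r ?mul0r.
have wtE z : wt z = \1_(Omega `*` cube (m%:R * p)) z * wt z.
  by rewrite /wt patchE indicE; case: ifPn => _; rewrite ?mul1r ?mul0r.
have vv0 : \int[leb2]_z (vv z ^+ 2) <= 0.
  apply: (tspan_norm_le (c := c) p0) => // [z nz|f tf].
    have nO : ~ (Omega `*` cube p) z by move=> [Oz cz]; apply: nz; split=> //; exact: OK.
    rewrite /vv /S utE !indicE !memNset ?mul0r ?mulr0 ?subr0// => -[Oz hz]; apply: nO.
    by split=> //; exact: hcube_cube.
  have [B fB] := tspan_bounded tf; have mf := tspan_measurable tf.
  (* Both sides are the limit of the same sequence, because [f] is admissible for either period. *)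
  have eqint : (p ^+ d)^-1 * \int[leb2]_z (ut z * f z) =
      ((m%:R * p) ^+ d)^-1 * \int[leb2]_z (wt z * f z).
    have c1 := two_scale_test mO Ooo p0 sv tsp tf.
    have c2 := two_scale_test mO Ooo q0 sv tsq (tspan_muln m tf).
    exact: (cvg_unique _ c1 c2).
  have iwt : leb2.-integrable setT (EFin \o (fun z => wt z * f z)).
    apply: (sqint_bounded_integrable (measurable_cubeX (m%:R * p) mO)
      (lebesgue_cubeX_lty mO Ooo (ltW q0)) swt _ mf fB) => z nz.
    by rewrite /wt patchE memNset.
  have iS : leb2.-integrable setT (EFin \o (fun z => S z * f z)).
    apply: (sqint_bounded_integrable (measurable_cubeX p mO)
      (lebesgue_cubeX_lty mO Ooo (ltW p0)) sS _ mf fB) => z nz.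
    rewrite /S indicE memNset ?mul0r// => -[Oz hz]; apply: nz; split=> //.
    exact: hcube_cube.
  have iut : leb2.-integrable setT (EFin \o (fun z => ut z * f z)).
    apply: (sqint_bounded_integrable (measurable_cubeX p mO)
      (lebesgue_cubeX_lty mO Ooo (ltW p0)) sut _ mf fB) => z nz.
    by rewrite utE indicE memNset ?mul0r.
  (* Unfolding: the integral over the large cube is a sum over its tiles, and [f] is unchanged by
     the translations between them. *)
  have SE : \int[leb2]_z (wt z * f z) = \int[leb2]_z (S z * f z).
    have mwf : measurable_fun setT (fun z => wt z * f z).
      by apply: measurable_funM => //; case: swt.
    have -> : \int[leb2]_z (wt z * f z) = \int[leb2]_(z in Omega `*` hcube (m%:R * p)) (wt z * f z).
      rewrite /Rintegral -integral_cube_hcube2//; [|exact: ltW|exact/measurable_EFinP].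
      rewrite [in RHS]integral_mkcond; congr fine; apply: eq_integral => z _.
      rewrite epatch_indic /= indicE; have [h|h] := pselect ((Omega `*` cube (m%:R * p)) z).
        by rewrite mem_set// mule1.
      by rewrite memNset// mule0 /wt patchE memNset// mul0r.
    have [ib ->] := Rintegral_grid mO (N := m) p0 mwf (integrableS measurableT (mH _) (@subsetT _ _) iwt).
    have [_ <-] := Rintegral_sum (index_enum _) (mH p) ib.
    rewrite Rintegral_mkcond; apply: eq_Rintegral => z _.
    rewrite patch_indic /= mulrC /S -mulrA mulr_suml; congr (_ * _).
    by apply: eq_bigr => b _; rewrite (tspan_periodic tf).
  have -> : \int[leb2]_z (vv z * f z) = (m%:R ^+ d)^-1 * \int[leb2]_z (S z * f z) -
      \int[leb2]_z (ut z * f z).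
    rewrite -RintegralZl// -RintegralB//; last exact: integrable_scale.
    by apply: eq_Rintegral => z _; rewrite /vv; ring.
  have -> : \int[leb2]_z (ut z * f z) = (m%:R ^+ d)^-1 * \int[leb2]_z (S z * f z).
    have pd0 : p ^+ d != 0 by rewrite expf_neq0// gt_eqF.
    by rewrite -[LHS](mulVKf pd0) eqint exprMn invfM -SE mulrA mulrCA mulfV// mulr1.
  by rewrite subrr mulr0 add0r ge0_sqint_integral.
have /(ae_eq_integral_abs leb2 measurableT) : measurable_fun setT (fun z => (vv z ^+ 2)%:E).
  by apply/measurable_EFinP; apply: measurable_funX; case: svv.
have : (\int[leb2]_z `|(vv z ^+ 2)%:E| = 0)%E.
  under eq_integral do rewrite gee0_abs ?lee_fin ?sqr_ge0//.
  rewrite -EFin_Rintegral; last exact: sqint_integrable.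
  by congr EFin; apply/eqP; rewrite eq_le vv0 ge0_sqint_integral.
move=> h /iffLR /(_ h); apply: filterS => z /= /(_ I) [/eqP]; rewrite sqrf_eq0 subr_eq0.
by move=> /eqP utz Oz; rewrite -/ut -utz /S indicE mem_set ?mul1r.
Qed.

End bound.
End two_scale_consequences.

(** * The shuffle function *)

Section shuffle_index.
Context (R : realType).
Variables (M m : nat -> nat).
Hypotheses (M0 : M 0%N = 1%N) (MS : forall n, M n.+1 = (M n * m n.+1)%N).
Hypothesis m_gt0 : forall n, (0 < m n.+1)%N.

Lemma M_gt0 n : (0 < M n)%N.
Proof. by elim: n => [|n ih]; rewrite ?M0// MS muln_gt0 ih m_gt0. Qed.

(* [H_star M m n] translates the [i]-th cell of length [1 / M n] onto the
   [shuf n i]-th one, for [i < M n]. *)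
Fixpoint shuf n i := if n is n'.+1 then (M n' * (i %% m n) + shuf n' (i %/ m n))%N else i.

Lemma divn_lt_M n i : (i < M n.+1)%N -> (i %/ m n.+1 < M n)%N.
Proof. by move=> iM; rewrite ltn_divLR// -MS. Qed.

Lemma shuf_lt n i : (i < M n)%N -> (shuf n i < M n)%N.
Proof.
elim: n i => [//|n ih] i iM /=.
apply: (@leq_trans (M n * (i %% m n.+1) + M n)).
  by rewrite ltn_add2l ih// divn_lt_M.
by rewrite addnC -mulnS MS leq_mul2l ltn_mod m_gt0 orbT.
Qed.

(** [shuf] reverses mixed-radix digits: the last digit [i %% m] receives the largest weight [M n],
    and the remaining digits are shuffled recursively into a number below [M n]. Division by [M n]
    thus recovers the digits one after another. *)
Lemma shuf_inj n i j : (i < M n)%N -> (j < M n)%N -> shuf n i = shuf n j -> i = j.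
Proof.
elim: n i j => [//|n ih] i j iM jM /= e.
have si := shuf_lt (divn_lt_M iM); have sj := shuf_lt (divn_lt_M jM).
have e1 : (i %% m n.+1 = j %% m n.+1)%N.
  have q x y : (y < M n)%N -> ((M n * x + y) %/ M n = x)%N.
    by move=> yM; rewrite mulnC divnMDl ?M_gt0// divn_small// addn0.
  by rewrite -(q (i %% m n.+1)%N _ si) e q.
have e2 : (i %/ m n.+1 = j %/ m n.+1)%N.
  apply: ih; rewrite ?divn_lt_M//; move: e; rewrite e1; exact: addnI.
by rewrite (divn_eq i (m n.+1)) (divn_eq j (m n.+1)) e1 e2.
Qed.

Definition in_cell (N i : nat) (t : R) := i%:R / N%:R <= t < i.+1%:R / N%:R.

Lemma in_cellE N i t : (0 < N)%N -> in_cell N i t = (i%:R <= N%:R * t < i%:R + 1).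
Proof.
move=> N0; have N0' : (0 : R) < N%:R by rewrite ltr0n.
by rewrite /in_cell ler_pdivrMr// ltr_pdivlMr// -natr1 mulrC.
Qed.

Lemma in_cell_uniq N i j t : (0 < N)%N -> in_cell N i t -> in_cell N j t -> i = j.
Proof.
move=> N0; rewrite !in_cellE// => /andP[i1 i2] /andP[j1 j2].
have := le_lt_trans i1 j2; have := le_lt_trans j1 i2.
by rewrite !natr1 !ltr_nat !ltnS => h1 h2; apply/eqP; rewrite eqn_leq h1 h2.
Qed.

Lemma in_cell_divn n i t : in_cell (M n.+1) i t -> in_cell (M n) (i %/ m n.+1) t.
Proof.
rewrite !in_cellE ?M_gt0// => /andP[i1 i2].
have m0 : (0 : R) < (m n.+1)%:R by rewrite ltr0n.
move: i1 i2; rewrite MS natrM => i1 i2.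
have id := divn_eq i (m n.+1); have im := ltn_pmod i (m_gt0 n).
apply/andP; split.
  rewrite -(ler_pM2r m0) mulrAC; apply: le_trans i1.
  by rewrite -natrM ler_nat [leqRHS]id leq_addr.
rewrite -(ltr_pM2r m0) [ltLHS]mulrAC; apply: lt_le_trans i2 _.
by rewrite !natr1 -natrM ler_nat {1}id mulSn addnC ltn_add2r.
Qed.

(** A point of the fine cell [i = j m + r] lies in the coarse cell [j], which is translated to the
    coarse cell [a]; there it occupies the fine cell [a m + r], and [R_shuffle] sends this index to
    [M n r + a]. *)
Lemma H_star_cell n i t : in_cell (M n) i t ->
  H_star M m n t = (shuf n i)%:R / (M n)%:R + (t - i%:R / (M n)%:R).
Proof.
elim: n i => [|n ih] i; first by rewrite /= M0 !divr1 addrCA subrr addr0.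
move=> it; have it' := in_cell_divn it.
rewrite /= (ih _ it') /h_shuffle -MS.
set j := (i %/ m n.+1)%N; set a := shuf n j; set r := (i %% m n.+1)%N.
pose Y : R := a%:R / (M n)%:R + (t - j%:R / (M n)%:R); rewrite -/Y.
have MR0 : ((M n)%:R : R) != 0 by rewrite pnatr_eq0 -lt0n M_gt0.
have mR0 : ((m n.+1)%:R : R) != 0 by rewrite pnatr_eq0 -lt0n.
have iE : (i%:R : R) = j%:R * (m n.+1)%:R + r%:R by rewrite -natrM -natrD -divn_eq.
have YE : (M n.+1)%:R * Y = (a * m n.+1 + r)%:R + ((M n.+1)%:R * t - i%:R).
  by rewrite iE MS !natrM natrD !natrM /Y; field.
have tr : Num.truncn ((M n.+1)%:R * Y) = (a * m n.+1 + r)%N.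
  apply: truncn_def; rewrite YE; move: it; rewrite in_cellE ?M_gt0// => /andP[i1 i2].
  by rewrite -natr1; apply/andP; split; lra.
rewrite tr /R_shuffle modnMDl modn_small ?ltn_pmod// divnMDl// divn_small ?ltn_pmod// addn0.
rewrite /Y iE MS !natrD !natrM; field.
by rewrite mR0.
Qed.

Lemma floor_H_star n i t : in_cell (M n) i t ->
  Num.floor ((M n)%:R * H_star M m n t) = (shuf n i : int).
Proof.
move=> it; rewrite (H_star_cell it).
have MR0 : ((M n)%:R : R) != 0 by rewrite pnatr_eq0 -lt0n M_gt0.
have -> : (M n)%:R * ((shuf n i)%:R / (M n)%:R + (t - i%:R / (M n)%:R)) =
   (shuf n i)%:R + ((M n)%:R * t - i%:R) :> R by field.
apply/floor_def; move: it; rewrite in_cellE ?M_gt0// => /andP[i1 i2].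
by rewrite intrD -pmulrn; apply/andP; split; lra.
Qed.

Section multi.
Variable d : nat.
Local Notation E := 'rV[R]_d.

Definition sig n (b : {ffun 'I_d -> 'I_(M n)}) : {ffun 'I_d -> 'I_(M n)} :=
  [ffun i => Ordinal (shuf_lt (ltn_ord (b i)))].

Lemma sig_bij n : bijective (@sig n).
Proof.
apply: injF_bij => b b' /ffunP e; apply/ffunP => i; have := e i; rewrite !ffunE => -[].
by move=> /(shuf_inj (ltn_ord _) (ltn_ord _)) /val_inj.
Qed.

Lemma floor_H_shuffle n (b : {ffun 'I_d -> 'I_(M n)}) (y : E) : cell b y ->
  floor_rV ((M n)%:R *: H_shuffle M m n y) = gridpt R (sig b).
Proof.
move=> hb; apply/rowP => i; rewrite !mxE (floor_H_star (hb i)) ffunE.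
by rewrite -pmulrn.
Qed.

Definition coarse n (b : {ffun 'I_d -> 'I_(M n.+1)}) : {ffun 'I_d -> 'I_(M n)} :=
  [ffun i => Ordinal (divn_lt_M (ltn_ord (b i)))].

Lemma cell_coarse n (b : {ffun 'I_d -> 'I_(M n.+1)}) (y : E) : cell b y -> cell (coarse b) y.
Proof. by move=> hb i; rewrite ffunE; exact: in_cell_divn (hb i). Qed.

Lemma cell_uniq N (b b' : {ffun 'I_d -> 'I_N}) (y : E) : (0 < N)%N -> cell b y -> cell b' y -> b = b'.
Proof.
by move=> N0 hb hb'; apply/ffunP => i; apply/val_inj; exact: (in_cell_uniq N0 (hb i) (hb' i)).
Qed.

Lemma refine_lt n (j : 'I_(M n)) (r : 'I_(m n.+1)) : (j * m n.+1 + r < M n.+1)%N.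
Proof.
rewrite MS; apply: (@leq_trans (j * m n.+1 + m n.+1)); first by rewrite ltn_add2l.
by rewrite -mulSnr leq_mul2r ltn_ord orbT.
Qed.

Definition refine n (jr : {ffun 'I_d -> 'I_(M n)} * {ffun 'I_d -> 'I_(m n.+1)}) :
    {ffun 'I_d -> 'I_(M n.+1)} :=
  [ffun i => Ordinal (refine_lt (jr.1 i) (jr.2 i))].

Lemma coarse_refine n jr : coarse (@refine n jr) = jr.1.
Proof.
apply/ffunP => i; rewrite !ffunE; apply/val_inj => /=.
by rewrite ?ffunE/= divnMDl// divn_small ?ltn_ord// addn0.
Qed.

Lemma refine_bij n : bijective (@refine n).
Proof.
pose f (b : {ffun 'I_d -> 'I_(M n.+1)}) : {ffun 'I_d -> 'I_(M n)} * {ffun 'I_d -> 'I_(m n.+1)} :=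
  (coarse b, [ffun i => Ordinal (ltn_pmod (b i) (m_gt0 n))]).
exists f.
  move=> jr; rewrite /f coarse_refine [RHS]surjective_pairing; congr pair.
  apply/ffunP => i; rewrite !ffunE; apply/val_inj => /=.
  by rewrite ?ffunE/= modnMDl modn_small.
move=> b; apply/ffunP => i; rewrite ffunE; apply/val_inj => /=.
by rewrite !ffunE /= -divn_eq.
Qed.

(** The property for which the shuffle is designed: the position [r] of a subcell in its coarse cell
    becomes a translation by [M n r], that is by [p n r] after multiplication by [p 0]. *)
Lemma gridpt_sig_refine n jr : gridpt R (sig (@refine n jr)) =
  gridpt R (sig jr.1) + (M n)%:R *: gridpt R jr.2.
Proof.
apply/rowP => i; rewrite !mxE !ffunE /= ?ffunE /=.
rewrite modnMDl modn_small// divnMDl// divn_small// addn0.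
by rewrite natrD natrM addrC.
Qed.

End multi.
End shuffle_index.

(** * The shuffled sequence *)

Section shuffled_sequence.
Context (R : realType) (d : nat).
Local Notation E := 'rV[R]_d.
Local Notation leb := (lebesgue_rV R d).
Local Notation leb2 := (leb \x leb)%E.
Local Notation mu := (leb \x leb \x leb)%E.
Variables (Omega : set E) (p : nat -> R) (M m : nat -> nat) (ut : nat -> E * E -> R) (C : R).
Hypothesis p_gt0 : forall n, 0 < p n.
Hypotheses (M0 : M 0%N = 1%N) (MS : forall n, M n.+1 = (M n * m n.+1)%N).
Hypothesis m_gt0 : forall n, (0 < m n.+1)%N.
Hypothesis pM : forall n, p n = (M n)%:R * p 0%N.
Local Notation q := (p 0%N).
Hypothesis sut : forall n, sqint leb2 (ut n).
Hypothesis ut0 : forall n z, ~ Omega z.1 -> ut n z = 0.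
Hypothesis utC : forall n, \int[leb2]_z (ut n z ^+ 2) <= p n ^+ d * C.
Hypothesis ut_avg : forall n, {ae leb2, forall z, (Omega `*` hcube (p n)) z ->
  ut n z = ((m n.+1)%:R ^+ d)^-1 * \sum_(b : {ffun 'I_d -> 'I_(m n.+1)})
     ut n.+1 (z.1, z.2 + p n *: gridpt R b)}.

Let Mp n : (0 < M n)%N := M_gt0 M0 MS m_gt0 n.
Local Notation sg := (sig MS m_gt0).

Lemma hcube_shift N (b : {ffun 'I_d -> 'I_N}) (a : R) (y : E) : 0 < a -> hcube a y ->
  hcube (N%:R * a) (y + a *: gridpt R b).
Proof.
move=> a0 hy i; have /andP[y0 ya] := hy i; rewrite !mxE addr_ge0 ?mulr_ge0// ?(ltW a0)//=.
apply: (@lt_le_trans _ _ (a + a * (b i)%:R)); first by rewrite ltrD2r.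
by rewrite -[X in X + _]mulr1 -mulrDr mulrC ler_pM2r// nat1r ler_nat.
Qed.

(* The condition on [cube 1] makes the faces of the closed cube, which no cell
   meets, one further class. *)
Definition same_cell n (z z' : E * E * E) := [/\ z.1 = z'.1,
  forall b : {ffun 'I_d -> 'I_(M n)}, cell b z.2 <-> cell b z'.2 & cube 1 z.2 <-> cube 1 z'.2].

Lemma same_cellP n w (b : {ffun 'I_d -> 'I_(M n)}) (y y' : E) :
  cell b y -> cell b y' -> same_cell n (w, y) (w, y').
Proof.
move=> hy hy'; split=> //= [b'|].
  split=> h; [have <- := cell_uniq (Mp n) hy h|have <- := cell_uniq (Mp n) hy' h]; done.
by split=> _; apply: hcube_cube; apply: cell_hcube1; first [exact: Mp|eassumption].
Qed.

(** Each fine cell lies in one coarse cell, and outside the half-open cube there are no cells at any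
    level. *)
Lemma same_cell_decr n z z' : same_cell n.+1 z z' -> same_cell n z z'.
Proof.
case: z z' => [w y] [w' y'] [/= <- hc h1]; split=> //= b.
have key (y1 y2 : E) : (forall b : {ffun 'I_d -> 'I_(M n.+1)}, cell b y1 <-> cell b y2) ->
    cell b y1 -> cell b y2.
  move=> h hb; have hy1 : hcube 1 y1 by apply: cell_hcube1 hb; exact: Mp.
  have [b' hb'] := hcube1_cell (Mp n.+1) hy1.
  rewrite (cell_uniq (Mp n) hb (cell_coarse M0 MS m_gt0 hb')).
  by apply: cell_coarse => //; apply/h.
by split; apply: key => b'; rewrite hc.
Qed.

(* A version of the two-scale shuffle that is defined on the whole space and
   vanishes outside the half-open cubes. *)
Definition shuffled n (z : E * E * E) : R := \sum_(b : {ffun 'I_d -> 'I_(M n)})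
  \1_(cell b) z.2 * (\1_(hcube q) z.1.2 * ut n (z.1.1, z.1.2 + q *: gridpt R (sg b))).

Lemma shuffled_cell n (b : {ffun 'I_d -> 'I_(M n)}) (x y y' : E) : cell b y' ->
  shuffled n (x, y, y') = \1_(hcube q) y * ut n (x, y + q *: gridpt R (sg b)).
Proof.
move=> hb; rewrite /shuffled (bigD1 b)//= indicE mem_set// mul1r big1 ?addr0// => b' bb'.
rewrite indicE memNset ?mul0r// => hb'; move/eqP : bb'; apply.
exact: (cell_uniq (Mp n) hb' hb).
Qed.

Lemma shuffled_out n z : ~ hcube 1 z.2 -> shuffled n z = 0.
Proof.
move=> nz; rewrite /shuffled big1// => b _; rewrite indicE memNset ?mul0r// => hb.
by apply: nz; apply: cell_hcube1 hb; exact: Mp.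
Qed.

Lemma shuffled_same_cell n z z' : same_cell n z z' -> shuffled n z = shuffled n z'.
Proof.
move=> [e hc _]; rewrite /shuffled -e; apply: eq_bigr => b _; congr (_ * _).
by rewrite !indicE; congr ((nat_of_bool _)%:R); apply/idP/idP; rewrite !inE => /hc.
Qed.

Lemma measurable_shuffled n : measurable_fun setT (shuffled n).
Proof.
have mut : measurable_fun setT (ut n) by case: (sut n).
have mc (b : {ffun 'I_d -> 'I_(M n)}) : measurable_fun setT (\1_(cell b) : E -> R).
  by apply: measurable_indic; exact: measurable_cell.
have mh : measurable_fun setT (\1_(hcube q) : E -> R).
  by apply: measurable_indic; exact: measurable_hcube.
apply: measurable_sum => b; apply: measurable_funM.
  exact: measurableT_comp (mc b) measurable_snd.
apply: (measurableT_comp (f := fun w : E * E => \1_(hcube q) w.2 * ut n (w.1, w.2 + q *: gridpt R (sg b))))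
  measurable_fst.
apply: measurable_funM.
  exact: measurableT_comp mh measurable_snd.
exact: measurableT_comp mut (measurable_shift2 _).
Qed.

(** Both factors are constant on cells and [shuffled] vanishes off them, so the fibre integral is a
    finite sum over corners, each cell having measure [M n ^ -d]. *)
Lemma shuffled_fiber n (h : E * E * E -> R) w : measurable_fun setT h ->
  (forall z z', same_cell n z z' -> h z = h z') ->
  (\int[leb]_y (h (w, y) * shuffled n (w, y))%:E =
  ((M n)%:R ^- d * \sum_(b : {ffun 'I_d -> 'I_(M n)})
    h (w, corner R b) * (\1_(hcube q) w.2 * ut n (w.1, w.2 + q *: gridpt R (sg b))))%:E)%E.
Proof.
move=> mh hc; pose phi (y : E) := h (w, y) * shuffled n (w, y).
transitivity (\int[leb]_(y in cube 1) (phi y)%:E)%E.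
  rewrite [RHS]integral_mkcond; apply: eq_integral => y _; rewrite epatch_indic /= indicE.
  have [cy|cy] := pselect (cube 1 y); first by rewrite mem_set// mule1.
  rewrite memNset// mule0 shuffled_out ?mulr0// => hy; apply: cy; exact: hcube_cube.
have mphi : measurable_fun setT phi.
  apply: measurable_funM.
    by apply: (measurableT_comp mh); exact: measurable_pair1.
  by apply: (measurableT_comp (measurable_shuffled n)); exact: measurable_pair1.
rewrite (integral_cells (Mp n) mphi) => [|b y hy].
  congr (_ * _)%:E; apply: eq_bigr => b _; rewrite /phi; case: w phi mphi => x y _ _.
  by rewrite (shuffled_cell _ _ (corner_cell R b (Mp n))).
have s := same_cellP w hy (corner_cell R b (Mp n)).
by rewrite /phi (hc _ _ s) (shuffled_same_cell s).
Qed.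

(** The fibre integrals collect the translates of [ut n ^ 2] on the small cube, which reassemble
    into an integral over the cube of side [p n]. The weight [M n ^ -d] cancels against
    [p n ^ d = M n ^ d q ^ d]. *)
Lemma shuffled_sqint n : sqint mu (shuffled n) /\
  \int[mu]_z (shuffled n z ^+ 2) <= q ^+ d * C.
Proof.
have ms := measurable_shuffled n.
have E1 : (\int[mu]_z (shuffled n z ^+ 2)%:E =
    ((M n)%:R ^- d)%:E * \int[leb2]_(z in setT `*` hcube (p n)) (ut n z ^+ 2)%:E)%E.
  have mut2 : measurable_fun setT (fun z => (ut n z ^+ 2)%:E).
    by apply/measurable_EFinP; apply: measurable_funX; case: (sut n).
  have ms2 : measurable_fun setT (fun z => (shuffled n z ^+ 2)%:E).
    by apply/measurable_EFinP; exact: measurable_funX.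
  transitivity (\int[leb2]_w \int[leb]_y (shuffled n (w, y) ^+ 2)%:E)%E.
    by apply: (ge0_integral_rV3 ms2) => z; rewrite lee_fin sqr_ge0.
  rewrite pM ge0_integral_grid//; last by move=> z; rewrite lee_fin sqr_ge0.
  have mb (b : {ffun 'I_d -> 'I_(M n)}) : measurable_fun setT
      (fun z : E * E => (ut n (z.1, z.2 + q *: gridpt R b) ^+ 2)%:E).
    exact: measurableT_comp mut2 (measurable_shift2 _).
  have mS : measurable ([set: E] `*` hcube q : set (E * E)) by exact: measurableX measurableT (measurable_hcube _).
  rewrite -ge0_integral_sum//; last 2 first.
  - by move=> b; exact: measurable_funTS.
  - by move=> b z _; rewrite lee_fin sqr_ge0.
  have mSum : measurable_fun ([set: E] `*` hcube q)
      (fun z : E * E => \sum_(b : {ffun 'I_d -> 'I_(M n)}) (ut n (z.1, z.2 + q *: gridpt R b) ^+ 2)%:E)%E.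
    by apply: emeasurable_sum => b; exact: measurable_funTS.
  rewrite -ge0_integralZl_EFin ?invr_ge0 ?exprn_ge0//; last first.
    by move=> z _; apply: sume_ge0 => b _; rewrite lee_fin sqr_ge0.
  rewrite [RHS]integral_mkcond; apply: eq_integral => w _.
  (* [shuffled n] itself plays the part of the invariant function [h]. *)
  under eq_integral do rewrite expr2.
  rewrite shuffled_fiber//; last exact: shuffled_same_cell.
  rewrite epatch_indic /= sumEFin -!EFinM; congr EFin; rewrite -mulrA; congr (_ * _).
  (* The shuffle only permutes the cells, so it disappears from a sum over all of them. *)
  rewrite [in RHS](reindex (@sig M m MS m_gt0 d n)); last exact/onW_bij/sig_bij.
  rewrite mulr_suml; apply: eq_bigr => b _.
  case: w => x y; rewrite (shuffled_cell _ _ (corner_cell R b (Mp n))) /=.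
  rewrite !indicE in_setX in_setT /=; case: (_ \in _); rewrite /=; ring.
have Mn0 : 0 < (M n)%:R ^- d :> R by rewrite invr_gt0 exprn_gt0// ltr0n.
have le : (\int[mu]_z (shuffled n z ^+ 2)%:E <= (q ^+ d * C)%:E)%E.
  rewrite E1; apply: (@le_trans _ _ (((M n)%:R ^- d)%:E * \int[leb2]_z (ut n z ^+ 2)%:E)%E).
    apply: lee_wpmul2l; first by rewrite lee_fin ltW.
    apply: ge0_subset_integral => //.
    - exact: measurableX measurableT (measurable_hcube _).
    - by apply/measurable_EFinP; apply: measurable_funX; case: (sut n).
    - by move=> z _; rewrite lee_fin sqr_ge0.
  rewrite -EFin_Rintegral; last exact: sqint_integrable.
  rewrite -EFinM lee_fin; apply: le_trans (ler_wpM2l (ltW Mn0) (utC n)) _.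
  by rewrite pM exprMn !mulrA mulVf ?mul1r// gt_eqF// exprn_gt0// ltr0n.
have sq : sqint mu (shuffled n) by split=> //; exact: le_lt_trans le (ltry _).
by split=> //; rewrite -lee_fin EFin_Rintegral//; exact: sqint_integrable.
Qed.

(** For almost every [(x, y)] the two fibre sums agree once the fine cells are grouped by coarse
    cell: the inner sum over subcells is then the one in the averaging identity. *)
Lemma shuffled_step n (h : E * E * E -> R) : sqint mu h ->
  (forall z z', same_cell n z z' -> h z = h z') ->
  \int[mu]_z (h z * shuffled n.+1 z) = \int[mu]_z (h z * shuffled n z).
Proof.
move=> sh hc; have mh : measurable_fun setT h by case: sh.
have hc1 z z' : same_cell n.+1 z z' -> h z = h z' by move=> /same_cell_decr; exact: hc.
congr fine; apply: eq_integral_rV3.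
- by apply: (sqintM sh); case: (shuffled_sqint n.+1).
- by apply: (sqintM sh); case: (shuffled_sqint n).
(* The averaging identity is needed at finitely many translates of [(x, y)], and translations
   preserve null sets. *)
have avg_all : {ae leb2, forall w, forall j : {ffun 'I_d -> 'I_(M n)},
    (Omega `*` hcube (p n)) (w.1, w.2 + q *: gridpt R (sg j)) ->
    ut n (w.1, w.2 + q *: gridpt R (sg j)) = ((m n.+1)%:R ^+ d)^-1 *
      \sum_(b : {ffun 'I_d -> 'I_(m n.+1)})
        ut n.+1 (w.1, w.2 + q *: gridpt R (sg j) + p n *: gridpt R b)}.
  by apply: filter_forall => j; exact: (ae_shift2 (q *: gridpt R (sg j)) (ut_avg n)).
apply: filterS avg_all => w avg_w.
rewrite (shuffled_fiber w mh hc) (shuffled_fiber w mh hc1); congr EFin.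
rewrite (reindex (@refine M m MS d n)) /=; last exact/onW_bij/refine_bij.
rewrite -(pair_big xpredT xpredT (fun (j : {ffun 'I_d -> 'I_(M n)}) (r : {ffun 'I_d -> 'I_(m n.+1)}) =>
   h (w, corner R (refine MS (j, r))) * (\1_(hcube q) w.2 *
     ut n.+1 (w.1, w.2 + q *: gridpt R (sg (refine MS (j, r)))))))/=.
rewrite !mulr_sumr; apply: eq_bigr => j _.
(* [h] is invariant at level [n], so it cannot distinguish the subcells of [j]. *)
have hj (r : {ffun 'I_d -> 'I_(m n.+1)}) :
    h (w, corner R (refine MS (j, r))) = h (w, corner R j).
  apply: hc; apply: (@same_cellP _ w j); last exact: corner_cell.
  rewrite -[X in cell X _](coarse_refine MS m_gt0 (j, r)); apply: (cell_coarse M0).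
  exact: corner_cell.
under eq_bigr => r _ do rewrite hj gridpt_sig_refine.
rewrite -mulr_sumr -mulr_sumr.
have [hw|hw] := pselect (hcube q w.2); last by rewrite indicE memNset// !mul0r !mulr0.
have -> : ut n (w.1, w.2 + q *: gridpt R (sg j)) = ((m n.+1)%:R ^+ d)^-1 *
      \sum_(b : {ffun 'I_d -> 'I_(m n.+1)})
        ut n.+1 (w.1, w.2 + q *: gridpt R (sg j) + p n *: gridpt R b).
  (* The averaging identity is available only over [Omega]; elsewhere both sides are 0. *)
  have [Ow|Ow] := pselect (Omega w.1).
    by apply: avg_w; split=> //=; rewrite pM; exact: hcube_shift.
  by rewrite ut0// big1 ?mulr0// => b _; rewrite ut0.
rewrite MS natrM exprMn invfM.
under eq_bigr => r _ do rewrite scalerDr scalerA (mulrC q) -pM addrA.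
by ring.
Qed.

End shuffled_sequence.

(** * Measurability of the shuffle and reduction modulo a period *)

Section measurable_shuffle.
Context (R : realType).

Lemma measurable_fun_floor (g : int -> R) : measurable_fun setT (fun t : R => g (Num.floor t)).
Proof.
move=> _ Y _; rewrite setTI.
rewrite [X in measurable X](_ : _ = \bigcup_(k : int)
    (if g k \in Y then `[k%:~R, (k + 1)%:~R[%classic else set0)); last first.
  apply/seteqP; split=> [t /= Yt|t [k _]].
    by exists (Num.floor t) => //; rewrite mem_set//= in_itv/= floor_itv.
  case: ifPn => // /set_mem Yk; rewrite /= in_itv/= => /floor_def tk.
  by rewrite /preimage/= tk.
apply: countable_bigcupT_measurable => // k.
by case: ifP => _ //; exact: measurable_itv.
Qed.

Lemma measurable_h_shuffle N k : measurable_fun setT (h_shuffle N k : R -> R).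
Proof.
(* [truncn] is the floor cut off at 0, hence a function of the floor, to which
   [measurable_fun_floor] applies. *)
pose tr (j : int) : nat := if j is Posz n then n else 0%N.
pose i (t : R) := tr (Num.floor t).
have -> : h_shuffle N k = fun t : R => (R_shuffle N k (i ((N * k)%:R * t)))%:R / (N * k)%:R +
    (t - (i ((N * k)%:R * t))%:R / (N * k)%:R) :> R.
  by apply/funext => t; rewrite /h_shuffle truncEfloor.
have mi (g : nat -> R) : measurable_fun setT (fun t : R => g (i ((N * k)%:R * t))).
  apply: (measurableT_comp (f := fun t : R => g (i t))).
    exact: (measurable_fun_floor (fun j => g (tr j))).
  exact: mulrl_measurable.
apply: measurable_funD; first exact: (mi (fun j => (R_shuffle N k j)%:R / (N * k)%:R)).
by apply: measurable_funB => //; exact: (mi (fun j => j%:R / (N * k)%:R)).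
Qed.

Lemma measurable_H_star M m n : measurable_fun setT (H_star M m n : R -> R).
Proof.
elim: n => [|n ih]; first exact: measurable_id.
exact: measurableT_comp (measurable_h_shuffle _ _) ih.
Qed.

Section rV.
Variable d : nat.
Local Notation E := 'rV[R]_d.

Lemma measurable_floor_rV : measurable_fun setT (@floor_rV R d).
Proof.
apply: measurable_fun_rV => i; under eq_fun do rewrite mxE.
exact: measurableT_comp (measurable_fun_floor (fun j => j%:~R)) (@measurable_coord R d i).
Qed.

Lemma measurable_H_shuffle M m n : measurable_fun setT (@H_shuffle R d M m n).
Proof.
apply: measurable_fun_rV => i; under eq_fun do rewrite mxE.
exact: measurableT_comp (@measurable_H_star M m n) (@measurable_coord R d i).
Qed.

Lemma measurable_fun_lincomb dT (T : measurableType dT) (a : R) (f g : T -> E) :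
  measurable_fun setT f -> measurable_fun setT g -> measurable_fun setT (fun t => a *: f t + g t).
Proof.
move=> mf mg; apply: measurable_fun_rV => i; under eq_fun do rewrite !mxE.
have mc (h : T -> E) : measurable_fun setT h -> measurable_fun setT (fun t => h t 0 i).
  by move=> mh; exact: measurableT_comp (@measurable_coord R d i) mh.
by apply: measurable_funD; [apply: measurable_funM => //|]; exact: mc.
Qed.

Lemma hcube_mod (a : R) (v : E) : 0 < a -> hcube a (v - a *: floor_rV (a^-1 *: v)).
Proof.
move=> a0 i; rewrite !mxE; have /andP[f1 f2] := floor_itv (a^-1 * v 0 i).
rewrite intrD in f2; have a1 : a != 0 by rewrite gt_eqF.
have -> : v 0 i - a * (Num.floor (a^-1 * v 0 i))%:~R =
    a * (a^-1 * v 0 i - (Num.floor (a^-1 * v 0 i))%:~R) by rewrite mulrBr mulVKf.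
apply/andP; split; first by rewrite mulr_ge0 ?(ltW a0)// subr_ge0.
by rewrite -[X in _ < X]mulr1 ltr_pM2l// ltrBlDl.
Qed.

Lemma hcube_modK (a : R) (v : E) : 0 < a -> hcube a v -> v - a *: floor_rV (a^-1 *: v) = v.
Proof.
move=> a0 hv; suff -> : floor_rV (a^-1 *: v) = 0 by rewrite scaler0 subr0.
apply/rowP => i; rewrite !mxE; have /andP[v0 va] := hv i.
by rewrite (@floor_def _ _ 0)// mulr_ge0 ?invr_ge0 ?(ltW a0)//= mulrC ltr_pdivrMr// mul1r.
Qed.

End rV.
End measurable_shuffle.

Section two_scale_shuffle.
Context (R : realType) (d : nat).
Local Notation E := 'rV[R]_d.
Variables (Omega : set E) (p : nat -> R) (M m : nat -> nat) (u0 : nat -> E * E -> R).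
Hypothesis p_gt0 : forall n, 0 < p n.
Hypotheses (M0 : M 0%N = 1%N) (MS : forall n, M n.+1 = (M n * m n.+1)%N).
Hypothesis m_gt0 : forall n, (0 < m n.+1)%N.
Hypothesis pM : forall n, p n = (M n)%:R * p 0%N.
Local Notation q := (p 0%N).
Local Notation w := (two_scale_shuffle p M m u0).
Local Notation D := (Omega `*` cube q `*` cube 1).
Local Notation ut := (fun n => u0 n \_ (Omega `*` cube (p n))).

(** Off the upper faces the shifted point already lies in [hcube (p n)], where the periodic
    extension changes nothing. *)
Lemma two_scale_shuffleE n (x y y' : E) : Omega x -> hcube q y -> hcube 1 y' ->
  w n (x, y, y') = shuffled p ut MS m_gt0 n (x, y, y').
Proof.
move=> Ox hy hy'; have Mn := M_gt0 M0 MS m_gt0 n.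
have [b hb] := hcube1_cell Mn hy'.
rewrite (shuffled_cell _ _ M0 _ _ _ _ hb) indicE mem_set// mul1r.
rewrite /two_scale_shuffle /periodic_ext (floor_H_shuffle M0 MS m_gt0 hb) (addrC (q *: _)).
have hv : hcube (p n) (y + q *: gridpt R (sig MS m_gt0 b)) by rewrite pM; exact: hcube_shift.
by rewrite hcube_modK// patchE mem_set//; split=> //; exact: hcube_cube.
Qed.

(** [u0 n] is known to be measurable only after extension by 0. Reduction modulo [p n] always lands
    in the period cube, so on all of [D], faces included, [u0 n] may be replaced by that
    extension. *)
Lemma measurable_two_scale_shuffle n : measurable Omega -> measurable_fun setT (ut n) ->
  measurable_fun setT (w n \_ D).
Proof.
move=> mO mut.
pose v (z : E * E * E) : E := q *: floor_rV ((M n)%:R *: H_shuffle M m n z.2) + z.1.2.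
pose k (y : E) : E := y - p n *: floor_rV ((p n)^-1 *: y).
have wE : w n \_ D = fun z => \1_D z * ut n (z.1.1, k (v z)).
  apply/funext => z; rewrite patch_indic /= indicE.
  have [Dz|Dz] := pselect (D z); last by rewrite memNset// mul0r mulr0.
  rewrite mem_set// mulr1 mul1r patchE mem_set; first by case: z Dz => [[x y] y'].
  by split=> /=; [case: Dz => -[]|exact/hcube_cube/hcube_mod].
rewrite wE; apply: measurable_funM.
  apply: measurable_indic; apply: measurableX; last exact: measurable_cube.
  by apply: measurableX => //; exact: measurable_cube.
apply: (measurableT_comp mut); apply/measurable_fun_pairP; split.
  exact: measurableT_comp measurable_fst measurable_fst.
have ms (a : R) : measurable_fun setT (fun y : E => a *: y).
  under eq_fun do rewrite -[_ *: _]addr0.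
  by apply: measurable_fun_lincomb.
have mv : measurable_fun setT v.
  apply: measurable_fun_lincomb; last exact: measurableT_comp measurable_snd measurable_fst.
  apply: (measurableT_comp (@measurable_floor_rV R d)); apply: (measurableT_comp (ms _)).
  exact: (measurableT_comp (@measurable_H_shuffle R d M m n) measurable_snd).
rewrite /k; under eq_fun do rewrite addrC -scaleNr.
apply: measurable_fun_lincomb => //.
by apply: (measurableT_comp (@measurable_floor_rV R d)); exact: measurableT_comp (ms _) mv.
Qed.

End two_scale_shuffle.

(** * The shuffle filtration *)

Section sigma_algebra_on.
Context (T : Type) (D : set T) (G : set (set T)).
Hypothesis sG : sigma_algebra D G.

Lemma sigma_algebra_bigcup_count (I : countType) (X : I -> set T) :
  (forall i, G (X i)) -> G (\bigcup_i X i).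
Proof.
case: sG => G0 _ GU GX.
rewrite [X in G X](_ : _ = \bigcup_k (if unpickle k is Some i then X i else set0)).
  by apply: GU => k; case: unpickle.
apply/seteqP; split=> [t [i _ Xt]|t [k _]]; first by exists (pickle i); rewrite ?pickleK.
by case: unpickle => // i Xt; exists i.
Qed.

Lemma sigma_algebra_setD A B : A `<=` D -> G A -> G B -> G (A `\` B).
Proof.
case: sG => G0 GC GU AD GA GB.
rewrite [X in G X](_ : _ = D `\` \bigcup_(b : bool) (if b then D `\` A else B)).
  by apply: (GC); apply: sigma_algebra_bigcup_count => -[] //; exact: GC.
apply/seteqP; split=> [t [At Bt]|t [Dt nt]].
  by split=> [|[[] _ //= []//]]; exact: AD.
split; last by move=> Bt; apply: nt; exists false.
by apply: contrapT => At; apply: nt; exists true.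
Qed.

End sigma_algebra_on.

Section shuffle_field.
Context (R : realType) (d : nat).
Local Notation E := 'rV[R]_d.
Variables (Omega : set E) (q : R) (M : nat -> nat) (n : nat).
Hypotheses (mO : measurable Omega) (Mn : (0 < M n)%N).
Local Notation W := (Omega `*` cube q).
Local Notation D := (Omega `*` cube q `*` (cube 1 : set E)).
Local Notation F := (shuffle_field Omega q (M n)).
Local Notation F3 := (<<s cube 1, range (@cell R d (M n)) >>).

Lemma measurable_shuffle_domain : measurable (D : set (E * E * E)).
Proof.
apply: measurableX; last exact: measurable_cube.
by apply: measurableX => //; exact: measurable_cube.
Qed.

Lemma same_cell_sym (z z' : E * E * E) : same_cell M n z z' -> same_cell M n z' z.
Proof. by move=> [e hc h1]; split=> [|b|]; [exact: esym|split=> /hc|split=> /h1]. Qed.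

Let F3P A : F3 A -> [/\ measurable A, A `<=` cube 1 &
  forall (w : E * E) y y', same_cell M n (w, y) (w, y') -> A y -> A y'].
Proof.
move: A; apply: smallest_sub; last first.
  move=> _ [b _ <-]; split; first exact: measurable_cell.
    by move=> y hb; apply: hcube_cube; exact: cell_hcube1 hb.
  by move=> w y y' [_ hc _] /hc.
split=> [|A [mA A1 cA]|A hA].
- by split.
- split; first by apply: measurableD => //; exact: measurable_cube.
    by move=> y [].
  move=> w y y' s [y1 Ay]; have [_ _ h1] := s; split; first exact/h1.
  by move=> Ay'; apply/Ay/(cA w _ _ _ Ay')/same_cell_sym.
- split; first by apply: bigcupT_measurable => k; case: (hA k).
    by move=> y [k _ Ay]; case: (hA k) => _ s _; exact: s.
  by move=> w y y' s [k _ Ay]; exists k => //; case: (hA k) => _ _ h; exact: h s Ay.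
Qed.

Let sF : sigma_algebra D F. Proof. exact: smallest_sigma_algebra. Qed.
Let sF3 : sigma_algebra (cube 1) F3. Proof. exact: smallest_sigma_algebra. Qed.

(** The sets [S] with this property form a sigma-field containing the rectangles, which generate the
    Borel sets of the first two factors. *)
Let F_rect S A : measurable S -> F3 A -> F ((S `&` W) `*` A).
Proof.
move=> mS hA; have [mA A1 _] := F3P hA.
suff : <<s [set A `*` B | A in measurable & B in measurable] >> `<=`
    [set S : set (E * E) | F ((S `&` W) `*` A)].
  by apply; rewrite -measurable_prod_measurableType.
apply: smallest_sub; last first.
  move=> _ [A1' mA1 [A2' mA2 <-]]; apply: sub_sigma_algebra.
  exists (A1' `&` Omega), (A2' `&` cube q), A; split=> //.
  - by split; [exact: measurableI|move=> x []].
  - by split; [apply: measurableI => //; exact: measurable_cube|move=> x []].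
  by rewrite setXI.
have FW : F (W `*` A).
  apply: sub_sigma_algebra; exists Omega, (cube q), A; split=> //; split=> //.
  exact: measurable_cube.
split=> [|S' hS|S' hS] /=.
- by rewrite set0I set0X; case: sF.
- rewrite [X in F X](_ : _ = (W `*` A) `\` ((S' `&` W) `*` A)).
    by apply: (sigma_algebra_setD sF) => // -[w y] [Ww Ay]; split=> //; exact: A1.
  apply/seteqP; split=> [[w y] [[[_ nS] Ww] Ay]|[w y] [[Ww Ay] nS]].
    by split=> // -[[]].
  by split=> //; split=> //; split=> // Sw; apply: nS.
- rewrite setI_bigcupl (_ : _ `*` _ = \bigcup_k ((S' k `&` W) `*` A)).
    by case: sF => _ _; apply.
  apply/seteqP; split=> [[w y] [[k _ h] Ay]|[w y] [k _ [h Ay]]]; first by exists k.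
  by split=> //; exists k.
Qed.

(** For the converse, an invariant Borel set is a finite union of products: over each atom of the
    third sigma-field its section in [(x, y)] does not vary, and is read off at one representative
    point. *)
Lemma shuffle_fieldP B : F B <->
  [/\ measurable B, B `<=` D & forall z z', same_cell M n z z' -> B z -> B z'].
Proof.
split.
  move: B; apply: smallest_sub; last first.
    move=> _ [A1 [A2 [A3 [[mA1 A1O] [mA2 A2q] /F3P[mA3 A31 cA3] ->]]]]; split.
    - by apply: measurableX => //; exact: measurableX.
    - by move=> [[x y] y'] [[/= /A1O ? /A2q ?] /A31 ?].
    move=> [w y] [w' y'] s [/= Aw Ay]; have [/= e _ _] := s; subst w'; split=> //=.
    exact: cA3 s Ay.
  have cD z z' : same_cell M n z z' -> D z -> D z'.
    by move=> [e _ h1] [Wz z1]; split; [rewrite -e|exact/h1].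
  split=> [|A [mA AD cA]|A hA].
  - by split.
  - split; first by apply: measurableD => //; exact: measurable_shuffle_domain.
      by move=> z [].
    move=> z z' s [Dz Az]; split; first exact: cD s Dz.
    by move=> Az'; apply/Az/(cA _ _ _ Az')/same_cell_sym.
  - split; first by apply: bigcupT_measurable => k; case: (hA k).
      by move=> z [k _ Az]; case: (hA k) => _ s _; exact: s.
    by move=> z z' s [k _ Az]; exists k => //; case: (hA k) => _ _ h; exact: h s Az.
move=> [mB BD cB].
have F3cell (b : {ffun 'I_d -> 'I_(M n)}) : F3 (cell b) by apply: sub_sigma_algebra; exists b.
have F3faces : F3 (cube 1 `\` \bigcup_(b : {ffun 'I_d -> 'I_(M n)}) cell b).
  by case: (sF3) => _ h _; apply: h; exact: sigma_algebra_bigcup_count.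
(* [None] stands for the atom formed by the faces, represented by the vertex [(1, ..., 1)]. *)
pose rep (o : option {ffun 'I_d -> 'I_(M n)}) : E := if o is Some b then corner R b else const_mx 1.
pose atom (o : option {ffun 'I_d -> 'I_(M n)}) : set E :=
  if o is Some b then cell b else cube 1 `\` \bigcup_(b : {ffun 'I_d -> 'I_(M n)}) cell b.
pose sec o : set (E * E) := [set w | B (w, rep o)].
have same o w y : atom o y -> same_cell M n (w, rep o) (w, y).
  case: o => [b|] /= hy.
    have hb := corner_cell R b Mn; split=> //= [b'|].
      by split=> h; [have <- := cell_uniq Mn hb h|have <- := cell_uniq Mn hy h].
    by split=> _; apply: hcube_cube; apply: cell_hcube1; first [exact: Mn|eassumption].
  case: hy => y1 ny; have n1 : ~ hcube 1 (const_mx 1 : E).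
    move=> h; have [b hb] : exists b : {ffun 'I_d -> 'I_(M n)}, cell b y.
      by apply: (hcube1_cell Mn) => i; have := h i; rewrite mxE ltxx andbF.
    by apply: ny; exists b.
  split=> //= [b|].
    by split=> hb; [case: n1; exact: cell_hcube1 hb|case: ny; exists b].
  by split=> // _ i; rewrite mxE ler01 lexx.
rewrite (_ : B = \bigcup_o ((sec o `&` W) `*` atom o)).
  apply: (sigma_algebra_bigcup_count sF) => o; apply: F_rect; last by case: o.
  rewrite -[X in measurable X]setTI.
  by apply: (@measurable_pair2 _ _ _ _ (rep o)).
apply/seteqP; split=> [[w y] Bz|[w y] [a _ [[/= Bz _] hy]]]; last first.
  exact: cB (same a w y hy) Bz.
have [Ww y1] := BD _ Bz.
have [a hy] : exists a, atom a y.
  have [[b _ hb]|ny] := pselect ((\bigcup_(b : {ffun 'I_d -> 'I_(M n)}) cell b) y).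
    by exists (Some b).
  by exists None.
exists a => //; split=> //; split=> //.
exact: cB (same_cell_sym (same a w y hy)) Bz.
Qed.

Lemma measurable_for_shuffle_field (g : E * E * E -> R) : measurable_fun setT g ->
  (forall z z', same_cell M n z z' -> g z = g z') -> measurable_for D F g.
Proof.
move=> mg cg Y mY; apply/shuffle_fieldP; split.
- apply: measurableI; first exact: measurable_shuffle_domain.
  by rewrite -[X in measurable X]setTI; exact: mg.
- by move=> z [].
move=> z z' s [Dz Yz]; split; last by rewrite /= -(cg _ _ s).
by case: s Dz => e _ h1 [Wz z1]; split; [rewrite -e|exact/h1].
Qed.

End shuffle_field.

(** * From measurable versions to classes on a domain of finite measure *)

Section restricted.
Context dT (T : measurableType dT) (R : realType).
Variables (mu : {measure set T -> \bar R}) (D : set T).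
Hypotheses (mD : measurable D) (Doo : (mu D < +oo)%E).

Lemma ae_sqint (f h : T -> R) : measurable_fun setT f -> sqint mu h ->
  {ae mu, forall z, f z = h z} ->
  sqint mu f /\ \int[mu]_z (f z ^+ 2) = \int[mu]_z (h z ^+ 2).
Proof.
move=> mf [mh hoo] fh.
have e : (\int[mu]_z (f z ^+ 2)%:E = \int[mu]_z (h z ^+ 2)%:E)%E.
  apply: ae_eq_integral => //.
  - by apply/measurable_EFinP; exact: measurable_funX.
  - by apply/measurable_EFinP; exact: measurable_funX.
  - by apply: filterS fh => z /= -> _.
by split; [split=> //; rewrite e|rewrite /Rintegral e].
Qed.

Lemma sqint_patch (f : T -> R) : sqint mu f -> sqint mu (f \_ D).
Proof.
move=> sf; rewrite (_ : f \_ D = fun z => \1_D z * f z); first exact: sqint_indicM.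
by apply/funext => z; rewrite patch_indic /= mulrC.
Qed.

Lemma L2_integrable (f : T -> R) : L2 mu D f -> mu.-integrable D (EFin \o f).
Proof.
move=> /Lfun2P sf; apply/integrable_mkcond => //.
have -> : (EFin \o f) \_ D = EFin \o (fun z => \1_D z * (f \_ D) z).
  apply/funext => z; rewrite restrict_EFin /=; congr EFin; rewrite patch_indic /= indicE.
  by case: (z \in D); rewrite ?(mulr1, mul1r, mulr0, mul0r).
by apply: sqintM => //; exact: sqint_indic.
Qed.

Lemma Rintegral_patch (B : set T) (f : T -> R) : B `<=` D ->
  \int[mu]_(z in B) f z = \int[mu]_z (\1_B z * (f \_ D) z).
Proof.
move=> BD; rewrite Rintegral_mkcond; apply: eq_Rintegral => z _.
rewrite !patch_indic /= !indicE.
have [Bz|Bz] := pselect (B z); last by rewrite memNset// mulr0 mul0r.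
by rewrite !mem_set ?mulr1 ?mul1r//; exact: BD.
Qed.

Lemma Rintegral_patch_ae (B : set T) (f h : T -> R) : measurable B -> B `<=` D ->
  measurable_fun setT (f \_ D) -> measurable_fun setT h ->
  {ae mu, forall z, D z -> f z = h z} ->
  \int[mu]_(z in B) f z = \int[mu]_z (\1_B z * h z).
Proof.
move=> mB BD mf mh fh; rewrite Rintegral_patch//; congr fine.
have mI (g : T -> R) : measurable_fun setT g -> measurable_fun setT (fun z => (\1_B z * g z)%:E).
  by move=> mg; apply/measurable_EFinP; apply: measurable_funM => //; exact: measurable_indic.
apply: ae_eq_integral => //; [exact: mI|exact: mI|].
apply: filterS fh => z fhz _; congr EFin; rewrite indicE.
have [Bz|Bz] := pselect (B z); last by rewrite memNset// !mul0r.
have Dz := BD _ Bz; by rewrite patchE (mem_set Dz) (fhz Dz).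
Qed.

End restricted.

Section L2_martingale.
Context dT (T : measurableType dT) (R : realType).
Variables (mu : {measure set T -> \bar R}) (D : set T).
Hypotheses (mD : measurable D) (Doo : (mu D < +oo)%E).
Variables (r : nat -> T -> T -> Prop) (F : nat -> set (set T)) (g w : nat -> T -> R) (C : R).
Hypothesis r_decr : forall n z z', r n.+1 z z' -> r n z z'.
Hypothesis FP : forall n B, F n B <->
  [/\ measurable B, B `<=` D & forall z z', r n z z' -> B z -> B z'].
Hypothesis r_sym : forall n z z', r n z z' -> r n z' z.
Hypothesis sF : forall n, sigma_algebra D (F n).
Hypothesis gF : forall n, measurable_for D (F n) (g n).
Hypothesis g_adapted : forall n, adapted mu r n (g n).
Hypothesis g_step : forall n h, adapted mu r n h ->
  \int[mu]_z (h z * g n.+1 z) = \int[mu]_z (h z * g n z).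
Hypothesis g_bounded : forall n, \int[mu]_z (g n z ^+ 2) <= C.
Hypothesis mw : forall n, measurable_fun setT (w n \_ D).
Hypothesis wg : forall n, {ae mu, forall z, D z -> w n z = g n z}.

Let sg n : sqint mu (g n). Proof. by case: (g_adapted n). Qed.

Let patch_ae (f h : T -> R) : {ae mu, forall z, D z -> f z = h z} ->
  {ae mu, forall z, (f \_ D) z = (h \_ D) z}.
Proof.
apply: filterS => z fh; rewrite !patchE; case: ifPn => // /set_mem; exact: fh.
Qed.

Let w_sqint n : sqint mu (w n \_ D) /\
  \int[mu]_z ((w n \_ D) z ^+ 2) = \int[mu]_z ((g n \_ D) z ^+ 2).
Proof. by apply: ae_sqint; [exact: mw|exact: sqint_patch|exact/patch_ae/wg]. Qed.

Let patch_int_le (f : T -> R) : sqint mu f ->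
  \int[mu]_z ((f \_ D) z ^+ 2) <= \int[mu]_z (f z ^+ 2).
Proof.
move=> sf; apply: le_Rintegral => //; try exact: sqint_integrable.
  by apply: sqint_integrable; exact: sqint_patch.
by move=> z _; rewrite patchE; case: ifP => // _; rewrite expr0n sqr_ge0.
Qed.

Let L2w n : L2 mu D (w n).
Proof. by apply/Lfun2P; case: (w_sqint n). Qed.

Let L2g n : L2 mu D (g n).
Proof. by apply/Lfun2P; exact: sqint_patch. Qed.

Let indic_adapted n B : F n B -> adapted mu r n \1_B.
Proof.
move=> /FP[mB BD cB]; split.
  by apply: sqint_indic => //; apply: le_lt_trans Doo; apply: le_measure; rewrite ?inE.
move=> z z' s; rewrite !indicE; congr ((nat_of_bool _)%:R).
by apply/idP/idP; rewrite !inE; [exact: cB|apply: cB; exact: r_sym].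
Qed.

(** [g] is the measurable version and [w] the given sequence. Indicators of sets of [F n] are
    admissible test functions, so the inner products of the abstract theorem become integrals over
    these sets, insensitive to the null set where [w] and [g] differ. *)
Lemma L2_martingale_summary :
  [/\ filtration D F,
      martingale mu D F w,
      exists C : R, forall n, L2 mu D (w n) /\ (L2norm mu D (w n) <= C%:E)%E &
      exists winf : T -> R,
        [/\ L2 mu D winf,
            (fun n => L2norm mu D (w n \- winf)) @ \oo --> 0%E,
            {ae mu, forall z, D z -> (fun n => w n z) @ \oo --> winf z},
            (forall n A, F n A ->
              \int[mu]_(z in A) w n z = \int[mu]_(z in A) winf z) &
            forall n, is_cond_exp mu D (F n) winf (w n)]].
Proof.
have intw n k B : (n <= k)%N -> F n B -> \int[mu]_(z in B) w k z = \int[mu]_z (\1_B z * g n z).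
  move=> nk FB; have /FP[mB BD _] := FB.
  rewrite (Rintegral_patch_ae (D := D) (h := g k))//; last by case: (sg k).
  exact: (adapted_inner r_decr g_step nk (indic_adapted FB)).
have intg n B : F n B -> \int[mu]_(z in B) g n z = \int[mu]_z (\1_B z * g n z).
  move=> /FP[mB BD _]; apply: (Rintegral_patch_ae (D := D)) => //.
  - by case: (sqint_patch mD (sg n)).
  - by case: (sg n).
  - exact: aeW.
split.
- split=> n; first by split=> // B /FP[].
  by move=> B /FP[mB BD cB]; apply/FP; split=> // z z' /r_decr; exact: cB.
- move=> n j; exists (g n); last exact: wg.
  split; [exact: L2_integrable|exact: L2_integrable|exact: gF|].
  by move=> B FB; rewrite intg// (intw n) ?leq_addr//.
- exists (Num.sqrt C) => n; split=> //; have [sw e] := w_sqint n.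
  rewrite /L2norm (sqint_Lnorm2 sw) lee_fin ler_sqrt; last first.
    by apply: le_trans (g_bounded n); exact: ge0_sqint_integral.
  by rewrite e; apply: le_trans (patch_int_le (sg n)) (g_bounded n).
have [ginf [sinf cvg2 cvg_ae inner]] := L2_martingale_cvg r_decr g_adapted g_step g_bounded.
have L2inf : L2 mu D ginf by apply/Lfun2P; exact: sqint_patch.
have intinf n B : F n B -> \int[mu]_(z in B) ginf z = \int[mu]_z (\1_B z * g n z).
  move=> FB; have /FP[mB BD _] := FB; rewrite -(inner _ _ (indic_adapted FB)).
  apply: (Rintegral_patch_ae (D := D)) => //.
  - by case: (sqint_patch mD sinf).
  - by case: sinf.
  - exact: aeW.
exists ginf; split=> //.
- pose b n := \int[mu]_z ((g n z - ginf z) ^+ 2).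
  (* The norm is squeezed between 0 and the error of [g] on the whole space, which bounds the error
     on [D]. *)
  have nE n : exists2 a, L2norm mu D (w n \- ginf) = a%:E & 0 <= a <= Num.sqrt (b n).
    have sB : sqint mu (fun z => g n z - ginf z) by exact: sqintB.
    have mB : measurable_fun setT ((w n \- ginf) \_ D).
      rewrite (_ : _ \_ D = fun z => (w n \_ D) z - (ginf \_ D) z); last first.
        by apply/funext => z; rewrite !patchE; case: ifP => //= _; rewrite subrr.
      by apply: measurable_funB => //; case: (sqint_patch mD sinf).
    have [|sw e] := @ae_sqint _ _ _ mu ((w n \- ginf) \_ D) _ mB (sqint_patch mD sB).
      by apply: patch_ae; apply: filterS (wg n) => z h Dz /=; rewrite h.
    exists (Num.sqrt (\int[mu]_z (((w n \- ginf) \_ D) z ^+ 2))); first exact: sqint_Lnorm2.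
    rewrite sqrtr_ge0 ler_sqrt ?e//; first exact: patch_int_le.
    exact: ge0_sqint_integral.
  have b0 : Num.sqrt (b n) @[n --> \oo] --> (0 : R).
    by rewrite -[X in _ --> X](sqrtr0 R); apply: continuous_cvg cvg2; exact: sqrt_continuous.
  apply/fine_cvgP; split; first by apply: nearW => n; have [a ->] := nE n.
  apply: (squeeze_cvgr _ (cvg_cst 0) b0); apply: nearW => n /=.
  by have [a -> ] := nE n.
(* The countably many exceptional sets are merged into one before passing to the limit. *)
- have : {ae mu, forall z n, D z -> w n z = g n z} by exact/ae_foralln.
  apply: filterS2 cvg_ae => z gz wgz Dz.
  by rewrite (_ : (fun n => w n z) = g ^~ z)//; apply/funext => n; exact: wgz.
- by move=> n A FA; rewrite (intinf n)// (intw n)//.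
- move=> n; exists (g n); last exact: wg.
  split; [exact: L2_integrable|exact: L2_integrable|exact: gF|].
  by move=> B FB; rewrite intg// (intinf n).
Qed.

End L2_martingale.

(** * The domain of integration and its null faces *)

Section domains.
Context (R : realType) (d : nat).
Local Notation E := 'rV[R]_d.
Local Notation leb := (lebesgue_rV R d).
Local Notation leb2 := (leb \x leb)%E.
Local Notation mu := (leb \x leb \x leb)%E.

Lemma bounded_obox (A : set E) : bounded_set A ->
  exists c : R, A `<=` obox (const_mx (- c)) (const_mx c).
Proof.
(* [bounded_set] gives a bound by every number above [B], here [B + 1]; one more unit makes the
   inequalities strict. *)
move=> [B [_ hB]]; exists (B + 2) => x Ax i; rewrite !mxE.
have : `|x 0 i| <= B + 1.
  apply: le_trans (hB (B + 1) _ x Ax); last by rewrite ltrDl.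
  rewrite [leRHS]mx_normrE.
  exact: (le_bigmax _ (fun ij : 'I_1 * 'I_d => `|x ij.1 ij.2|) (0, i)).
by rewrite ler_norml => /andP[? ?]; apply/andP; split; lra.
Qed.

Lemma lebesgue_rectangle (A1 A2 A3 : set E) :
  measurable A1 -> measurable A2 -> measurable A3 ->
  mu (A1 `*` A2 `*` A3) = (leb A1 * leb A2 * leb A3)%E.
Proof.
move=> m1 m2 m3; have m12 : measurable (A1 `*` A2) by exact: measurableX.
transitivity (leb2 (A1 `*` A2) * leb A3)%E; first exact: product_measure1E.
by congr (_ * _)%E; exact: product_measure1E.
Qed.

Variables (Omega : set E) (q : R).
Hypotheses (mO : measurable Omega) (Ooo : (leb Omega < +oo)%E) (q0 : 0 < q).
Local Notation D := (Omega `*` cube q `*` (cube 1 : set E)).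

Lemma lebesgue_domain_lty : (mu D < +oo)%E.
Proof.
have mc (a : R) : measurable (cube a : set E) by exact: measurable_cube.
rewrite lebesgue_rectangle//.
rewrite (_ : leb (cube q) = (q ^+ d)%:E); last exact: lebesgue_cube (ltW q0).
rewrite (_ : leb (cube 1) = (1 ^+ d)%:E); last exact: lebesgue_cube ler01.
by rewrite lte_mul_pinfty ?mule_ge0 ?lee_fin ?exprn_ge0 ?(ltW q0)//= ?ltry// fin_numM// ge0_fin_numE.
Qed.

Lemma ae_domain_hcube : {ae mu, forall z, D z -> hcube q z.1.2 /\ hcube 1 z.2}.
Proof.
have mf (a : R) : measurable (cube a `\` hcube a : set E).
  by apply: measurableD; [exact: measurable_cube|exact: measurable_hcube].
have ae1 : {ae mu, forall z, D z -> hcube q z.1.2}.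
  exists (Omega `*` (cube q `\` hcube q) `*` (cube 1 : set E)); split.
  - apply: measurableX; last exact: measurable_cube.
    exact: measurableX.
  - rewrite lebesgue_rectangle//; last exact: measurable_cube.
    by rewrite [X in (_ * X * _)%E](lebesgue_faces d (ltW q0)) mule0 mul0e.
  - move=> z /= /not_implyP[[[Oz qz] z1] nz].
    by split.
have ae2 : {ae mu, forall z, D z -> hcube 1 z.2}.
  exists (Omega `*` cube q `*` (cube 1 `\` hcube 1 : set E)); split.
  - apply: measurableX => //.
    by apply: measurableX => //; exact: measurable_cube.
  - rewrite lebesgue_rectangle//; last exact: measurable_cube.
    by rewrite [X in (_ * X)%E](lebesgue_faces d ler01) mule0.
  - move=> z /= /not_implyP[[[Oz qz] z1] nz].
    by split.
by apply: filterS2 ae1 ae2 => z h1 h2 Dz; split; [exact: h1|exact: h2].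
Qed.

End domains.

Theorem theorem3p8 (R : realType) (d : nat) (hd : (0 < d)%N)
    (Omega : set 'rV[R]_d) (Omega_open : open Omega)
    (Omega_bounded : bounded_set Omega) (Omega_connected : connected Omega)
    (u : R -> 'rV[R]_d -> R)
    (u_bounded : exists C : R, forall e : R, 0 < e ->
      L2 (lebesgue_rV R d) Omega (u e) /\
      (L2norm (lebesgue_rV R d) Omega (u e) <= C%:E)%E)
    (p : nat -> R) (p_pos : forall n, 0 < p n) (p_incr : increasing_seq p)
    (p_mult : forall n, exists k : int, p n.+1 = k%:~R * p n)
    (M m : nat -> nat) (M_def : forall n, (M n)%:R = p n / p 0%N)
    (m_def : forall n, (m n.+1)%:R = p n.+1 / p n)
    (eps : nat -> R) (eps_pos : forall k, 0 < eps k)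
    (eps_decr : decreasing_seq eps) (eps_cvg : eps @ \oo --> (0 : R))
    (u0 : nat -> 'rV[R]_d * 'rV[R]_d -> R)
    (u_two_scale : forall n,
      two_scale_cvg Omega (p n) eps (fun k => u (eps k)) (u0 n)) :
  let leb := lebesgue_rV R d in
  let mu := (leb \x leb \x leb)%E in
  let D := Omega `*` cube (p 0%N) `*` cube 1 in
  let F := fun n => shuffle_field Omega (p 0%N) (M n) in
  let w := two_scale_shuffle p M m u0 in
  [/\ filtration D F,
      martingale mu D F w,
      exists C : R, forall n, L2 mu D (w n) /\ (L2norm mu D (w n) <= C%:E)%E &
      exists winf : 'rV[R]_d * 'rV[R]_d * 'rV[R]_d -> R,
        [/\ L2 mu D winf,
            (fun n => L2norm mu D (w n \- winf)) @ \oo --> 0%E,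
            {ae mu, forall z, D z -> (fun n => w n z) @ \oo --> winf z},
            (forall n A, F n A ->
              \int[mu]_(z in A) w n z = \int[mu]_(z in A) winf z) &
            forall n, is_cond_exp mu D (F n) winf (w n)]].
Proof.
have mO : measurable Omega by exact: open_measurable_rV.
have [c OK] := bounded_obox Omega_bounded.
have Ooo : (lebesgue_rV R d Omega < +oo)%E.
  apply: le_lt_trans (ltry (\prod_(i < d) Num.max ((const_mx c : 'rV[R]_d) 0 i - (const_mx (- c) : 'rV[R]_d) 0 i) 0)).
  rewrite -lebesgue_oboxE; apply: le_measure => //; rewrite inE//; exact: measurable_obox.
have [C uC] := u_bounded.
have sv k : sqint (lebesgue_rV R d) (u (eps k) \_ Omega) by have [/Lfun2P] := uC _ (eps_pos k).
(* The hypothesis bounds norms, the lemmas use squared norms: hence [C ^ 2]. *)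
have vC k : \int[lebesgue_rV R d]_x ((u (eps k) \_ Omega) x ^+ 2) <= C ^+ 2.
  have [_] := uC _ (eps_pos k); rewrite /L2norm (sqint_Lnorm2 (sv k)) lee_fin => le.
  rewrite -[leLHS]sqr_sqrtr ?ge0_sqint_integral//.
  by rewrite ler_pXn2r ?nnegrE ?sqrtr_ge0//; apply: le_trans le; exact: sqrtr_ge0.
have p0 n : p n != 0 by rewrite gt_eqF.
(* The ratios are given as real numbers; these identities are pulled back to natural numbers, where
   the digit arithmetic of the shuffle takes place. *)
have M0 : M 0%N = 1%N by apply/eqP; rewrite -(eqr_nat R) M_def divff.
have MS n : M n.+1 = (M n * m n.+1)%N.
  apply/eqP; rewrite -(eqr_nat R) natrM !M_def m_def; apply/eqP; field.
  by rewrite !p0.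
have m_gt0 n : (0 < m n.+1)%N by rewrite -(ltr_nat R) m_def divr_gt0.
have pM n : p n = (M n)%:R * p 0%N by rewrite M_def divfK.
have pm n : p n.+1 = (m n.+1)%:R * p n by rewrite m_def divfK.
pose ut n := u0 n \_ (Omega `*` cube (p n)).
have sut n : sqint (lebesgue_rV R d \x lebesgue_rV R d)%E (ut n).
  exact: two_scale_sqint (u_two_scale n).
have ut0 n (z : 'rV[R]_d * 'rV[R]_d) : ~ Omega z.1 -> ut n z = 0.
  by move=> nz; rewrite /ut patchE memNset// => -[].
have utC n : \int[(lebesgue_rV R d \x lebesgue_rV R d)%E]_z (ut n z ^+ 2) <= p n ^+ d * C ^+ 2.
  exact: (two_scale_norm_le mO Ooo (p_pos n) OK eps_pos eps_cvg sv (u_two_scale n) vC).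
have ut_avg n : {ae (lebesgue_rV R d \x lebesgue_rV R d)%E, forall z, (Omega `*` hcube (p n)) z ->
    ut n z = ((m n.+1)%:R ^+ d)^-1 * \sum_(b : {ffun 'I_d -> 'I_(m n.+1)})
      ut n.+1 (z.1, z.2 + p n *: gridpt R b)}.
  have ts := u_two_scale n.+1; rewrite /ut pm; rewrite pm in ts.
  exact: (two_scale_average mO Ooo (p_pos n) OK sv (m_gt0 n) (u_two_scale n) ts).
move=> leb mu D F w.
pose g := shuffled p ut MS m_gt0.
have mD : measurable D by exact: measurable_shuffle_domain.
have Mn n : (0 < M n)%N by exact: (M_gt0 M0 MS m_gt0).
have gS := shuffled_sqint p_pos M0 MS m_gt0 pM sut utC.
have gc n := @shuffled_same_cell R d p M m ut MS m_gt0 n.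
apply: (@L2_martingale_summary _ _ R mu D mD _ (same_cell M) F g w (p 0%N ^+ d * C ^+ 2)).
- exact: lebesgue_domain_lty.
- exact: (same_cell_decr M0 MS m_gt0).
- by move=> n B; exact: shuffle_fieldP.
- by move=> n z z'; exact: same_cell_sym.
- by move=> n; exact: smallest_sigma_algebra.
- move=> n; apply: measurable_for_shuffle_field => //; first by case: (gS n) => -[].
  exact: gc.
- by move=> n; split; [case: (gS n)|exact: gc].
- move=> n h [sh hc].
  exact: (shuffled_step p_pos M0 MS m_gt0 pM sut ut0 utC ut_avg sh hc).
- by move=> n; case: (gS n).
- by move=> n; apply: (measurable_two_scale_shuffle M m p_pos mO); case: (sut n).
(* Almost every point of [D] avoids the upper faces, and there the given sequence and its version
   coincide. *)
move=> n; apply: filterS (ae_domain_hcube mO (p_pos 0%N)) => -[[x y] y'] h Dz.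
have [hy hy'] := h Dz; case: Dz => -[Ox _] _.
exact: (two_scale_shuffleE u0 p_pos M0 MS m_gt0 pM).
Qed.
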